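(* Let $F=\mathbb{Q}(\sqrt D)$ with $D>1$ squarefree, $D\notin\{2,3,5\}$, and let $L$ be a totally positive definite ternary quadratic $\mathcal{O}_F$-lattice which is universal. Then $D\in\{6,7,10,13,17,21,33,41,65,77\}$, and moreover: if $D=6$, $L$ corresponds to $\varphi_1^{(6)}$, $\varepsilon_6\varphi_1^{(6)}$, $\varphi_2^{(6)}$ or $\varepsilon_6\varphi_2^{(6)}$; if $D=7$, $L$ corresponds to $\varphi^{(7)}$ or $\varepsilon_7\varphi^{(7)}$; if $D=10$, $L$ is non-free and corresponds to $\varphi^{(10)}$; if $D=13$, $L$ corresponds to $\varphi_{24}^{(13)}$, $\varphi_{12}^{(13)}$, $(\varphi_{12}^{(13)})'$, $\varphi_{\mathrm{h2}}^{(13)}$, $(\varphi_{\mathrm{h2}}^{(13)})'$, $\varphi_{\mathrm{h3}}^{(13)}$, $\varphi_{\mathrm{nm}}^{(13)}$ or $(\varphi_{\mathrm{nm}}^{(13)})'$; if $D=17$, $L$ corresponds to $\varphi_1^{(17)}$, $(\varphi_1^{(17)})'$, $\varphi_2^{(17)}$, $\varphi_3^{(17)}$, $(\varphi_3^{(17)})'$, $\varphi_{\mathrm{nm1}}^{(17)}$, $(\varphi_{\mathrm{nm1}}^{(17)})'$, $\varphi_{\mathrm{nm2}}^{(17)}$, $(\varphi_{\mathrm{nm2}}^{(17)})'$, $\varphi_{\mathrm{nm3}}^{(17)}$ or $(\varphi_{\mathrm{nm3}}^{(17)})'$; if $D=21$, $L$ corresponds to $\varphi^{(21)}$ or $\varepsilon_{21}\varphi^{(21)}$;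 if $D=33$, $L$ corresponds to $\varphi^{(33)}$ or $\varepsilon_{33}\varphi^{(33)}$; if $D=41$, $L$ corresponds to $\varphi^{(41)}$; if $D=65$, $L$ is non-free and corresponds to $\varphi^{(65)}$; if $D=77$, $L$ corresponds to $\varphi^{(77)}$ or $\varepsilon_{77}\varphi^{(77)}$.
   Context: A quadratic $\mathcal{O}_F$-lattice is a finitely generated $\mathcal{O}_F$-submodule $L$ of a quadratic space $(V,Q)$ over $F$ with $Q(L)\subseteq\mathcal{O}_F$ (not necessarily classical); universal means $Q(v)$ is totally positive for all nonzero $v\in L$ and $Q(L\setminus\{0\})$ equals the set of totally positive elements of $\mathcal{O}_F$. $\omega_D=\frac{1+\sqrt D}{2}$ if $D\equiv1\pmod4$, $\omega_D=\sqrt D$ otherwise; $'$ denotes Galois conjugation, and for a form $\varphi$, $\varphi'$ is the form with conjugated coefficients. $\varepsilon_6=5+2\sqrt6$, $\varepsilon_7=8+3\sqrt7$, $\varepsilon_{21}=(5+\sqrt{21})/2$, $\varepsilon_{33}=23+4\sqrt{33}$, $\varepsilon_{77}=(9+\sqrt{77})/2$. For $D=10$, $\mathfrak p_2^{-1}=\mathbb{Z}\cdot1+\mathbb{Z}\cdot\frac{\sqrt{10}}{2}$; for $D=65$, $\mathfrak p_2^{-1}=\mathbb{Z}\cdot1+\mathbb{Z}\cdot\frac{1+\omega_{65}}{2}$. A free ternary lattice $L$ corresponds to a ternary form $\varphi$ if it has an $\mathcal{O}_F$-basis $b_1,b_2,b_3$ with $Q(xb_1+yb_2+zb_3)=\varphi(x,y,z)$;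 a lattice $L=\mathcal{O}_Fb_1+\mathcal{O}_Fb_2+\mathfrak p_2^{-1}b_3$ ($b_i$ linearly independent) corresponds to $\varphi$ if $Q(xb_1+yb_2+zb_3)=\varphi(x,y,z)$ for $x,y\in\mathcal{O}_F$, $z\in\mathfrak p_2^{-1}$. The forms are: $\varphi_1^{(6)}=x^2+y^2+2z^2+xz+\sqrt6yz$; $\varphi_2^{(6)}=x^2+3y^2+(3+\sqrt6)z^2+xy+(2+\sqrt6)xz$; $\varphi^{(7)}=x^2+y^2+2z^2+\sqrt7yz$; $\varphi_{24}^{(13)}=x^2+y^2+2z^2+\omega_{13}xz+\omega_{13}'yz$; $\varphi_{12}^{(13)}=x^2+y^2+2z^2+xy+\omega_{13}yz$; $\varphi_{\mathrm{h2}}^{(13)}=x^2+2y^2+(3+\omega_{13})z^2+\omega_{13}xy+2xz$; $\varphi_{\mathrm{h3}}^{(13)}=x^2+y^2+(2+\omega_{13})z^2+\omega_{13}yz$; $\varphi_{\mathrm{nm}}^{(13)}=x^2+2y^2+(2+\omega_{13})z^2+\omega_{13}xz+\omega_{13}yz$; $\varphi_1^{(17)}=x^2+y^2+2z^2+xz+\omega_{17}yz$; $\varphi_2^{(17)}=x^2+2y^2+2z^2+\omega_{17}xy+\omega_{17}'xz-yz$; $\varphi_3^{(17)}=x^2+4y^2+6z^2+(1-\omega_{17})xz+(1-4\omega_{17})yz$; $\varphi_{\mathrm{nm1}}^{(17)}=x^2+y^2+2z^2+\omega_{17}yz$; $\varphi_{\mathrm{nm2}}^{(17)}=x^2+(2+\omega_{17})y^2+(6+2\omega_{17})z^2+(1+\omega_{17})xy+3xz$;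 $\varphi_{\mathrm{nm3}}^{(17)}=x^2+(2+\omega_{17})y^2+3z^2+\omega_{17}xz+2yz$; $\varphi^{(21)}=x^2+y^2+\varepsilon_{21}z^2+(1-\varepsilon_{21})yz$; $\varphi^{(33)}=x^2+y^2+2\varepsilon_{33}z^2+(7+3\omega_{33})xz+(2+\omega_{33})yz$; $\varphi^{(41)}=x^2+4y^2+(15-4\omega_{41})z^2+3xy+(4-\omega_{41})xz$; $\varphi^{(77)}=x^2+y^2+2\varepsilon_{77}z^2+(\varepsilon_{77}-1)yz$; $\varphi^{(10)}=x^2+(4+\sqrt{10})y^2+4z^2+2xz+(6+\sqrt{10})yz$ (with $z\in\mathfrak p_2^{-1}$); $\varphi^{(65)}=x^2+2y^2+4z^2+xy+2xz+(2-\omega_{65})yz$ (with $z\in\mathfrak p_2^{-1}$). *)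

(* Defs.v *)
From HB Require Import structures.
From mathcomp Require Import all_boot all_order all_algebra all_field.

Set Implicit Arguments.
Unset Strict Implicit.
Unset Printing Implicit Defensive.

Import GRing.Theory.
Local Open Scope ring_scope.

Definition squarefree (n : nat) : Prop := forall d : nat, (d ^ 2 %| n)%N -> d = 1%N.

(* Either square root of D may play the role of [s]. *)
Definition is_quadratic_field (D : nat) (F : fieldExtType rat) (s : F) : Prop :=
  s ^+ 2 = D%:R /\ <<1%VS; s>>%VS = fullv.

Section Field.

Variable F : fieldExtType rat.

Definition OF (x : F) : Prop := integralOver (intr : int -> F) x.

(* In algC, [0 < z] entails that z is real, and every embedding of a real
   quadratic field into algC is real. *)
Definition totally_positive (x : F) : Prop :=
  forall sigma : {rmorphism F -> algC}, 0 < sigma x.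

(* a + b * s |-> a - b * s, for a, b rational; meaningful when (1, s) is a
   basis of F over the rationals. *)
Definition gconj (s x : F) : F :=
  coord [tuple 1; s] 0 x *: 1 - coord [tuple 1; s] 1 x *: s.

Definition omega (D : nat) (s : F) : F :=
  if (D %% 4 == 1)%N then (1 + s) / 2 else s.

Section Lattice.

Variable V : vectType F.
Implicit Types (Q : V -> F) (L : V -> Prop) (e : seq V).

Definition polar Q (u v : V) : F := Q (u + v) - Q u - Q v.

Definition quadratic_map Q : Prop :=
  (forall (a : F) (v : V), Q (a *: v) = a ^+ 2 * Q v)
  /\ (forall u : V, scalar (polar Q u)).

Definition OF_span e (v : V) : Prop :=
  exists2 c : 'I_(size e) -> F,
    forall i, OF (c i) & v = \sum_i c i *: e`_i.

(* The rank of the lattice generated by e is the dimension of its F-span. *)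
Definition quadratic_lattice (r : nat) Q L : Prop :=
  [/\ quadratic_map Q,
      exists e, (forall v, L v <-> OF_span e v) /\ \dim <<e>>%VS = r
    & forall v, L v -> OF (Q v)].

Definition totally_positive_definite Q L : Prop :=
  forall v, L v -> v != 0 -> totally_positive (Q v).

Definition universal Q L : Prop :=
  totally_positive_definite Q L
  /\ forall a : F,
       (exists v, [/\ L v, v != 0 & Q v = a]) <-> (OF a /\ totally_positive a).

(* [free] is linear independence over F, equivalently over the ring of
   integers. *)
Definition free_lattice L : Prop :=
  exists e, free e /\ (forall v, L v <-> OF_span e v).

End Lattice.

(* a x^2 + b y^2 + c z^2 + d x y + e x z + f y z *)
Record ternary_form := TForm {
  cxx : F; cyy : F; czz : F; cxy : F; cxz : F; cyz : F }.

Definition eval_form (phi : ternary_form) (x y z : F) : F :=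
  cxx phi * x ^+ 2 + cyy phi * y ^+ 2 + czz phi * z ^+ 2
  + cxy phi * (x * y) + cxz phi * (x * z) + cyz phi * (y * z).

Definition map_form (h : F -> F) (phi : ternary_form) : ternary_form :=
  TForm (h (cxx phi)) (h (cyy phi)) (h (czz phi))
        (h (cxy phi)) (h (cxz phi)) (h (cyz phi)).

Definition scale_form (c : F) : ternary_form -> ternary_form :=
  map_form (fun x => c * x).

Definition conj_form (s : F) : ternary_form -> ternary_form :=
  map_form (gconj s).

(* L = OF b1 + OF b2 + A b3 with the b_i linearly independent, and Q is given
   by phi in the coordinates (x, y, z). *)
Definition corresponds_with (A : F -> Prop) (V : vectType F) (Q : V -> F)
    (L : V -> Prop) (phi : ternary_form) : Prop :=
  exists b1 b2 b3 : V,
    [/\ free [:: b1; b2; b3],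
        forall v, L v <-> exists x y z : F,
          [/\ OF x, OF y, A z & v = x *: b1 + y *: b2 + z *: b3]
      & forall x y z : F, OF x -> OF y -> A z ->
          Q (x *: b1 + y *: b2 + z *: b3) = eval_form phi x y z].

Definition corresponds (V : vectType F) :=
  @corresponds_with OF V.

Section Forms.

Variable s : F.

(* Inverses of the prime above 2, for D = 10 and D = 65. *)
Definition p2inv10 (z : F) : Prop :=
  exists a b : int, z = a%:~R + b%:~R * (s / 2).

Definition p2inv65 (z : F) : Prop :=
  exists a b : int, z = a%:~R + b%:~R * ((1 + omega 65 s) / 2).

Definition eps6 : F := 5 + 2 * s.
Definition eps7 : F := 8 + 3 * s.
Definition eps21 : F := (5 + s) / 2.
Definition eps33 : F := 23 + 4 * s.
Definition eps77 : F := (9 + s) / 2.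

Definition phi6_1 := TForm 1 1 2 0 1 s.
Definition phi6_2 := TForm 1 3 (3 + s) 1 (2 + s) 0.

Definition phi7 := TForm 1 1 2 0 0 s.

Definition phi10 := TForm 1 (4 + s) 4 0 2 (6 + s).

Definition phi13_24 := let w := omega 13 s in TForm 1 1 2 0 w (gconj s w).
Definition phi13_12 := let w := omega 13 s in TForm 1 1 2 1 0 w.
Definition phi13_h2 := let w := omega 13 s in TForm 1 2 (3 + w) w 2 0.
Definition phi13_h3 := let w := omega 13 s in TForm 1 1 (2 + w) 0 0 w.
Definition phi13_nm := let w := omega 13 s in TForm 1 2 (2 + w) 0 w w.

Definition phi17_1 := let w := omega 17 s in TForm 1 1 2 0 1 w.
Definition phi17_2 := let w := omega 17 s in TForm 1 2 2 w (gconj s w) (-1).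
Definition phi17_3 := let w := omega 17 s in
  TForm 1 4 6 0 (1 - w) (1 - 4 * w).
Definition phi17_nm1 := let w := omega 17 s in TForm 1 1 2 0 0 w.
Definition phi17_nm2 := let w := omega 17 s in
  TForm 1 (2 + w) (6 + 2 * w) (1 + w) 3 0.
Definition phi17_nm3 := let w := omega 17 s in TForm 1 (2 + w) 3 0 w 2.

Definition phi21 := TForm 1 1 eps21 0 0 (1 - eps21).

Definition phi33 := let w := omega 33 s in
  TForm 1 1 (2 * eps33) 0 (7 + 3 * w) (2 + w).

Definition phi41 := let w := omega 41 s in
  TForm 1 4 (15 - 4 * w) 3 (4 - w) 0.

Definition phi65 := let w := omega 65 s in TForm 1 2 4 1 2 (2 - w).

Definition phi77 := TForm 1 1 (2 * eps77) 0 0 (eps77 - 1).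

End Forms.

End Field.

(* Main.v *)
(* By universality L represents 1, 2, and so on. By the Cauchy-Schwarz inequality at
   both real places, a vector representing a given element has only finitely many
   possible polars with the vectors already found, so the possible Gram matrices form a
   finitely branching tree. Once three independent vectors are found, any further vector
   is determined by its polars with them, and these satisfy an equation expressing the
   vanishing of a Gram determinant; this kills most of the branches, and adjoining the
   further vectors on the others leads to one of the listed lattices inside L. A verified
   checker explores the tree along certificates naming the elements to be represented;
   only discriminants up to 1760 are needed, because for larger ones vectors representing
   1, 2 and 3 or 5 are forced to have rational polars with a vector whose norm is
   irrational. A proper overlattice of a listed lattice of prime index contains an earlier
   listed lattice, so L itself is in the list. For D = 10 and D = 65 the lattice found is
   not free, since its Steinitz class is that of a nonprincipal prime above 2. *)

Require Import Defs.
From HB Require Import structures.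
From Stdlib Require Import ZArith Lia List.
From mathcomp Require Import all_boot all_order all_algebra all_field.
From mathcomp Require Import zify ssrZ ring.

Set Implicit Arguments.
Unset Strict Implicit.
Unset Printing Implicit Defensive.

Import Order.TTheory GRing.Theory Num.Theory.
Local Open Scope ring_scope.

(** * The field and its integers *)

(** All Gram entries are polars $B(u,v)=Q(u+v)-Q(u)-Q(v)$, with $B(v,v)=2Q(v)$. They are integral
    even when the lattice is not classical, which is why norms appear doubled throughout. An element
    of a real quadratic field is totally positive exactly when its trace and norm are positive, so
    every test becomes a computation with pairs of binary integers.

    The obstacle in building the tree is linear dependence: a vector representing the next element
    may lie in the span of those already found, and then no larger frame arises. The first two
    extensions therefore refuse an element as soon as a degenerate Gram determinant occurs among the
    candidates, and the certificates have to name elements for which this does not happen.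

    After the third vector the frame usually spans too small a lattice. Further vectors are
    therefore kept by their polars alone, and a target may be exhibited by combinations that use
    them.

    Only soundness is at stake: a box that is too large costs time, and a badly chosen certificate
    makes the check fail. *)

Lemma squarefree_nonsquare D (q : rat) :
  (1 < D)%N -> squarefree D -> q ^+ 2 != D%:R.
Proof.
move=> D_gt1 D_sqf; apply/eqP => qD.
have : numq q * numq q = D%:Z * (denq q * denq q).
  apply: (@intr_inj rat); rewrite !rmorphM /= numqE mulrACA -!expr2 qD.
  by rewrite -pmulrn.
move/(congr1 absz); rewrite !abszM absz_nat => e.
have cop := coprime_num_den q.
have den1 : `|denq q|%N = 1%N.
  have : (`|denq q| %| `|numq q| * `|numq q|)%N by rewrite e mulnA dvdn_mull.
  rewrite Gauss_dvdr 1?coprime_sym // => h; apply/eqP; rewrite -dvdn1.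
  by rewrite -(eqP cop) dvdn_gcd h dvdnn.
rewrite den1 !muln1 in e.
have := D_sqf `|numq q|%N; rewrite expnS expn1 e dvdnn => /(_ isT) n1.
by move: D_gt1; rewrite -e n1.
Qed.

(** * Rational coordinates and embeddings of a quadratic field *)

Section QuadraticField.

Variables (D : nat) (F : fieldExtType rat) (s : F).
Hypotheses (D_gt1 : (1 < D)%N) (D_sqf : squarefree D).
Hypothesis F_eq : is_quadratic_field D s.

Let ss : s * s = D%:R. Proof. by rewrite -expr2; case: F_eq. Qed.

Let al : {rmorphism rat -> F} := in_alg F.
Let alE a : a%:A = al a. Proof. by []. Qed.

Lemma quad_span (x : F) : exists a b : rat, x = a%:A + b%:A * s.
Proof.
have : x \in <<1%VS; s>>%VS by rewrite F_eq.2 memvf.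
case/Fadjoin_polyP => p /polyOver1P [q ->] ->.
elim/poly_ind: q => [|q c [a [b e]]].
  by exists 0, 0; rewrite map_poly0 horner0 !scale0r mul0r addr0.
exists (b * D%:R + c), a.
rewrite rmorphD rmorphM /= map_polyX map_polyC hornerD hornerM hornerX hornerC e.
rewrite !alE rmorphD rmorphM rmorph_nat -ss; ring.
Qed.

Lemma s_notin : s \notin 1%VS.
Proof.
apply/vlineP => -[q e]; have := ss.
rewrite e !alE -rmorphM -(rmorph_nat al) => /fmorph_inj /eqP.
by rewrite -expr2 (negbTE (squarefree_nonsquare _ _ _)).
Qed.

Lemma quad_inj0 a b : a%:A + b%:A * s = 0 -> a = 0 /\ b = 0.
Proof.
rewrite !alE => e; suff b0 : b = 0.
  by move: e; rewrite b0 rmorph0 mul0r addr0 => /eqP; rewrite fmorph_eq0 => /eqP.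
apply/eqP/negPn/negP => nz; case/negP: s_notin; apply/vlineP.
exists (- a / b); rewrite alE rmorphM fmorphV rmorphN.
have nz' : al b != 0 by rewrite fmorph_eq0.
by apply: (mulfI nz'); rewrite mulrCA divff // mulr1 -[LHS]subr0 -e; ring.
Qed.

Lemma quad_inj a b c d :
  a%:A + b%:A * s = c%:A + d%:A * s -> a = c /\ b = d.
Proof.
move=> e; have [] := @quad_inj0 (a - c) (b - d).
  rewrite !alE in e *; rewrite !rmorphB -[RHS](subrr (al a + al b * s)) {2}e.
  by ring.
by move=> /eqP; rewrite subr_eq0 => /eqP -> /eqP; rewrite subr_eq0 => /eqP ->.
Qed.

Lemma quad_basis : basis_of fullv [tuple 1; s].
Proof.
rewrite basisEfree; apply/and3P; split.
- apply/freeP => k; rewrite !big_ord_recl big_ord0 addr0 /=.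
  rewrite -[k _ *: s]mulr_algl => /quad_inj0 [k0 k1] i.
  by case: i => [[|[|//]] h]; [rewrite -[RHS]k0 | rewrite -[RHS]k1];
    congr (k _); apply: val_inj.
- exact: subvf.
- apply: leq_trans (dimvS _) (dim_span [:: 1; s]).
  apply/subvP => x _; have [a [b ->]] := quad_span x.
  by rewrite mulr_algl memvD // memvZ // memv_span // !inE eqxx ?orbT.
Qed.

Definition re (x : F) : rat := coord [tuple 1; s] 0 x.
Definition im (x : F) : rat := coord [tuple 1; s] 1 x.

Lemma quadE x : x = (re x)%:A + (im x)%:A * s.
Proof.
rewrite {1}(coord_basis quad_basis (memvf x)) !big_ord_recl big_ord0 addr0 /=.
rewrite mulr_algl /re /im; congr (_ + coord _ _ _ *: _); exact: val_inj.
Qed.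

Lemma re_quad a b : re (a%:A + b%:A * s) = a.
Proof. by have [] := quad_inj (quadE (a%:A + b%:A * s)). Qed.

Lemma im_quad a b : im (a%:A + b%:A * s) = b.
Proof. by have [] := quad_inj (quadE (a%:A + b%:A * s)). Qed.

Lemma gconjE a b : gconj s (a%:A + b%:A * s) = a%:A - b%:A * s.
Proof. by rewrite /gconj -/(re _) -/(im _) re_quad im_quad mulr_algl. Qed.

Variables (e : algC) (ee : e * e = D%:R).

(** The two square roots [e] of [D] give the two embeddings of the field. *)
Definition emb (x : F) : algC := ratr (re x) + ratr (im x) * e.

Lemma emb_quad a b : emb (a%:A + b%:A * s) = ratr a + ratr b * e.
Proof. by rewrite /emb re_quad im_quad. Qed.

Fact emb_is_zmod : zmod_morphism emb.
Proof.
move=> x y; rewrite (quadE x) (quadE y).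
have -> : (re x)%:A + (im x)%:A * s - ((re y)%:A + (im y)%:A * s)
  = (re x - re y)%:A + (im x - im y)%:A * s.
  by rewrite !alE !rmorphB; ring.
by rewrite !emb_quad !rmorphB; ring.
Qed.

Fact emb_is_monoid : monoid_morphism emb.
Proof.
split=> [|x y].
  have -> : 1 = 1%:A + 0%:A * s :> F by rewrite scale0r mul0r addr0 scale1r.
  by rewrite emb_quad rmorph1 rmorph0 mul0r addr0.
rewrite (quadE x) (quadE y).
have -> : ((re x)%:A + (im x)%:A * s) * ((re y)%:A + (im y)%:A * s)
  = (re x * re y + im x * im y * D%:R)%:A + (re x * im y + im x * re y)%:A * s.
  by rewrite !alE !(rmorphD, rmorphM) rmorph_nat -ss; ring.
by rewrite !emb_quad !(rmorphD, rmorphM) /= ratr_nat -ee; ring.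
Qed.

HB.instance Definition _ := GRing.isZmodMorphism.Build F algC emb emb_is_zmod.
HB.instance Definition _ := GRing.isMonoidMorphism.Build F algC emb emb_is_monoid.

Definition emb_rmorphism : {rmorphism F -> algC} := emb.

End QuadraticField.

Section ConjugateEmbeddings.

Variables (D : nat) (F : fieldExtType rat) (s : F).
Hypotheses (D_gt1 : (1 < D)%N) (D_sqf : squarefree D).
Hypothesis F_eq : is_quadratic_field D s.

(** [totally_positive] ranges over all embeddings; this pair, exchanged by conjugation, is what
    extracts the signs of trace and norm from it. *)
Lemma conjugate_embeddings :
  exists f g : {rmorphism F -> algC}, forall x, g x = f (gconj s x).
Proof.
have e1 : sqrtC D%:R * sqrtC D%:R = D%:R :> algC by rewrite -expr2 sqrtCK.
have e2 : (- sqrtC D%:R) * (- sqrtC D%:R) = D%:R :> algC by rewrite mulrNN e1.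
exists (emb_rmorphism D_gt1 D_sqf F_eq e1), (emb_rmorphism D_gt1 D_sqf F_eq e2).
move=> x; rewrite (quadE D_gt1 D_sqf F_eq x) (gconjE D_gt1 D_sqf F_eq).
have -> : (re s x)%:A - (im s x)%:A * s = (re s x)%:A + (- im s x)%:A * s.
  by rewrite scaleNr mulNr.
by rewrite /= !(emb_quad D_gt1 D_sqf F_eq) rmorphN mulrN mulNr.
Qed.

End ConjugateEmbeddings.

(** * Certificates *)

(* (a, b) stands for a + b omega, where omega^2 = t omega + n. *)
Definition K : Type := (Z * Z)%type.

Section Arithmetic.

Local Open Scope Z_scope.

Variables t n : Z.

Definition kadd (x y : K) : K := (x.1 + y.1, x.2 + y.2).
Definition kopp (x : K) : K := (- x.1, - x.2).
Definition ksub (x y : K) : K := (x.1 - y.1, x.2 - y.2).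
Definition kmul (x y : K) : K :=
  let bd := (x.2 * y.2) in
  (x.1 * y.1 + n * bd, x.1 * y.2 + x.2 * y.1 + t * bd).
Definition kdbl (x : K) : K := (2 * x.1, 2 * x.2).
Definition kconj (x : K) : K := (x.1 + t * x.2, - x.2).
Definition ktr (x : K) : Z := (2 * x.1 + t * x.2).
Definition knm (x : K) : Z := (x.1 * x.1 + t * (x.1 * x.2) - n * (x.2 * x.2)).
(** Explicit conditionals replace [&&] in the tests evaluated most often: under call by value both
    arguments of [andb] would be computed. *)
Definition keq (x y : K) : bool := if x.1 =? y.1 then x.2 =? y.2 else false.
Definition kzero : K := (0, 0).
Definition knonneg (x : K) : bool := if 0 <=? ktr x then 0 <=? knm x else false.
Definition kpos (x : K) : bool := (0 <? ktr x) && (0 <? knm x).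
(** Selects one of [x] and [- x]; zero counts as leading, so that no candidate is lost. *)
Definition kleading (x : K) : bool :=
  if 0 <? x.1 then true else if x.1 =? 0 then 0 <=? x.2 else false.
(** Meaningful only when [d] divides [x]: otherwise the coordinates are rounded. *)
Definition kdiv (x d : K) : K :=
  let y := kmul x (kconj d) in (y.1 / knm d, y.2 / knm d).
Definition kdvd (d x : K) : bool := keq (kmul (kdiv x d) d) x.

Definition zrange (lo hi : Z) : seq Z :=
  [seq (lo + Z.of_nat i) | i <- iota O (Z.to_nat (hi - lo + 1))].

(* x^2 has trace ((2a + tb)^2 + (t^2 + 4n) b^2) / 2 for x = a + b omega. *)
Definition square_box (c : K) : seq K :=
  let m := (2 * ktr c) in
  let disc := (t * t + 4 * n) in
  let r := Z.sqrt (m / disc) in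
  flatten [seq let r' := Z.sqrt (m - disc * (b * b)) in
               (* Both ends of the range given by $|2a+tb|\le r'$ are rounded inwards; the lower one
                  is minus a floor. *)
               [seq x <- [seq (a, b) | a <- zrange (- ((r' + t * b) / 2))
                                                   ((r' - t * b) / 2)]
                  | knonneg (ksub c (kmul x x))]
          | b <- zrange (- r) r].

Definition vec3 : Type := (K * K * K)%type.

Record gram3 := Gram { g11 : K; g12 : K; g13 : K; g22 : K; g23 : K; g33 : K }.

Definition adj_gram (G : gram3) : gram3 :=
  let: Gram a b c d e f := G in
  Gram (ksub (kmul d f) (kmul e e)) (ksub (kmul c e) (kmul b f))
       (ksub (kmul b e) (kmul c d)) (ksub (kmul a f) (kmul c c))
       (ksub (kmul b c) (kmul a e)) (ksub (kmul a d) (kmul b b)).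

Definition gram_app (G : gram3) (v : vec3) : vec3 :=
  let: (x, y, z) := v in
  (kadd (kmul (g11 G) x) (kadd (kmul (g12 G) y) (kmul (g13 G) z)),
   kadd (kmul (g12 G) x) (kadd (kmul (g22 G) y) (kmul (g23 G) z)),
   kadd (kmul (g13 G) x) (kadd (kmul (g23 G) y) (kmul (g33 G) z))).

Definition kdot (u v : vec3) : K :=
  kadd (kmul u.1.1 v.1.1) (kadd (kmul u.1.2 v.1.2) (kmul u.2 v.2)).

Definition gram_det (G : gram3) : K :=
  kdot (g11 G, g12 G, g13 G)
       (g11 (adj_gram G), g12 (adj_gram G), g13 (adj_gram G)).

Definition det2 (a b c : K) : K := ksub (kmul a c) (kmul b b).

(* The Gram matrix of the vectors found so far. In [State3 G ex] the vectors after the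
   third are recorded in [ex] by their polars with the first three. *)
Inductive state :=
  | State0
  | State1 of K
  | State2 of K & K & K
  | State3 of gram3 & seq vec3.

(* The extensions list the possible polars with a further vector of norm [al2] / 2,
   up to its sign; they fail if that vector may depend on the previous ones. *)
Definition extend1 (g al2 : K) : option (seq state) :=
  let c := kmul al2 g in
  let bs := [seq b <- square_box c | kleading b] in
  if has (fun b => keq c (kmul b b)) bs then None
  else Some [seq State2 g b al2 | b <- bs].

(** The number stored with a pair of polars is the determinant of the resulting Gram matrix of three
    vectors. Products that depend on one polar only are computed once. *)
Definition extend2 (a b c al2 : K) : option (seq state) :=
  let top := kmul al2 (det2 a b c) in
  let bx := [seq (x, kmul a (kmul x x)) | x <- square_box (kmul al2 c)] in
  let bx0 := [seq p <- bx | kleading p.1] in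
  let cand := flatten
    [seq let p11 := kmul c (kmul x x) in
         let p12 := kdbl (kmul b x) in
         [seq p <- [seq (ksub top (kadd (ksub p11 (kmul p12 p.1)) p.2), (x, p.1))
                   | p <- if keq x kzero then bx0 else bx]
            | knonneg p.1]
    | x <- square_box (kmul al2 a) & kleading x] in
  if has (fun p => keq p.1 kzero) cand then None
  else Some [seq State3 (Gram a b p.2.1 c p.2.2 al2) [::] | p <- cand].

(* A fourth vector depends on the frame, so its polars (x, y, z) with the frame satisfy
   a quadratic equation in z; its polars with the vectors of [ex] must be integral. *)
Definition extend3 (G : gram3) (ex : seq vec3) (al2 : K) : seq vec3 :=
  let A := adj_gram G in
  let d2 := g33 A in
  let d3 := gram_det G in
  let top := kmul al2 d2 in
  let top3 := kmul al2 d3 in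
  let bx := [seq (x, (kmul (g11 G) (kmul x x), kmul (g22 A) (kmul x x)))
            | x <- square_box (kmul al2 (g22 G))] in
  let bx0 := [seq p <- bx | kleading p.1] in
  let by_ := [seq (x, kmul (g33 A) (kmul x x))
             | x <- square_box (kmul al2 (g33 G))] in
  let by0 := [seq p <- by_ | kleading p.1] in
  let exA := [seq gram_app A e | e <- ex] in
  flatten
    [seq let xx := kmul x x in
         let p11 := kmul (g22 G) xx in
         let p12 := kdbl (kmul (g12 G) x) in
         let q11 := kmul (g11 A) xx in
         let q12 := kdbl (kmul (g12 A) x) in
         let q13 := kdbl (kmul (g13 A) x) in
         let x0 := keq x kzero in
         flatten
           [seq let y := p.1 in
                if knonneg (ksub top (kadd (ksub p11 (kmul p12 y)) p.2.1)) then
                  (* For [v = (x, y, z)] the Gram determinant of four vectors vanishes when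
                     $v^TAv=d_3\,\alpha$, where $\alpha$ is [al2]; as an equation in $z$ this is
                     $c=lz+A_{33}z^2$. *)
                  let c := ksub top3 (kadd q11 (kadd (kmul q12 y) p.2.2)) in
                  let l := kadd q13 (kdbl (kmul (g23 A) y)) in
                  [seq v <- [seq (x, y, q.1)
                            | q <- if x0 && keq y kzero then by0 else by_
                            & keq c (kadd (kmul l q.1) q.2)]
                     | all (fun e => kdvd d3 (kdot v e)) exA]
                else [::]
           | p <- if x0 then bx0 else bx]
    | x <- square_box (kmul al2 (g11 G)) & kleading x].

(* (r, k) stands for the combination of the frame by r and of the extra vectors by k. *)
Definition crow : Type := (vec3 * seq K)%type.

Definition vadd (u v : vec3) : vec3 :=
  (kadd u.1.1 v.1.1, kadd u.1.2 v.1.2, kadd u.2 v.2).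
Definition vscale (c : K) (v : vec3) : vec3 :=
  (kmul c v.1.1, kmul c v.1.2, kmul c v.2).

(* Coordinates in the frame, multiplied by the Gram determinant. *)
Definition row_num (G : gram3) (ex : seq vec3) (r : crow) : vec3 :=
  foldr (fun p v => vadd (vscale p.1 (gram_app (adj_gram G) p.2)) v)
        (vscale (gram_det G) r.1) (zip r.2 ex).

Definition row_polar (G : gram3) (ex : seq vec3) (r : crow) : vec3 :=
  foldr (fun p v => vadd (vscale p.1 p.2) v) (gram_app G r.1) (zip r.2 ex).

(** Pairing coordinates with polars gives the polar of two combinations; [row_num] carries a factor
    [gram_det G], removed by [kdiv]. *)
Definition change (G : gram3) (ex : seq vec3) (r1 r2 r3 : crow) (rs : seq crow) :
    option (gram3 * seq vec3) :=
  let q r r' :=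
    kdiv (kdot (row_num G ex r) (row_polar G ex r')) (gram_det G) in
  let G' := Gram (q r1 r1) (q r1 r2) (q r1 r3) (q r2 r2) (q r2 r3) (q r3 r3) in
  if keq (gram_det G') kzero then None
  else Some (G', [seq (q r1 e, q r2 e, q r3 e) | e <- rs]).

(** A certificate may be shared by many branches; [Either] then offers several ways to close each of
    them. *)
Inductive cert :=
  | Branch of K & seq cert
  | Either of cert & cert
  | Accept of nat & crow & crow & crow & seq crow.

Definition veq (u v : vec3) : bool :=
  [&& keq u.1.1 v.1.1, keq u.1.2 v.1.2 & keq u.2 v.2].
Definition gram_eq (G H : gram3) : bool :=
  [&& keq (g11 G) (g11 H), keq (g12 G) (g12 H), keq (g13 G) (g13 H),
      keq (g22 G) (g22 H), keq (g23 G) (g23 H) & keq (g33 G) (g33 H)].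

Fixpoint vseq_eq (s s' : seq vec3) : bool :=
  match s, s' with
  | [::], [::] => true
  | u :: s1, v :: s1' => veq u v && vseq_eq s1 s1'
  | _, _ => false
  end.

Definition branches (al : K) (st : state) : option (seq state) :=
  if ~~ kpos al then None else
  let al2 := kdbl al in
  match st with
  | State0 => Some [:: State1 al2]
  | State1 g => extend1 g al2
  | State2 a b c => extend2 a b c al2
  | State3 G ex => Some [seq State3 G (rcons ex v) | v <- extend3 G ex al2]
  end.

Variable targets : seq (gram3 * seq vec3).

(* [Branch al] represents [al] and treats each resulting lattice separately;
   [Accept i] exhibits the i-th target lattice in the current one by a new frame.
   The last certificate of a list serves all remaining branches. *)
Fixpoint run (c : cert) (st : state) : bool :=
  match c with
  | Branch al cs =>
    let fix go cs sts :=
      match cs with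
      | [::] => nilp sts
      | [:: c'] => all (run c') sts
      | c' :: cs' => if sts is st' :: sts' then run c' st' && go cs' sts' else true
      end in
    if branches al st is Some sts then go cs sts else false
  | Either c1 c2 => if run c1 st then true else run c2 st
  | Accept i r1 r2 r3 rs =>
    match st with
    | State3 G ex =>
      match change G ex r1 r2 r3 rs, onth targets i with
      | Some (G', ex'), Some (H, ex0) => gram_eq G' H && vseq_eq ex' ex0
      | _, _ => false
      end
    | _ => false
    end
  end.

End Arithmetic.

Delimit Scope Z_scope with BZ.
Local Arguments Z.mul : simpl never.
Local Arguments Z.add : simpl never.
Local Arguments Z.sub : simpl never.
Local Arguments Z.opp : simpl never.

Definition zr (R : pzRingType) (z : Z) : R := (int_of_Z z)%:~R.

Section IntegerCast.

Variable R : pzRingType.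
Local Notation zr := (zr R).

Lemma zrD a b : zr (Z.add a b) = zr a + zr b.
Proof. by rewrite /zr (rmorphD int_of_Z) intrD. Qed.
Lemma zrM a b : zr (Z.mul a b) = zr a * zr b.
Proof. by rewrite /zr (rmorphM int_of_Z) intrM. Qed.
Lemma zrN a : zr (Z.opp a) = - zr a.
Proof. by rewrite /zr (rmorphN int_of_Z) mulrNz. Qed.
Lemma zrB a b : zr (Z.sub a b) = zr a - zr b.
Proof. by rewrite zrD zrN. Qed.
Lemma zr0 : zr Z0 = 0. Proof. by []. Qed.
Lemma zr1 : zr 1%BZ = 1. Proof. by []. Qed.
Lemma zr2 : zr 2%BZ = 2. Proof. by []. Qed.
Lemma zr_int (m : int) : zr (Z_of_int m) = m%:~R.
Proof. by rewrite /zr Z_of_intK. Qed.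
Lemma zr_nat m : zr (Z.of_nat m) = m%:R.
Proof. by rewrite -[Z.of_nat m]/(Z_of_int (Posz m)) zr_int. Qed.

End IntegerCast.

Definition zrE := (zrD, zrB, zrM, zrN, zr0, zr1, zr2).

Lemma zr_gt0 (R : numDomainType) z : (0 < zr R z) = (0 <? z)%BZ.
Proof. by rewrite /zr ltr0z; apply/idP/idP; lia. Qed.
Lemma zr_inj (R : numDomainType) : injective (zr R).
Proof. by move=> a b /intr_inj /(can_inj int_of_ZK). Qed.
Lemma zr_rmorph (R S : pzRingType) (f : {rmorphism R -> S}) z :
  f (zr R z) = zr S z.
Proof. exact: rmorph_int. Qed.

Definition omega_tr (D : nat) : Z := if (D %% 4 == 1)%N then 1%BZ else 0%BZ.
(** Minus the norm of [omega]; when D is 1 modulo 4, [D %/ 4] is $(D-1)/4$. *)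
Definition omega_nm (D : nat) : Z :=
  if (D %% 4 == 1)%N then Z.of_nat (D %/ 4) else Z.of_nat D.

(** * The ring of integers as pairs of binary integers *)

Section Integers.

Variables (D : nat) (F : fieldExtType rat) (s : F).
Hypotheses (D_gt1 : (1 < D)%N) (D_sqf : squarefree D).
Hypothesis F_eq : is_quadratic_field D s.

Let ss : s * s = D%:R. Proof. by rewrite -expr2; case: F_eq. Qed.
Let al : {rmorphism rat -> F} := in_alg F.
Let alE a : a%:A = al a. Proof. by []. Qed.
Let al_inj : injective al. Proof. exact: fmorph_inj. Qed.

Lemma F_char0 (m : nat) : (m%:R == 0 :> F) = (m == 0)%N.
Proof. by rewrite -(rmorph_nat al) fmorph_eq0 pnatr_eq0. Qed.

Let two_neq0 : 2 != 0 :> F. Proof. by rewrite F_char0. Qed.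

Local Notation w := (omega D s).
Local Notation t := (omega_tr D).
Local Notation n := (omega_nm D).
Local Notation kmul := (kmul t n).
Local Notation kconj := (kconj t).

Lemma omega_sqr : w * w = zr F t * w + zr F n.
Proof.
rewrite /omega /omega_tr /omega_nm; case: eqP => [e|_].
  have Ds : s * s = 4 * (D %/ 4)%:R + 1.
    by rewrite ss {1}(divn_eq D 4) e natrD natrM mulrC.
  rewrite zr_nat zr1.
  have -> : (D %/ 4)%:R = (s * s - 1) / 4 :> F.
    by rewrite Ds; field; rewrite F_char0.
  by field; rewrite ?F_char0.
by rewrite zr_nat zr0 mul0r add0r ss.
Qed.

Definition phi (x : K) : F := zr F x.1 + zr F x.2 * w.

Lemma phi_add x y : phi (kadd x y) = phi x + phi y.
Proof. by rewrite /phi /kadd /= !zrE; ring. Qed.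
Lemma phi_sub x y : phi (ksub x y) = phi x - phi y.
Proof. by rewrite /phi /ksub /= !zrE; ring. Qed.
Lemma phi_opp x : phi (kopp x) = - phi x.
Proof. by rewrite /phi /kopp /= !zrE; ring. Qed.
Lemma phi_dbl x : phi (kdbl x) = 2 * phi x.
Proof. by rewrite /phi /kdbl /= !zrE; ring. Qed.
Lemma phi_mul x y : phi (kmul x y) = phi x * phi y.
Proof.
rewrite /phi /kmul /= !zrE.
have -> : zr F n = w * w - zr F t * w by rewrite omega_sqr; ring.
ring.
Qed.
Lemma phi0 : phi kzero = 0. Proof. by rewrite /phi /= !zrE mul0r addr0. Qed.
Lemma phi_int z : phi (z, Z0) = zr F z.
Proof. by rewrite /phi /= zr0 mul0r addr0. Qed.

Definition phiE := (phi_add, phi_sub, phi_opp, phi_dbl, phi_mul, phi0).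

Lemma quad_of_phi x :
  phi x = (zr rat (ktr t x) / 2)%:A
          + (if (D %% 4 == 1)%N then zr rat x.2 / 2 else zr rat x.2)%:A * s.
Proof.
rewrite !alE /phi /omega /ktr /omega_tr !fmorph_div rmorph_nat zr_rmorph.
case: eqP => _; rewrite ?fmorph_div ?rmorph_nat ?zr_rmorph !zrE; field;
  by rewrite F_char0.
Qed.

Lemma phi_inj : injective phi.
Proof.
move=> [a b] [c d]; rewrite !quad_of_phi => /(quad_inj D_gt1 D_sqf F_eq) [].
rewrite /ktr /= => e1 e2.
have bd : b = d.
  apply: (@zr_inj rat); move: e2; case: ifP => // _ /(congr1 (fun x => x * 2)).
  by rewrite !divfK.
move: e1 => /(congr1 (fun x => x * 2)); rewrite !divfK // => /zr_inj; rewrite bd.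
by move=> e; congr pair; lia.
Qed.

Lemma gconj_phi x : gconj s (phi x) = phi (kconj x).
Proof.
rewrite [in LHS]quad_of_phi (gconjE D_gt1 D_sqf F_eq) quad_of_phi /kconj /ktr /= !alE.
rewrite !fmorph_div !rmorph_nat !zr_rmorph /omega_tr.
case: eqP => _; rewrite ?fmorph_div ?rmorph_nat ?zr_rmorph !zrE; field;
  by rewrite F_char0.
Qed.

Lemma phi_tr x : phi x + phi (kconj x) = zr F (ktr t x).
Proof. by rewrite /phi /kconj /ktr /= !zrE; ring. Qed.

Lemma phi_nm x : phi x * phi (kconj x) = zr F (knm t n x).
Proof.
rewrite /phi /kconj /knm /= !zrE.
have -> : zr F n = w * w - zr F t * w by rewrite omega_sqr; ring.
ring.
Qed.

Lemma phi_nm_eq0 x : (knm t n x == 0) = (phi x == 0).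
Proof.
apply/idP/idP => [/eqP e|/eqP e]; last first.
  by apply/eqP/(@zr_inj rat)/al_inj; rewrite !zr_rmorph -phi_nm e mul0r.
have /eqP : phi x * phi (kconj x) = 0 by rewrite phi_nm e.
rewrite mulf_eq0 => /orP [//|/eqP c0].
have : gconj s (phi (kconj x)) = phi x.
  rewrite gconj_phi /kconj /=; congr phi; case: x {e c0} => a b /=.
  by congr pair; lia.
by rewrite c0 -phi0 gconj_phi /kconj /= Z.mul_0_r => <-; rewrite phi0.
Qed.

(** Trace and norm are the sum and product of the two conjugates; two real numbers are positive
    exactly when their sum and product are. *)
Lemma totally_positive_phi x : totally_positive (phi x) <-> kpos t n x.
Proof.
split=> [pos|/andP [tr_gt0 nm_gt0] f].
  have [f [g gE]] := conjugate_embeddings D_gt1 D_sqf F_eq.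
  have := pos g; have := pos f; rewrite gE gconj_phi => f1 f2.
  have := addr_gt0 f1 f2; have := mulr_gt0 f1 f2.
  rewrite -rmorphM -rmorphD phi_nm phi_tr !zr_rmorph !zr_gt0 /kpos => -> ->.
  done.
set p := f (phi x); set q := f (phi (kconj x)).
have pq_sum : 0 < p + q by rewrite -rmorphD phi_tr zr_rmorph zr_gt0.
have pq_prod : 0 < p * q by rewrite -rmorphM phi_nm zr_rmorph zr_gt0.
(* Positivity in [algC] includes being real, which holds because [f s] is a square root of D up to
   sign. *)
have p_real : p \is Num.real.
  have r_real : f s \is Num.real.
    have : f s ^+ 2 = sqrtC D%:R ^+ 2 by rewrite sqrtCK expr2 -rmorphM ss rmorph_nat.
    move/eqP; rewrite eqf_sqr => /orP [] /eqP ->; rewrite ?rpredN.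
      by rewrite ger0_real // sqrtC_ge0 ler0n.
    by rewrite ger0_real // sqrtC_ge0 ler0n.
  rewrite /p quad_of_phi rmorphD rmorphM !alE.
  have real_al a : f (al a) \is Num.real.
    by have := fmorph_eq_rat (f \o al) a; rewrite /= => ->; rewrite /ratr rpred_div ?rpred_int.
  by rewrite rpredD // rpredM.
(* Since $p(p+q)=p^2+pq$, the conjugate $p$ has the sign of the trace. *)
have : 0 < p * (p + q).
  by rewrite mulrDr; apply: ltr_wpDl => //; rewrite -expr2 real_exprn_even_ge0.
by rewrite pmulr_lgt0.
Qed.

Lemma knonneg_totally_positive x :
  phi x = 0 \/ totally_positive (phi x) -> knonneg t n x.
Proof.
case=> [e|/totally_positive_phi]; last first.
  by rewrite /kpos /knonneg => /andP [h1 h2]; have -> : (0 <=? ktr t x)%BZ; lia.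
by rewrite (@phi_inj x kzero) ?phi0 //; rewrite /knonneg /ktr /knm /= !Z.mul_0_r.
Qed.

Lemma OF_phi x : OF (phi x).
Proof.
pose p : {poly int} := ('X - (int_of_Z (ktr t x))%:P) * 'X + (int_of_Z (knm t n x))%:P.
exists p.
  rewrite /p monicE lead_coefDl; last first.
    rewrite size_mulX ?polyXsubC_eq0 // size_XsubC; exact: leq_ltn_trans (size_polyC_leq1 _) _.
  by rewrite lead_coefMX lead_coefXsubC.
rewrite /root /p rmorphD rmorphM rmorphB /= map_polyX !map_polyC /=.
rewrite hornerD hornerM hornerD hornerN !hornerC !hornerX.
rewrite -!/(zr F _) -phi_tr -phi_nm; apply/eqP; ring.
Qed.

(** Both images of an integral [x] in [algC] are algebraic integers, so their sum and product are
    too; being rational, these are integers. *)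
Lemma int_trace_norm x : OF x ->
  exists A N : int, 2 * re s x = A%:~R /\ re s x ^+ 2 - D%:R * im s x ^+ 2 = N%:~R.
Proof.
case=> p p_monic p_root.
have [f [g gE]] := conjugate_embeddings D_gt1 D_sqf F_eq.
have Af (h : {rmorphism F -> algC}) : h x \in Aint.
  apply: (@root_monic_Aint (map_poly intr p)).
  - move: p_root; rewrite -(fmorph_root h) -map_poly_comp /=.
    by congr (root _ _); apply: eq_map_poly => z /=; rewrite rmorph_int.
  - exact: monic_map.
  - by apply/polyOverP => i; rewrite coef_map rpred_int.
have fal (h : {rmorphism F -> algC}) a : h (al a) = ratr a.
  exact: (fmorph_eq_rat (h \o al)).
have ex : x = al (re s x) + al (im s x) * s := quadE D_gt1 D_sqf F_eq x.
have gx : gconj s x = al (re s x) - al (im s x) * s.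
  by rewrite {1}ex (gconjE D_gt1 D_sqf F_eq).
have prod_x : x * gconj s x = al (re s x ^+ 2 - D%:R * im s x ^+ 2).
  by rewrite gx {1}ex !expr2 rmorphB !rmorphM rmorph_nat -ss; ring.
have sum_x : x + gconj s x = al (2 * re s x).
  by rewrite gx {1}ex rmorphM rmorph_nat; ring.
have := rpredD (Af f) (Af g); have := rpredM (Af f) (Af g).
rewrite gE -(rmorphM f) -(rmorphD f) prod_x sum_x.
rewrite !fal => /Cint_rat_Aint + /Cint_rat_Aint.
rewrite !Crat_rat => /(_ isT) /intrP [N eN] /(_ isT) /intrP [A eA].
exists A, N; split; apply: (fmorph_inj (@ratr algC)); by rewrite /= ratr_int ?eA ?eN.
Qed.

Lemma OF_phiP x : OF x -> exists k, x = phi k.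
Proof.
move=> /int_trace_norm [A [N [eA eN]]].
(* With $q=2\,\mathrm{im}\,x$ the number $Dq^2=A^2-4N$ is an integer, so the square of the
   denominator of $q$ divides the squarefree D. *)
have [B eB] : exists B : int, 2 * im s x = B%:~R.
  set q := 2 * im s x.
  have e : D%:Z * (numq q * numq q) = (A * A - 4 * N) * (denq q * denq q).
    apply: (@intr_inj rat); rewrite !(rmorphM, rmorphB) /= numqE -eA -eN -pmulrn.
    rewrite /q; ring.
  exists (numq q); rewrite -[LHS]divq_num_den.
  suff -> : denq q = 1 by rewrite divr1.
  have cop := coprime_num_den q.
  have dv : (`|denq q| ^ 2 %| D)%N.
    have : (`|denq q| ^ 2 %| D * `|numq q| ^ 2)%N.
      by move/(congr1 absz): e; rewrite !abszM absz_nat !mulnn => ->; rewrite dvdn_mull.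
    by rewrite Gauss_dvdl // coprimeXl // coprimeXr // coprime_sym.
  by rewrite -[LHS]gtz0_abs ?denq_gt0 // (D_sqf dv).
have e : A ^+ 2 - D%:Z * B ^+ 2 = 4 * N.
  apply: (@intr_inj rat); rewrite !expr2 !(rmorphM, rmorphB) /= -eA -eB -eN.
  by rewrite -pmulrn; ring.
have D4 : (D %% 4 != 0)%N.
  by apply/negP => d4; have := D_sqf (d4 : 2 ^ 2 %| D)%N.
have DE : D%:Z = 4 * (D %/ 4)%:Z + (D %% 4)%:Z by lia.
have AE := divz_eq A 2; have BE := divz_eq B 2.
have A2 : (A %% 2)%Z = 0 \/ (A %% 2)%Z = 1 by lia.
have B2 : (B %% 2)%Z = 0 \/ (B %% 2)%Z = 1 by lia.
have D2 : (D %% 4)%N = 1%N \/ (D %% 4)%N = 2%N \/ (D %% 4)%N = 3%N.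
  by move: D4 (ltn_pmod D (isT : 0 < 4)%N); case: (D %% 4)%N => [|[|[|[|]]]] //; auto.
set a := (A %/ 2)%Z in AE; set b := (B %/ 2)%Z in BE.
(* Squares are 0 or 1 modulo 4: $A$ and $B$ have the same parity when D is 1 modulo 4, and both are
   even when D is 2 or 3. *)
have par : if (D %% 4 == 1)%N then exists c, A = 2 * c + B
           else exists c d, A = 2 * c /\ B = 2 * d.
  move: e; rewrite DE AE BE.
  case: D2 => [->|D2] /=.
    by case: A2 => ->; case: B2 => -> e; [exists (a - b)|exfalso|exfalso|exists (a - b)]; lia.
  case: eqP => [|_]; first by lia.
  by case: A2 => ->; case: B2 => ->; case: D2 => -> e;
    first [by exists a, b; lia | exfalso; lia].
rewrite (quadE D_gt1 D_sqf F_eq x).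
have -> : re s x = A%:~R / 2 by rewrite -eA; field.
have -> : im s x = B%:~R / 2 by rewrite -eB; field.
case: ifP par => [D1 [c ->]|D1 [c [d [-> ->]]]].
  exists (Z_of_int c, Z_of_int B); rewrite quad_of_phi D1 /ktr /omega_tr D1 /= !zrE !zr_int.
  by rewrite intrD intrM mul1r.
exists (Z_of_int c, Z_of_int d); rewrite quad_of_phi D1 /ktr /omega_tr D1 /= !zrE !zr_int.
by rewrite !intrM mul0r addr0 [_ / 2 in X in _ + X]mulrAC divff // mul1r.
Qed.

End Integers.

(** * Soundness of the certificate checker *)

Section Boxes.

Local Open Scope Z_scope.

Lemma mem_zrange lo hi z : lo <= z -> z <= hi -> z \in zrange lo hi.
Proof.
move=> h1 h2; apply/mapP; exists (Z.to_nat (z - lo)); last by lia.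
by rewrite mem_iota; lia.
Qed.

Lemma sqrt_bound y m : y * y <= m -> - Z.sqrt m <= y <= Z.sqrt m.
Proof.
move=> h; have [r0 r1] : 0 <= Z.sqrt m /\ m < Z.succ (Z.sqrt m) * Z.succ (Z.sqrt m).
  by have := Z.sqrt_spec m; have := Z.sqrt_nonneg m; nia.
by nia.
Qed.

(** Only the trace is used: the left side is twice the trace of $b^2$, a positive definite form in
    the coordinates of $b$. *)
Lemma trace_square_le t n c b : knonneg t n (ksub c (kmul t n b b)) ->
  (2 * b.1 + t * b.2) * (2 * b.1 + t * b.2) + (t * t + 4 * n) * (b.2 * b.2)
  <= 2 * ktr t c.
Proof.
case: b => x y; rewrite /knonneg; case: ifP => //.
rewrite /ktr /ksub /kmul /=; nia.
Qed.

Lemma mem_square_box t n c b : 0 < t * t + 4 * n ->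
  knonneg t n (ksub c (kmul t n b b)) -> b \in square_box t n c.
Proof.
case: b => x y disc_gt0 nn; have := trace_square_le nn; rewrite /=.
set m := 2 * ktr t c; set disc := t * t + 4 * n in disc_gt0 * => tr_le.
apply/flattenP; eexists; first apply/mapP; first exists y; [|reflexivity|].
  have : y * y <= m / disc.
    by apply: Z.div_le_lower_bound => //; have := Z.square_nonneg (2 * x + t * y); lia.
  by move=> /sqrt_bound [h1 h2]; apply: mem_zrange.
rewrite mem_filter nn /=; apply/mapP; exists x => //.
have : (2 * x + t * y) * (2 * x + t * y) <= m - disc * (y * y) by lia.
move=> /sqrt_bound; set r := Z.sqrt _ => h; apply: mem_zrange; rewrite -/m -/disc -/r.
  have : - x <= (r + t * y) / 2 by apply: Z.div_le_lower_bound; lia.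
  by lia.
by apply: Z.div_le_lower_bound; lia.
Qed.

Lemma kleading_opp x : ~~ kleading x -> kleading (kopp x).
Proof. by case: x => a b; rewrite /kleading /kopp /=; do ![case: ifP]; lia. Qed.

End Boxes.

Lemma keqP x y : reflect (x = y) (keq x y).
Proof.
case: x y => a b [c d]; rewrite /keq /=.
apply: (iffP idP) => [|[-> ->]]; last by rewrite !Z.eqb_refl.
by case: ifP => // h1 h2; congr pair; lia.
Qed.

Lemma mem_In_map (S : eqType) (T : Type) (f : S -> T) (r : seq S) x :
  x \in r -> List.In (f x) [seq f y | y <- r].
Proof. by elim: r => //= y r IH; rewrite inE => /orP [/eqP ->|/IH]; auto. Qed.

Lemma all_In (T : Type) (p : pred T) (r : seq T) x : all p r -> List.In x r -> p x.
Proof. by elim: r => //= y r IH /andP [py pr] [<-|/IH]; auto. Qed.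

Definition vopp (v : vec3) : vec3 := (kopp v.1.1, kopp v.1.2, kopp v.2).
(** A vector and its opposite have the same norm; this picks the one whose first nonzero polar is
    leading. *)
Definition vleading (v : vec3) : bool :=
  if keq v.1.1 kzero then
    if keq v.1.2 kzero then kleading v.2 else kleading v.1.2
  else kleading v.1.1.

Lemma kopp_eq0 x : keq (kopp x) kzero = keq x kzero.
Proof.
by apply/keqP/keqP; case: x => a b; rewrite /kopp /= => -[h1 h2]; congr pair; lia.
Qed.

Lemma vleading_opp v : ~~ vleading v -> vleading (vopp v).
Proof.
rewrite /vleading /vopp /= !kopp_eq0.
by case: ifP => _; [case: ifP => _|]; apply: kleading_opp.
Qed.

(** * Gram matrices, Cramer's rule and escalation *)

Section Lattices.

Variables (D : nat) (F : fieldExtType rat) (s : F).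
Hypotheses (D_gt1 : (1 < D)%N) (D_sqf : squarefree D).
Hypothesis F_eq : is_quadratic_field D s.

Local Notation t := (omega_tr D).
Local Notation n := (omega_nm D).
Local Notation phi := (phi D s).
Local Notation tpos := (@totally_positive F).

Let phiE' := phiE F_eq.

Lemma totally_positive_div (x y : F) : tpos x -> tpos (x * y) -> tpos y.
Proof. by move=> hx hxy f; have := hxy f; rewrite rmorphM pmulr_rgt0. Qed.

Lemma totally_positive_mul (x y : F) : tpos x -> tpos y -> tpos (x * y).
Proof. by move=> hx hy f; rewrite rmorphM mulr_gt0. Qed.

Lemma totally_positive_neq0 (x : F) : tpos x -> x != 0.
Proof.
move=> hx; have [f _] := conjugate_embeddings D_gt1 D_sqf F_eq.
by apply/eqP => x0; have := hx f; rewrite x0 rmorph0 ltxx.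
Qed.

Variables (V : vectType F) (Q : V -> F) (L : V -> Prop).
Hypothesis Q_quad : quadratic_map Q.
Hypothesis L_add : forall u v, L u -> L v -> L (u + v).
Hypothesis L_scale : forall k v, L v -> L (phi k *: v).
Hypothesis L_OF : forall v, L v -> exists k, Q v = phi k.
Hypothesis L_pos : totally_positive_definite Q L.
Variable U : {vspace V}.
Hypotheses (dimU : \dim U = 3) (L_U : forall v, L v -> v \in U).

Local Notation B := (polar Q).

Lemma polarC u v : B u v = B v u.
Proof. by rewrite /polar (addrC u v) addrAC. Qed.

Lemma polar_scaler a u v : B u (a *: v) = a * B u v.
Proof.
have lin := Q_quad.2 u.
have z0 : B u 0 = 0.
  have := lin 1 0 0; rewrite scale1r addr0 mul1r => /eqP.
  by rewrite -subr_eq subrr => /eqP <-.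
by have := lin a v 0; rewrite !addr0 z0 addr0.
Qed.

Lemma polar_addr u v w : B u (v + w) = B u v + B u w.
Proof. by have := Q_quad.2 u 1 v w; rewrite scale1r mul1r. Qed.

Lemma polar_scalel a u v : B (a *: u) v = a * B u v.
Proof. by rewrite polarC polar_scaler polarC. Qed.

Lemma polar_addl u v w : B (u + v) w = B u w + B v w.
Proof. by rewrite polarC polar_addr !(polarC w). Qed.

Lemma polar_oppr u v : B u (- v) = - B u v.
Proof. by rewrite -scaleN1r polar_scaler mulN1r. Qed.

Lemma polar_oppl u v : B (- u) v = - B u v.
Proof. by rewrite polarC polar_oppr polarC. Qed.

Definition polarE :=
  (polar_addr, polar_addl, polar_oppr, polar_oppl, polar_scaler, polar_scalel).

Lemma polar_diag v : B v v = 2 * Q v.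
Proof.
have -> : B v v = Q (2 *: v) - Q v - Q v by rewrite scaler_nat.
by rewrite Q_quad.1; ring.
Qed.

Lemma L_opp v : L v -> L (- v).
Proof.
move=> Lv; have -> : - v = phi (-1, 0)%BZ *: v by rewrite phi_int (_ : zr F (-1)%BZ = -1) ?scaleN1r.
exact: L_scale.
Qed.

Lemma L_sub u v : L u -> L v -> L (u - v).
Proof. by move=> Lu Lv; apply: L_add => //; apply: L_opp. Qed.

Lemma polar_OF u v : L u -> L v -> exists k, B u v = phi k.
Proof.
move=> Lu Lv; have [k1 e1] := L_OF (L_add Lu Lv).
have [k2 e2] := L_OF Lu; have [k3 e3] := L_OF Lv.
by exists (ksub (ksub k1 k2) k3); rewrite /polar !phiE' e1 e2 e3.
Qed.

Lemma polar0r u : B u 0 = 0.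
Proof. by rewrite -(scale0r 0) polar_scaler mul0r. Qed.

Lemma polar_diag_pos v : L v -> v = 0 \/ tpos (B v v).
Proof.
move=> Lv; have [->|v0] := eqVneq v 0; first by left.
right; rewrite polar_diag => f.
by rewrite rmorphM rmorph_nat mulr_gt0 ?ltr0n //; apply: L_pos.
Qed.

Lemma polar_diag_nonneg v : L v -> B v v = 0 \/ tpos (B v v).
Proof. by case/polar_diag_pos => [->|]; [left; exact: polar0r | right]. Qed.

Definition gram_of (G : gram3) (u1 u2 u3 : V) : Prop :=
  [/\ B u1 u1 = phi (g11 G), B u1 u2 = phi (g12 G) & B u1 u3 = phi (g13 G)]
  /\ [/\ B u2 u2 = phi (g22 G), B u2 u3 = phi (g23 G) & B u3 u3 = phi (g33 G)].

Definition polars_of (u1 u2 u3 v : V) (x : vec3) : Prop :=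
  [/\ B u1 v = phi x.1.1, B u2 v = phi x.1.2 & B u3 v = phi x.2].

Definition combination (x : vec3) (u1 u2 u3 : V) : V :=
  phi x.1.1 *: u1 + phi x.1.2 *: u2 + phi x.2 *: u3.

Section Frame.

Variables (G : gram3) (u1 u2 u3 : V).
Hypotheses (Lu1 : L u1) (Lu2 : L u2) (Lu3 : L u3).
Hypothesis uG : gram_of G u1 u2 u3.
Hypothesis detG : phi (gram_det t n G) != 0.

Let B11 : B u1 u1 = phi (g11 G). Proof. by case: uG => -[]. Qed.
Let B12 : B u1 u2 = phi (g12 G). Proof. by case: uG => -[]. Qed.
Let B13 : B u1 u3 = phi (g13 G). Proof. by case: uG => -[]. Qed.
Let B22 : B u2 u2 = phi (g22 G). Proof. by case: uG => _ []. Qed.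
Let B23 : B u2 u3 = phi (g23 G). Proof. by case: uG => _ []. Qed.
Let B33 : B u3 u3 = phi (g33 G). Proof. by case: uG => _ []. Qed.
Let B21 : B u2 u1 = phi (g12 G). Proof. by rewrite polarC. Qed.
Let B31 : B u3 u1 = phi (g13 G). Proof. by rewrite polarC. Qed.
Let B32 : B u3 u2 = phi (g23 G). Proof. by rewrite polarC. Qed.
Let BE := (B11, B12, B13, B22, B23, B33, B21, B31, B32).

(** Applying the adjugate to the three vanishing polars multiplies each coordinate by the nonzero
    determinant. *)
Lemma gram_kernel c1 c2 c3 (w : V) : w = c1 *: u1 + c2 *: u2 + c3 *: u3 ->
  B u1 w = 0 -> B u2 w = 0 -> B u3 w = 0 -> [/\ c1 = 0, c2 = 0 & c3 = 0].
Proof.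
move=> ->; rewrite !polarE !BE => e1 e2 e3.
move: detG; case: (G) e1 e2 e3 => a b c d e f /= e1 e2 e3.
rewrite /gram_det /kdot /= !phiE' => det0.
split; apply: (mulfI det0); rewrite mulr0.
- transitivity ((phi d * phi f - phi e * phi e) * 0
    + (phi c * phi e - phi b * phi f) * 0 + (phi b * phi e - phi c * phi d) * 0).
    rewrite -{1}e1 -{1}e2 -{1}e3; ring.
  by rewrite !mulr0 !addr0.
- transitivity ((phi c * phi e - phi b * phi f) * 0
    + (phi a * phi f - phi c * phi c) * 0 + (phi b * phi c - phi a * phi e) * 0).
    rewrite -{1}e1 -{1}e2 -{1}e3; ring.
  by rewrite !mulr0 !addr0.
- transitivity ((phi b * phi e - phi c * phi d) * 0
    + (phi b * phi c - phi a * phi e) * 0 + (phi a * phi d - phi b * phi b) * 0).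
    rewrite -{1}e1 -{1}e2 -{1}e3; ring.
  by rewrite !mulr0 !addr0.
Qed.

Lemma frame_free : free [:: u1; u2; u3].
Proof.
rewrite -[[:: _; _; _]]/(val [tuple u1; u2; u3]); apply/freeP => k.
rewrite !big_ord_recl big_ord0 addr0 /= addrA => e0.
have B0 u : B u (k ord0 *: u1 + k (lift ord0 ord0) *: u2
                 + k (lift ord0 (lift ord0 ord0)) *: u3) = 0.
  by rewrite e0 -(scale0r 0) polar_scaler mul0r.
have [k0 k1 k2] := gram_kernel erefl (B0 _) (B0 _) (B0 _).
by case=> [[|[|[|//]]] h]; [rewrite -[RHS]k0 | rewrite -[RHS]k1 | rewrite -[RHS]k2];
  congr (k _); apply: val_inj.
Qed.

Lemma frame_span v : v \in U ->
  exists c1 c2 c3, v = c1 *: u1 + c2 *: u2 + c3 *: u3.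
Proof.
move=> vU; have spanU : <<[:: u1; u2; u3]>>%VS = U.
  apply/eqP; rewrite eqEdim dimU (eqnP frame_free) leqnn andbT.
  by apply/span_subvP => x; rewrite !inE => /or3P [] /eqP ->; apply: L_U.
move: vU; rewrite -spanU -[[:: _; _; _]]/(val [tuple u1; u2; u3]) => /coord_span ->.
by rewrite !big_ord_recl big_ord0 addr0 addrA /=; do 3!eexists.
Qed.

(** The difference of the two sides lies in the span of the frame and has zero polar with it, so it
    vanishes by [gram_kernel]. *)
Lemma cramer v x : L v -> polars_of u1 u2 u3 v x ->
  phi (gram_det t n G) *: v = combination (gram_app t n (adj_gram t n G) x) u1 u2 u3.
Proof.
move=> Lv [x1 x2 x3]; apply/eqP; rewrite -subr_eq0; apply/eqP.
set w := _ - _; have wU : w \in U.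
  by rewrite /w /combination memvB ?memvD ?memvZ ?L_U.
have [c1 [c2 [c3 wE]]] := frame_span wU.
have [] // := gram_kernel wE; rewrite /w /combination ?polarE ?BE ?x1 ?x2 ?x3.
- case: (G) => a b c d e f; case: (x) => -[y1 y2] y3.
  by rewrite /gram_det /kdot /= !phiE'; ring.
- case: (G) => a b c d e f; case: (x) => -[y1 y2] y3.
  by rewrite /gram_det /kdot /= !phiE'; ring.
- case: (G) => a b c d e f; case: (x) => -[y1 y2] y3.
  by rewrite /gram_det /kdot /= !phiE'; ring.
by move=> c10 c20 c30; rewrite -/w wE c10 c20 c30 !scale0r !addr0.
Qed.

(** For [w = v] this is the vanishing of the Gram determinant of the frame and [v]. *)
Lemma polar_cramer v w x y : L v -> polars_of u1 u2 u3 v x -> polars_of u1 u2 u3 w y ->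
  phi (gram_det t n G) * B v w
  = phi (kdot t n (gram_app t n (adj_gram t n G) x) y).
Proof.
move=> Lv hx [y1 y2 y3]; rewrite -polar_scalel (cramer Lv hx) /combination.
rewrite !polarE y1 y2 y3; case: (gram_app _ _ _ _) => -[a b] c.
by rewrite /kdot /= !phiE' addrA.
Qed.

End Frame.

(** Containment only: L may be larger than the lattice described by T. *)
Definition has_lattice (T : gram3 * seq vec3) : Prop :=
  exists u1 u2 u3, [/\ L u1, L u2 & L u3]
    /\ [/\ gram_of T.1 u1 u2 u3, phi (gram_det t n T.1) != 0
         & forall x, x \in T.2 -> exists2 e, L e & polars_of u1 u2 u3 e x].

(** The leading minors are kept totally positive because the inequalities below are obtained by
    dividing by them. *)
Definition realizes (st : state) : Prop :=
  match st with
  | State0 => True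
  | State1 g => exists2 u, L u & B u u = phi g /\ tpos (phi g)
  | State2 a b c => exists u v, [/\ L u, L v & B u u = phi a]
      /\ [/\ B u v = phi b, B v v = phi c, tpos (phi a) & tpos (phi (det2 t n a b c))]
  | State3 G ex => [/\ has_lattice (G, ex), tpos (phi (g11 G))
      & tpos (phi (det2 t n (g11 G) (g12 G) (g22 G)))]
  end.

Hypothesis L_univ : forall al, kpos t n al -> exists2 v, L v & Q v = phi al.

Lemma disc_gt0 : (0 < t * t + 4 * n)%BZ.
Proof. by rewrite /omega_tr /omega_nm; case: eqP; lia. Qed.

Lemma mem_box c b : phi c - phi b * phi b = 0 \/ tpos (phi c - phi b * phi b) ->
  b \in square_box t n c.
Proof.
move=> h; apply: (mem_square_box disc_gt0).
by apply: (knonneg_totally_positive D_gt1 D_sqf F_eq); rewrite !phiE'.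
Qed.

Lemma nonneg_div x y : tpos x -> x * y = 0 \/ tpos (x * y) -> y = 0 \/ tpos y.
Proof.
move=> hx [/eqP|hxy]; last by right; apply: totally_positive_div hxy.
by rewrite mulf_eq0 (negbTE (totally_positive_neq0 hx)) => /eqP; left.
Qed.

(** The polar of $av-bu$ with itself is $a(ac-b^2)$, and the totally positive factor $a$ can be
    cancelled. *)
Lemma cauchy_schwarz u v a b c : L u -> L v -> B u u = phi a -> B u v = phi b ->
  B v v = phi c -> tpos (phi a) ->
  phi a * phi c - phi b * phi b = 0 \/ tpos (phi a * phi c - phi b * phi b).
Proof.
move=> Lu Lv ea eb ec ha; apply: nonneg_div (ha) _.
have := polar_diag_nonneg (L_sub (L_scale a Lv) (L_scale b Lu)).
rewrite !polarE (polarC v u) ea eb ec.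
by congr (_ = 0 \/ tpos _); ring.
Qed.

(** Cauchy-Schwarz one dimension higher: $(ac-b^2)v-(cx-by)u_1-(ay-bx)u_2$ is orthogonal to
    $u_1,u_2$, and its polar with itself is $ac-b^2$ times the Gram determinant [d]. *)
Lemma det3_nonneg u1 u2 v a b c x y m : L u1 -> L u2 -> L v ->
  B u1 u1 = phi a -> B u1 u2 = phi b -> B u2 u2 = phi c ->
  B u1 v = phi x -> B u2 v = phi y -> B v v = phi m ->
  tpos (phi (det2 t n a b c)) ->
  let d := phi m * (phi a * phi c - phi b * phi b)
           - (phi c * (phi x * phi x) - 2 * (phi b * phi x) * phi y
              + phi a * (phi y * phi y)) in
  d = 0 \/ tpos d.
Proof.
move=> L1 L2 Lv ea eb ec ex ey em hd d; apply: nonneg_div (hd) _.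
have := polar_diag_nonneg (L_sub (L_scale (det2 t n a b c) Lv)
  (L_add (L_scale (ksub (kmul t n c x) (kmul t n b y)) L1)
         (L_scale (ksub (kmul t n a y) (kmul t n b x)) L2))).
rewrite !polarE (polarC v u1) (polarC v u2) (polarC u2 u1) ea eb ec ex ey em.
by rewrite /det2 !phiE' /d; congr (_ = 0 \/ tpos _); ring.
Qed.

Lemma kleading_sign u v b : L v -> B u v = phi b ->
  exists v' b', [/\ L v', B v' v' = B v v, B u v' = phi b' & kleading b'].
Proof.
move=> Lv e; have [h|h] := boolP (kleading b); first by exists v, b.
exists (- v), (kopp b); split; rewrite ?kleading_opp //; first exact: L_opp.
  by rewrite !polarE opprK.
by rewrite !polarE e phiE'.
Qed.

Lemma extend1_sound g al sts : kpos t n al -> realizes (State1 g) ->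
  extend1 t n g (kdbl al) = Some sts -> exists2 st, List.In st sts & realizes st.
Proof.
move=> al_pos [u Lu [eg g_pos]]; rewrite /extend1.
case: ifP => // /negbT /hasPn no_dep [<-].
have [v0 Lv0 Qv0] := L_univ al_pos.
have [b0 eb0] := polar_OF Lu Lv0.
have [v [b [Lv ev eb b_lead]]] := kleading_sign Lv0 eb0.
have ec : B v v = phi (kdbl al) by rewrite ev polar_diag Qv0 phiE'.
have cs := cauchy_schwarz Lu Lv eg eb ec g_pos.
have b_in : b \in [seq b <- square_box t n (kmul t n (kdbl al) g) | kleading b].
  by rewrite mem_filter b_lead mem_box // !phiE' mulrC -(phi_dbl D s al).
exists (State2 g b (kdbl al)).
  exact: mem_In_map b_in.
exists u, v; split=> //; split=> //; rewrite /det2 !phi_sub !phi_mul //.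
(* A vanishing determinant would place [b] among the candidates for which [extend1] fails. *)
case: cs => // cs0; move: (no_dep _ b_in); case: keqP => // -[].
apply: (phi_inj D_gt1 D_sqf F_eq); apply/eqP.
by rewrite -subr_eq0 !(phi_mul F_eq) [X in X - _]mulrC cs0.
Qed.

Lemma vleading_sign u1 u2 u3 v x : L v -> polars_of u1 u2 u3 v x ->
  exists v' x', [/\ L v', B v' v' = B v v, polars_of u1 u2 u3 v' x' & vleading x'].
Proof.
move=> Lv hx; have [h|h] := boolP (vleading x); first by exists v, x.
exists (- v), (vopp x); split; rewrite ?vleading_opp //; first exact: L_opp.
  by rewrite !polarE opprK.
by case: hx => h1 h2 h3; split; rewrite !polarE ?h1 ?h2 ?h3 phi_opp.
Qed.

Lemma extend2_sound a b c al sts : kpos t n al -> realizes (State2 a b c) ->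
  extend2 t n a b c (kdbl al) = Some sts -> exists2 st, List.In st sts & realizes st.
Proof.
move=> al_pos [u1 [u2 [[L1 L2 ea] [eb ec a_pos d_pos]]]]; rewrite /extend2.
case: ifP => // /negbT /hasPn no_dep [<-].
have [v0 Lv0 Qv0] := L_univ al_pos.
have [x0 ex0] := polar_OF L1 Lv0; have [y0 ey0] := polar_OF L2 Lv0.
(* There is no third frame vector yet, so [u1] is repeated and the third polar equals the first. *)
have [] := @vleading_sign u1 u2 u1 v0 (x0, y0, x0) Lv0; first by split.
move=> v [[[x y] z] [Lv ev [ex ey ez] lead]]; rewrite /= in ex ey ez.
have zx : z = x by apply: (phi_inj D_gt1 D_sqf F_eq); rewrite -ex -ez.
rewrite {}zx {z ez} in lead.
have x_lead : kleading x.
  move: lead; rewrite /vleading /=; case: ifP => // /keqP ->.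
  by case: ifP.
have em : B v v = phi (kdbl al) by rewrite ev polar_diag Qv0 phiE'.
have csx := cauchy_schwarz L1 Lv ea ex em a_pos.
have c_pos : tpos (phi c).
  have := polar_diag_pos L2; rewrite ec => -[u20|//].
  have := totally_positive_neq0 d_pos.
  by rewrite /det2 !phiE' -eb -ec u20 !polar0r !mulr0 subr0 eqxx.
have csy := cauchy_schwarz L2 Lv ec ey em c_pos.
have := det3_nonneg L1 L2 Lv ea eb ec ex ey em d_pos.
set p11 := kmul t n c (kmul t n x x); set p12 := kdbl (kmul t n b x).
set cand := flatten _ in no_dep *.
set p := (ksub (kmul t n (kdbl al) (det2 t n a b c))
               (kadd (ksub p11 (kmul t n p12 y)) (kmul t n a (kmul t n y y))), (x, y)).
have phip : phi (kdbl al) * (phi a * phi c - phi b * phi b)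
  - (phi c * (phi x * phi x) - 2 * (phi b * phi x) * phi y + phi a * (phi y * phi y))
  = phi p.1 by rewrite /p /p11 /p12 /= /det2 !phiE'.
move=> /=; rewrite phip => hp.
have p_in : p \in cand.
  apply/flattenP; eexists; first apply/mapP; first exists x.
  - by rewrite mem_filter x_lead mem_box // !phiE' mulrC -(phi_dbl D s al) mulrC mulrC.
  - reflexivity.
  rewrite mem_filter (knonneg_totally_positive D_gt1 D_sqf F_eq) /=; last first.
    by case: hp => [->|]; [left|right].
  apply/mapP; exists (y, kmul t n a (kmul t n y y)) => //.
  have y_in : (y, kmul t n a (kmul t n y y)) \in
    [seq (x, kmul t n a (kmul t n x x)) | x <- square_box t n (kmul t n (kdbl al) c)].
    by apply: map_f; rewrite mem_box // !phiE' mulrC -(phi_dbl D s al) mulrC mulrC.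
  case: ifP => // x_eq0; rewrite mem_filter y_in andbT /=.
  by move: lead; rewrite /vleading /= x_eq0; case: ifP => // /keqP ->.
have p_neq0 : phi p.1 != 0.
  apply: contra (no_dep _ p_in) => /eqP e; apply/keqP.
  by apply: (phi_inj D_gt1 D_sqf F_eq); rewrite e phi0.
exists (State3 (Gram a b x c y (kdbl al)) [::]).
  exact: (mem_In_map (fun p => State3 (Gram a b p.2.1 c p.2.2 (kdbl al)) [::]) p_in).
split=> //; exists u1, u2, v; split=> //; split=> //.
congr (_ != 0): p_neq0; rewrite -phip /gram_det /kdot /= !phiE'; ring.
Qed.

(** Multiplying by the conjugate of [d] turns the division into an exact division of both
    coordinates by the norm, which is nonzero with [d]. *)
Lemma kdivP d q x : phi d != 0 -> phi x = phi d * phi q ->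
  kdvd t n d x /\ kdiv t n x d = q.
Proof.
move=> d0 e; have xE : x = kmul t n d q.
  by apply: (phi_inj D_gt1 D_sqf F_eq); rewrite phiE'.
have nm0 : knm t n d <> Z0.
  by move/eqP; rewrite (phi_nm_eq0 D_gt1 D_sqf F_eq) (negbTE d0).
have qE : kdiv t n x d = q.
  rewrite /kdiv xE; set y := kmul t n (kmul t n d q) (kconj t d).
  have -> : y = (q.1 * knm t n d, q.2 * knm t n d)%BZ.
    by rewrite /y /kmul /kconj /knm /=; congr pair; ring.
  by case: (q) => q1 q2 /=; rewrite !Z.div_mul.
split=> //; apply/keqP; rewrite qE xE.
by apply: (phi_inj D_gt1 D_sqf F_eq); rewrite !phiE' mulrC.
Qed.

Lemma extend3_sound G ex al : kpos t n al -> realizes (State3 G ex) ->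
  exists2 x, x \in extend3 t n G ex (kdbl al) & realizes (State3 G (rcons ex x)).
Proof.
move=> al_pos [[u1 [u2 [u3 [[L1 L2 L3] [uG det0 exP]]]]] a_pos d_pos].
rewrite /= in uG det0 exP.
have [v0 Lv0 Qv0] := L_univ al_pos.
have [x0 ex0] := polar_OF L1 Lv0; have [y0 ey0] := polar_OF L2 Lv0.
have [z0 ez0] := polar_OF L3 Lv0.
have [] := @vleading_sign u1 u2 u3 v0 (x0, y0, z0) Lv0; first by split.
move=> v [[[x y] z] [Lv ev xyz lead]].
have em : B v v = phi (kdbl al) by rewrite ev polar_diag Qv0 phiE'.
(* This is the quadratic equation in the third polar by which [extend3] filters. *)
have self := polar_cramer L1 L2 L3 uG det0 Lv xyz xyz.
have [[B11 B12 B13] [B22 B23 B33]] := uG; have [ex' ey ez] := xyz.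
rewrite /= in ex' ey ez.
have diag_pos w g : L w -> B w w = phi g -> (w = 0 -> False) -> tpos (phi g).
  by move=> Lw <- w0; case: (polar_diag_pos Lw).
have b_pos : tpos (phi (g22 G)).
  apply: (diag_pos u2) => // u0; have := totally_positive_neq0 d_pos.
  by rewrite /det2 !phiE' -B12 -B22 u0 !polar0r !mulr0 subr0 eqxx.
have c_pos : tpos (phi (g33 G)).
  apply: (diag_pos u3) => // u0; move/eqP: det0; apply.
  move: (B13) (B23) (B33); rewrite u0 !polar0r; case: (G) => a b c d e f /= c0 e0 f0.
  by rewrite /gram_det /kdot /= !phiE' -c0 -e0 -f0; ring.
exists (x, y, z); last first.
  split=> //; exists u1, u2, u3; split=> //; split=> // r.
  rewrite mem_rcons inE => /orP [/eqP ->|/exP //]; by exists v.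
have csx := cauchy_schwarz L1 Lv B11 ex' em a_pos.
have csy := cauchy_schwarz L2 Lv B22 ey em b_pos.
have csz := cauchy_schwarz L3 Lv B33 ez em c_pos.
have nn := det3_nonneg L1 L2 Lv B11 B12 B22 ex' ey em d_pos.
have x_lead : kleading x.
  move: lead; rewrite /vleading /=; case: ifP => // /keqP ->.
  by case: ifP.
rewrite /extend3; apply/flattenP; eexists; first apply/mapP; first exists x.
- by rewrite mem_filter x_lead mem_box // !phiE' mulrC -(phi_dbl D s al) mulrC mulrC.
- reflexivity.
set A := adj_gram t n G; rewrite -/A in self.
apply/flattenP; eexists; first apply/mapP.
- exists (y, (kmul t n (g11 G) (kmul t n y y), kmul t n (g22 A) (kmul t n y y)));
    last by reflexivity.
  set bx := [seq _ | _ <- _].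
  have y_in : (y, (kmul t n (g11 G) (kmul t n y y), kmul t n (g22 A) (kmul t n y y)))
      \in bx.
    apply/mapP; exists y => //.
    by rewrite mem_box // !phiE' mulrC -(phi_dbl D s al) mulrC mulrC.
  case: ifP => // x_eq0; rewrite mem_filter y_in andbT /=.
  by move: lead; rewrite /vleading /= x_eq0; case: ifP => // /keqP ->.
rewrite /= (knonneg_totally_positive D_gt1 D_sqf F_eq); last first.
  case: nn => nn; [left; rewrite -nn | right; move: nn; congr tpos];
  rewrite /A; case: (G) => a b c d e f /=; rewrite !phiE'; ring.
rewrite mem_filter; apply/andP; split.
  apply/allP => _ /mapP [e /exP [w Lw hw] ->].
  have [q eq] := polar_OF Lw Lv.
  apply: (kdivP det0 (q := q) _).1; rewrite -eq.
  rewrite (polar_cramer L1 L2 L3 uG det0 Lw hw xyz) -/A.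
  by case: (gram_app _ _ _ _) => -[r1 r2] r3; rewrite /kdot /= !phiE'; ring.
apply/mapP; exists (z, kmul t n (g33 A) (kmul t n z z)) => //.
rewrite mem_filter; apply/andP; split.
  apply/keqP; apply: (phi_inj D_gt1 D_sqf F_eq).
  move: self; rewrite em /A; case: (G) => a b c d e f /= self.
  apply/eqP; rewrite -subr_eq0; move: self => /eqP; rewrite -subr_eq0.
  by rewrite /kdot /= !phiE' => /eqP self; rewrite -[X in _ == X]self; apply/eqP; ring.
set by_ := [seq _ | _ <- _].
have z_in : (z, kmul t n (g33 A) (kmul t n z z)) \in by_.
  by apply/mapP; exists z => //; rewrite mem_box // !phiE' mulrC -(phi_dbl D s al) mulrC mulrC.
case: ifP => // /andP [x_eq0 y_eq0]; rewrite mem_filter z_in andbT /=.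
by move: lead; rewrite /vleading /= x_eq0 y_eq0.
Qed.

Lemma combination_add x y u1 u2 u3 :
  combination (vadd x y) u1 u2 u3 = combination x u1 u2 u3 + combination y u1 u2 u3.
Proof.
have scaleD a b (v : V) : phi (kadd a b) *: v = phi a *: v + phi b *: v.
  by rewrite phi_add scalerDl.
rewrite /combination /vadd /= !scaleD (addrACA (phi x.1.1 *: u1)).
by rewrite (addrACA (phi x.1.1 *: u1 + phi x.1.2 *: u2)).
Qed.

Lemma combination_scale k x u1 u2 u3 :
  combination (vscale t n k x) u1 u2 u3 = phi k *: combination x u1 u2 u3.
Proof. by rewrite /combination /vscale /= !(phi_mul F_eq) !scalerDr !scalerA. Qed.

Lemma row_sound G ex u1 u2 u3 r : L u1 -> L u2 -> L u3 ->
  gram_of G u1 u2 u3 -> phi (gram_det t n G) != 0 ->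
  (forall x, x \in ex -> exists2 e, L e & polars_of u1 u2 u3 e x) ->
  exists w, [/\ L w, polars_of u1 u2 u3 w (row_polar t n G ex r)
    & phi (gram_det t n G) *: w = combination (row_num t n G ex r) u1 u2 u3].
Proof.
move=> L1 L2 L3 uG det0 exP; rewrite /row_polar /row_num.
have : forall p, p \in zip r.2 ex -> p.2 \in ex.
  move=> [p1 p2] /= h.
  have : p2 \in unzip2 (zip r.2 ex) by apply/mapP; exists (p1, p2).
  elim: ex (r.2) {exP h} => [|e ex IH] [|k ks] //=.
  by rewrite !inE => /orP [/eqP ->|/IH ->]; rewrite ?eqxx ?orbT.
elim: (zip _ _) => [_|[k x] l IH hl] /=.
  exists (combination r.1 u1 u2 u3); split.
  - by rewrite /combination; apply: L_add; [apply: L_add|]; apply: L_scale.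
  - have [[B11 B12 B13] [B22 B23 B33]] := uG.
    case: (r.1) => -[a b] c; rewrite /polars_of /combination /gram_app /=.
    rewrite !polarE B11 B12 B13 B22 B23 B33 (polarC u2 u1) (polarC u3 u1) (polarC u3 u2).
    by rewrite B12 B13 B23 !phiE'; split; ring.
  - by rewrite combination_scale.
have [|w [Lw hw wE]] := IH; first by move=> p pl; apply: hl; rewrite inE pl orbT.
have [|e Le he] := exP x; first by apply: (hl (k, x)); rewrite inE eqxx.
exists (phi k *: e + w); split.
- by apply: L_add => //; apply: L_scale.
- case: hw he => w1 w2 w3 [e1 e2 e3].
  by rewrite /polars_of /= !polarE !phiE' w1 w2 w3 e1 e2 e3.
rewrite combination_add combination_scale -(cramer L1 L2 L3 uG det0 Le he) -wE.
rewrite scalerDr [in LHS]scalerA [in RHS]scalerA.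
by rewrite [phi (gram_det _ _ _) * _]mulrC.
Qed.

(** Polars of lattice vectors are integral, so every division made by [change] is exact. *)
Lemma change_sound G ex r1 r2 r3 rs T :
  change t n G ex r1 r2 r3 rs = Some T -> has_lattice (G, ex) -> has_lattice T.
Proof.
pose q r r' := kdiv t n (kdot t n (row_num t n G ex r) (row_polar t n G ex r'))
  (gram_det t n G).
rewrite /change; cbv zeta; rewrite -!/(q _ _); case: keqP => // /eqP det' [<-].
case=> u1 [u2 [u3 [[L1 L2 L3] [/= uG det0 exP]]]].
have vec r := row_sound r L1 L2 L3 uG det0 exP.
have pol r w r' w' : L w -> L w' ->
    phi (gram_det t n G) *: w = combination (row_num t n G ex r) u1 u2 u3 ->
    polars_of u1 u2 u3 w' (row_polar t n G ex r') -> B w w' = phi (q r r').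
  move=> Lw Lw' wE [h1 h2 h3]; have [k ek] := polar_OF Lw Lw'.
  rewrite ek; congr phi; symmetry; apply: (kdivP det0 _).2.
  rewrite -ek -polar_scalel wE /combination !polarE h1 h2 h3 /kdot !phiE'.
  by rewrite addrA.
have [w1 [Lw1 p1 e1]] := vec r1; have [w2 [Lw2 p2 e2]] := vec r2.
have [w3 [Lw3 p3 e3]] := vec r3.
exists w1, w2, w3; split=> //; split=> /=.
- by split; split; apply: pol.
- by apply: contraNneq det' => e; apply/eqP; apply: (phi_inj D_gt1 D_sqf F_eq); rewrite phi0.
move=> x /mapP [r _ ->]; have [w [Lw p e]] := vec r.
by exists w => //; split; apply: pol.
Qed.

Lemma gram_eqP G H : gram_eq G H -> G = H.
Proof.
case: G H => a b c d e f [a' b' c' d' e' f'] /and5P [/keqP /= -> /keqP /= -> /keqP /= ->].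
by move=> /keqP /= -> /andP [/keqP /= -> /keqP /= ->].
Qed.

Lemma vseq_eqP r r' : vseq_eq r r' -> r = r'.
Proof.
elim: r r' => [|[[a b] c] r IH] [|[[a' b'] c'] r'] //= /andP [/and3P []].
by move=> /keqP /= -> /keqP /= -> /keqP /= -> /IH ->.
Qed.

Lemma branches_sound al st sts : branches t n al st = Some sts -> realizes st ->
  exists2 st', List.In st' sts & realizes st'.
Proof.
rewrite /branches; case: ifP => // /negbFE al_pos.
case: st => [|g|a b c|G ex] e h.
- case: e => <-; exists (State1 (kdbl al)); first by left.
  have [v Lv Qv] := L_univ al_pos; exists v => //.
  split; first by rewrite polar_diag Qv phiE'.
  rewrite phiE'; apply: totally_positive_mul => [f|].
    by rewrite rmorph_nat ltr0n.
  exact/(totally_positive_phi D_gt1 D_sqf F_eq).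
- exact: extend1_sound e.
- exact: extend2_sound e.
case: e => <-; have [x x_in hx] := extend3_sound al_pos h.
exists (State3 G (rcons ex x)); last exact: hx.
exact: (mem_In_map (fun v => State3 G (rcons ex v)) x_in).
Qed.

Lemma accept_sound targets i r1 r2 r3 rs G ex :
  run t n targets (Accept i r1 r2 r3 rs) (State3 G ex) -> has_lattice (G, ex) ->
  exists2 T, List.In T targets & has_lattice T.
Proof.
move=> /=; case e1: (change _ _ _ _ _ _ _ _) => [[G' ex']|//].
case e2: (onth _ _) => [[H ex0]|//] /andP [/gram_eqP eG /vseq_eqP ee] h.
exists (H, ex0); last by rewrite -eG -ee; apply: change_sound e1 h.
by elim: targets i e2 {e1} => [|T Ts IHT] [|i] //= => [[->]|/IHT]; [left|right].
Qed.

Lemma run_sound targets c st : run t n targets c st -> realizes st ->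
  exists2 T, List.In T targets & has_lattice T.
Proof.
(* [cert] is nested through lists, hence a direct fixpoint with an inner induction on the list of
   certificates. *)
move: c st; fix IH 1 => -[al cs|c1 c2|i r1 r2 r3 rs] st /=.
- case e: (branches _ _ _ _) => [sts|//] ok h.
  have [st' st'_in h'] := branches_sound e h.
  elim: cs sts ok st'_in {e} => [|c [|c' cs] IHcs] [|st1 sts] //= ok st'_in.
  + by apply: IH h'; apply: (all_In (p := run t n targets c) (r := st1 :: sts)).
  case/andP: ok => ok1 ok2; case: st'_in => [e1|]; last exact: IHcs.
  by apply: IH ok1 _; rewrite e1.
- by case: ifP => [ok _|_ ok] h; [apply: IH ok h|apply: IH ok h].
by case: st => // G ex ok [h _ _]; apply: (accept_sound (r1 := r1) ok h).
Qed.

End Lattices.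

(** * A bound on the discriminant *)

(** Used with [d] the discriminant: an element whose square has small trace is rational. *)
Lemma square_sum_small (a d y m : Z) :
  (a * a + d * (y * y) <= m)%BZ -> (0 <= m < d)%BZ -> y = Z0.
Proof.
move=> h1 h2; case: (Z.eq_dec y 0) => // y0.
have : (1 <= y * y)%BZ by nia.
have := Z.square_nonneg a; nia.
Qed.

Section Universal.

Variables (D : nat) (F : fieldExtType rat) (s : F).
Variables (V : vectType F) (Q : V -> F) (L : V -> Prop).
Hypotheses (D_gt1 : (1 < D)%N) (D_sqf : squarefree D).
Hypothesis F_eq : is_quadratic_field D s.
Hypothesis L_lat : quadratic_lattice 3 Q L.
Hypothesis L_univ : universal Q L.

Local Notation t := (omega_tr D).
Local Notation n := (omega_nm D).
Local Notation phi := (phi D s).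
Local Notation B := (polar Q).

Let L_pos : totally_positive_definite Q L := L_univ.1.

Lemma lattice_quad : quadratic_map Q. Proof. by case: L_lat. Qed.

Lemma lattice_add u v : L u -> L v -> L (u + v).
Proof.
case: L_lat => _ [e [eL _]] _ /eL [c cO ->] /eL [d dO ->]; apply/eL.
exists (fun i => c i + d i) => [i|]; first exact: (integral_add (cO i) (dO i)).
by rewrite -big_split; apply: eq_bigr => i _; rewrite scalerDl.
Qed.

Lemma lattice_scaleOF a v : OF a -> L v -> L (a *: v).
Proof.
case: L_lat => _ [e [eL _]] _ aO /eL [c cO ->]; apply/eL.
exists (fun i => a * c i) => [i|]; first exact: (integral_mul aO (cO i)).
by rewrite scaler_sumr; apply: eq_bigr => i _; rewrite scalerA.
Qed.

Lemma lattice_scale k v : L v -> L (phi k *: v).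
Proof. by apply: lattice_scaleOF; apply: OF_phi. Qed.

Lemma lattice_OF v : L v -> exists k, Q v = phi k.
Proof. by case: L_lat => _ _ h /h; apply: OF_phiP. Qed.

Lemma lattice_ambient : exists2 U : {vspace V}, \dim U = 3 & forall v, L v -> v \in U.
Proof.
case: L_lat => _ [e [eL edim]] _; exists <<e>>%VS => // v /eL [c _ ->].
by apply: memv_suml => i _; rewrite memvZ // memv_span // mem_nth.
Qed.

Lemma universal_phi al : kpos t n al -> exists2 v, L v & Q v = phi al.
Proof.
move=> al_pos; have [_ []] := L_univ.2 (phi al).
  by split; [apply: OF_phi | apply/(totally_positive_phi D_gt1 D_sqf F_eq)].
by move=> v [Lv _ Qv]; exists v.
Qed.

Lemma universal_run targets c : run t n targets c State0 ->
  exists2 T, List.In T targets & has_lattice D s Q L T.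
Proof.
move=> ok; have [U dimU L_U] := lattice_ambient.
exact: (run_sound D_gt1 D_sqf F_eq lattice_quad lattice_add lattice_scale lattice_OF
  L_pos dimU L_U universal_phi ok).
Qed.

(** Cauchy-Schwarz read on traces: the right side is twice the trace of $(2a)(2k)$. *)
Lemma polar_small u v a k b : (0 < a)%BZ -> L u -> L v ->
  Q u = phi (a, Z0) -> Q v = phi k -> B u v = phi b ->
  ((2 * b.1 + t * b.2) * (2 * b.1 + t * b.2) + (t * t + 4 * n) * (b.2 * b.2)
   <= 8 * a * ktr t k)%BZ.
Proof.
move=> a_gt0 Lu Lv Qu Qv eb.
have ea : B u u = phi (kdbl (a, Z0)) by rewrite (polar_diag lattice_quad) Qu phi_dbl.
have ek : B v v = phi (kdbl k) by rewrite (polar_diag lattice_quad) Qv phi_dbl.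
have a_pos : totally_positive (phi (kdbl (a, Z0))).
  apply/(totally_positive_phi D_gt1 D_sqf F_eq); rewrite /kpos /ktr /knm /kdbl /=.
  by apply/andP; split; nia.
have cs := cauchy_schwarz D_gt1 D_sqf F_eq lattice_quad lattice_add lattice_scale L_pos
  Lu Lv ea eb ek a_pos.
have nn : knonneg t n (ksub (kmul t n (kdbl (a, Z0)) (kdbl k)) (kmul t n b b)).
  by apply: (knonneg_totally_positive D_gt1 D_sqf F_eq); rewrite !(phiE F_eq) -!phi_dbl.
apply: Z.le_trans (trace_square_le nn) _.
by rewrite /ktr /kmul /kdbl /=; lia.
Qed.

Lemma kmul_int a b : kmul t n (a, Z0) (b, Z0) = (a * b, Z0)%BZ.
Proof. by rewrite /kmul /=; congr pair; ring. Qed.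
Lemma ksub_int a b : ksub (a, Z0) (b, Z0) = (a - b, Z0)%BZ.
Proof. by []. Qed.
Lemma kadd_int a b : kadd (a, Z0) (b, Z0) = (a + b, Z0)%BZ.
Proof. by []. Qed.
Definition kintE := (kmul_int, ksub_int, kadd_int).

(* The binary lattices of determinant 8 - x^2 containing 1 and 2 do not represent
   5 (x = 0) or 3 (x <> 0), even rationally. *)
Lemma escalation_det_neq0 (x p q : Z) (T := if (x =? 0)%BZ then 5%BZ else 3%BZ) :
  (- 2 <= x <= 2)%BZ -> (p * p <= 4 * T)%BZ -> (q * q <= 8 * T)%BZ ->
  (2 * T * (8 - x * x) <> 4 * (p * p) - 2 * (x * (p * q)) + 2 * (q * q))%BZ.
Proof.
move=> hx hp hq.
(* As $T\le 5$, one has $p^2\le 20$ and $q^2\le 40$, hence $|p|\le 4$ and $|q|\le 6$. *)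
have check : all (fun x => let T := if (x =? 0)%BZ then 5%BZ else 3%BZ in
    all (fun p => all (fun q =>
      ~~ (2 * T * (8 - x * x) =? 4 * (p * p) - 2 * (x * (p * q)) + 2 * (q * q))%BZ)
      (zrange (-6) 6)) (zrange (-4) 4)) (zrange (-2) 2) by vm_compute.
have T5 : (T <= 5)%BZ by rewrite /T; case: ifP.
have hp' : p \in zrange (-4) 4 by apply: mem_zrange; nia.
have hq' : q \in zrange (-6) 6 by apply: mem_zrange; nia.
have hx' : x \in zrange (-2) 2 by apply: mem_zrange; lia.
have /= := allP (allP (allP check _ hx') _ hp') _ hq'.
by rewrite -/T => /negP h /Z.eqb_eq.
Qed.

(* For larger discriminants the vectors v1, v2, v3 representing 1, 2 and 3 or 5 have a
   rational Gram matrix, of nonzero determinant. The element al just above sqrt(disc) / 2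
   is so small that a vector representing it has rational polars with them too, which
   makes al rational. *)
Lemma discriminant_le : (t * t + 4 * n <= 1760)%BZ.
Proof.
set disc := (_ + _)%BZ; case: (Z.leb_spec disc 1760) => // disc_gt; exfalso.
have t01 : t = Z0 \/ t = 1%BZ by rewrite /omega_tr; case: ifP; auto.
have [r_le r_gt] := Z.sqrt_spec disc ltac:(lia).
set r := Z.sqrt disc in r_le r_gt.
(* The trace exceeds [r] by 1 or 2, so that four times the norm, which is
   $\mathrm{tr}^2-\mathrm{disc}$, is positive while the trace stays close to
   $\sqrt{\mathrm{disc}}$. *)
pose al : K := ((r - t) / 2 + 1, 1)%BZ.
have [tr_ge tr_le] : (r + 1 <= ktr t al /\ ktr t al <= r + 2)%BZ.
  rewrite /ktr /al /=; have := Z.div_mod (r - t) 2; have := Z.mod_pos_bound (r - t) 2.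
  by lia.
have r_ge : (41 <= r)%BZ by nia.
have al_pos : kpos t n al.
  have e : (4 * knm t n al = ktr t al * ktr t al - disc)%BZ.
    by rewrite /knm /ktr /disc /al /=; ring.
  by rewrite /kpos; apply/andP; split; nia.
have pos_int a : (0 < a)%BZ -> kpos t n (a, Z0).
  by move=> a_gt0; rewrite /kpos /ktr /knm /=; apply/andP; split; nia.
have [v1 L1 Q1] := universal_phi (pos_int 1%BZ erefl).
have [v2 L2 Q2] := universal_phi (pos_int 2%BZ erefl).
have pol u v Lu Lv := @polar_OF D F s V Q L lattice_add lattice_OF u v Lu Lv.
have [[x y] e12] := pol _ _ L1 L2.
have := polar_small (erefl : (0 < 1)%BZ) L1 L2 Q1 Q2 e12.
rewrite /ktr /= -/disc => b12.
have y0 : y = Z0 by apply: square_sum_small (b12) _; lia.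
rewrite {}y0 in e12 b12.
have hx : (- 2 <= x <= 2)%BZ by nia.
pose T := if (x =? 0)%BZ then 5%BZ else 3%BZ.
have T_bd : (3 <= T <= 5)%BZ by rewrite /T; case: ifP.
have [v3 L3 Q3] := universal_phi (pos_int T ltac:(lia)).
have [[p z] e13] := pol _ _ L1 L3.
have := polar_small (erefl : (0 < 1)%BZ) L1 L3 Q1 Q3 e13.
rewrite /ktr /= -/disc => b13.
have z0 : z = Z0 by apply: square_sum_small (b13) _; lia.
rewrite {}z0 in e13 b13.
have [[q z'] e23] := pol _ _ L2 L3.
have := polar_small (erefl : (0 < 2)%BZ) L2 L3 Q2 Q3 e23.
rewrite /ktr /= -/disc => b23.
have z0 : z' = Z0 by apply: square_sum_small (b23) _; lia.
rewrite {}z0 in e23 b23.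
have det := @escalation_det_neq0 x p q hx ltac:(lia) ltac:(lia).
have [v Lv Qv] := universal_phi al_pos.
(* [polar_small] bounds by $8a(r+2)\le 40(r+2)$, which is below the discriminant; the constant
   $1760=40\cdot 44$ comes from here. *)
have rational u a b : (0 < a <= 5)%BZ -> L u -> Q u = phi (a, Z0) -> B u v = phi b ->
    b.2 = Z0.
  move=> a_bd Lu Qu eb; have := polar_small (proj1 a_bd) Lu Lv Qu Qv eb.
  by rewrite -/disc => h; apply: square_sum_small h _; nia.
have [[b1 c1] e1] := pol _ _ L1 Lv; have /= c10 := rational _ 1%BZ _ ltac:(lia) L1 Q1 e1.
have [[b2 c2] e2] := pol _ _ L2 Lv; have /= c20 := rational _ 2%BZ _ ltac:(lia) L2 Q2 e2.
have [[b3 c3] e3] := pol _ _ L3 Lv; have /= c30 := rational _ T _ ltac:(lia) L3 Q3 e3.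
rewrite {}c10 {}c20 {}c30 in e1 e2 e3.
pose G := Gram (2, Z0)%BZ (x, Z0) (p, Z0) (4, Z0)%BZ (q, Z0) (2 * T, Z0)%BZ.
have diag u a : Q u = phi (a, Z0) -> B u u = phi (2 * a, Z0)%BZ.
  by move=> Qu; rewrite (polar_diag lattice_quad) Qu -phi_dbl.
have uG : gram_of D s Q G v1 v2 v3.
  by split; split=> //=; [rewrite (diag _ 1%BZ)|rewrite (diag _ 2%BZ)|rewrite (diag _ T)].
have detE : gram_det t n G
    = (2 * T * (8 - x * x) - (4 * (p * p) - 2 * (x * (p * q)) + 2 * (q * q)), Z0)%BZ.
  by rewrite /gram_det /kdot /= !kintE; congr pair; ring.
set d := (_ - _)%BZ in detE.
have d_neq0 : d <> Z0 by rewrite /d; lia.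
have det0 : phi (gram_det t n G) != 0.
  rewrite detE; apply/eqP => e; apply: d_neq0.
  by have := @phi_inj D F s D_gt1 D_sqf F_eq (d, Z0) kzero; rewrite e phi0 => /(_ erefl) [].
have [U dimU L_U] := lattice_ambient.
have hv : polars_of D s Q v1 v2 v3 v ((b1, Z0), (b2, Z0), (b3, Z0)) by split.
(* The right side is rational, whereas the left side is $2d\cdot$[al], with [omega]-coordinate
   $2d\ne 0$. *)
have := polar_cramer F_eq lattice_quad dimU L_U L1 L2 L3 uG det0 Lv hv hv.
rewrite (polar_diag lattice_quad) Qv -phi_dbl -(phi_mul F_eq).
move=> /(phi_inj D_gt1 D_sqf F_eq); rewrite detE /kdot /gram_app /adj_gram /= !kintE.
by rewrite /kmul /kdbl /= => -[_]; nia.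
Qed.

End Universal.

(** * Overlattices *)

Section OverlatticeChecks.

Variables t n : Z.
Local Notation gram_det := (gram_det t n).
Local Notation gram_app := (gram_app t n).
Local Notation kdot := (kdot t n).

Definition vzero : vec3 := (kzero, kzero, kzero).

Definition residues (m : Z) : seq K :=
  [seq (a, b) | a <- zrange 0 (m - 1), b <- zrange 0 (m - 1)].

Definition kdvz (m : Z) (x : K) : bool :=
  if (x.1 mod m =? 0)%BZ then (x.2 mod m =? 0)%BZ else false.

(* Coordinates, multiplied by m, of the possible classes of L modulo the lattice
   with Gram matrix G that are killed by m. *)
Definition over_residues (G : gram3) (ex : seq vec3) (m : Z) : seq vec3 :=
  let d := gram_det G in
  (* By Cramer's rule [d] times L lies in the frame lattice, so m divides [d] times each
     numerator. *)
  let rs := [seq r <- residues m | kdvz m (kmul t n d r)] in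
  [seq r <- [seq (ab, c) | ab <- [seq (a, b) | a <- rs, b <- rs], c <- rs]
     | let g := gram_app G r in
       if kdvz m g.1.1 then if kdvz m g.1.2 then if kdvz m g.2 then
         (* If $w$ has coordinates $r/m$, then [kdot r g] is $2m^2Q(w)$. *)
         kdvz (2 * (m * m))%BZ (kdot r g) && all (fun e => kdvz m (kdot r e)) ex
       else false else false else false].

Definition kdivz (m : Z) (x : K) : K := (x.1 / m, x.2 / m)%BZ.

Definition over_polars (G : gram3) (m : Z) (r : vec3) : vec3 :=
  let g := gram_app G r in (kdivz m g.1.1, kdivz m g.1.2, kdivz m g.2).

(** The norm of the determinant carries L into the frame lattice. Removing its factors one at a
    time, either the quotient is trivial or a nonzero class killed by some factor appears, and
    adjoining such a class must produce an element of T. *)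
Definition over_check (T : seq (gram3 * seq vec3)) (G : gram3)
    (pcs : seq (Z * seq cert)) : bool :=
  (foldr Z.mul 1%BZ (unzip1 pcs) =? knm t n (gram_det G))%BZ
  && all (fun pc : Z * seq cert =>
       (0 <? pc.1)%BZ
       (* [Accept] is sound from [has_lattice] alone; the other constructors rely on the positivity
          recorded by [realizes]. *)
       && all2 (fun r c => if c is Accept _ _ _ _ _ then
                   run t n T c (State3 G [:: over_polars G pc.1 r]) else false)
            [seq r <- over_residues G [::] pc.1 | ~~ veq r vzero] pc.2) pcs.

(* For each prime p dividing the norm of the determinant of a target, an integral lattice
   containing the target with an element of order p in the quotient contains a previous
   target, so a lattice minimal in the list is all of L. *)
Fixpoint over_closed (prev rest : seq (gram3 * seq vec3))
    (certs : seq (seq (Z * seq cert))) : bool :=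
  match rest, certs with
  | [::], _ => true
  | T :: rest', c :: certs' =>
    [&& nilp T.2, over_check prev T.1 c & over_closed (rcons prev T) rest' certs']
  | _, _ => false
  end.

End OverlatticeChecks.

Lemma veqP u v : reflect (u = v) (veq u v).
Proof.
case: u v => -[a b] c [[a' b'] c']; rewrite /veq /=.
by apply: (iffP and3P) => [[/keqP -> /keqP -> /keqP ->] | [-> -> ->]] //; split; apply/keqP.
Qed.

Lemma mem_residues m a b : (0 < m)%BZ -> (a mod m, b mod m)%BZ \in residues m.
Proof.
move=> m0; have := Z.mod_pos_bound a m m0; have := Z.mod_pos_bound b m m0 => h1 h2.
by apply/allpairsP; exists (a mod m, b mod m)%BZ; split=> //=; apply: mem_zrange; lia.
Qed.

Section Overlattices.

Variables (D : nat) (F : fieldExtType rat) (s : F).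
Hypotheses (D_gt1 : (1 < D)%N) (D_sqf : squarefree D).
Hypothesis F_eq : is_quadratic_field D s.

Local Notation t := (omega_tr D).
Local Notation n := (omega_nm D).
Local Notation phi := (phi D s).

Variables (V : vectType F) (Q : V -> F) (L : V -> Prop).
Hypothesis Q_quad : quadratic_map Q.
Hypothesis L_add : forall u v, L u -> L v -> L (u + v).
Hypothesis L_scale : forall k v, L v -> L (phi k *: v).
Hypothesis L_OF : forall v, L v -> exists k, Q v = phi k.
Variable U : {vspace V}.
Hypotheses (dimU : \dim U = 3) (L_U : forall v, L v -> v \in U).

Local Notation B := (polar Q).
Local Notation comb := (combination D s).

Let phiE' := phiE F_eq.
Let phi_inj' := phi_inj D_gt1 D_sqf F_eq.

Lemma kdvz_mul m q x : (0 < m)%BZ -> phi x = phi (m, Z0) * phi q ->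
  kdvz m x /\ kdivz m x = q.
Proof.
rewrite -(phi_mul F_eq) => m0 /phi_inj' ->; case: q => a b.
have -> : kmul t n (m, Z0) (a, b) = (a * m, b * m)%BZ.
  by rewrite /kmul /=; congr pair; ring.
by rewrite /kdvz /kdivz /= !Z.mod_mul ?Z.div_mul //; lia.
Qed.

Section Frame.

Variables (G : gram3) (u1 u2 u3 : V).
Hypotheses (Lu1 : L u1) (Lu2 : L u2) (Lu3 : L u3).
Hypothesis uG : gram_of D s Q G u1 u2 u3.
Hypothesis detG : phi (gram_det t n G) != 0.

Local Notation cmb x := (comb x u1 u2 u3).

Lemma comb_lattice x : L (cmb x).
Proof. by rewrite /combination; apply: L_add; [apply: L_add|]; apply: L_scale. Qed.

Lemma polar_comb x w y : polars_of D s Q u1 u2 u3 w y ->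
  B (cmb x) w = phi (kdot t n x y).
Proof.
case=> y1 y2 y3; rewrite /combination (polar_addl Q_quad) (polar_addl Q_quad).
by rewrite !(polar_scalel Q_quad) y1 y2 y3 /kdot !phiE' addrA.
Qed.

Lemma polars_comb x : polars_of D s Q u1 u2 u3 (cmb x) (gram_app t n G x).
Proof.
have [[B11 B12 B13] [B22 B23 B33]] := uG.
case: x => -[a b] c; rewrite /polars_of /combination /gram_app /=.
rewrite !(polar_addr Q_quad) !(polar_scaler Q_quad) B11 B12 B13 B22 B23 B33.
rewrite (polarC Q u2 u1) (polarC Q u3 u1) (polarC Q u3 u2) B12 B13 B23 !phiE'.
by split; ring.
Qed.

Lemma comb_inj x y : cmb x = cmb y -> x = y.
Proof.
move=> e; have e0 : (phi x.1.1 - phi y.1.1) *: u1 + (phi x.1.2 - phi y.1.2) *: u2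
    + (phi x.2 - phi y.2) *: u3 = 0.
  rewrite !scalerBl -[RHS](subrr (cmb x)) {2}e /combination !opprD.
  by rewrite (addrACA (phi x.1.1 *: u1)) (addrACA (phi x.1.1 *: u1 + _)).
have B0 u : B u ((phi x.1.1 - phi y.1.1) *: u1 + (phi x.1.2 - phi y.1.2) *: u2
    + (phi x.2 - phi y.2) *: u3) = 0 by rewrite e0 (polar0r Q_quad).
have [] := gram_kernel F_eq Q_quad uG detG erefl (B0 u1) (B0 u2) (B0 u3).
have eq k k' : phi k - phi k' = 0 -> k = k' by move=> h; apply/phi_inj'/eqP; rewrite -subr_eq0 h.
by case: x y {e e0 B0} => -[a b] c [[a' b'] c'] /= /eq -> /eq -> /eq ->.
Qed.

(** Reducing numerators modulo m moves [w] by a vector of the frame lattice. Integrality of Q and of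
    the polars, together with Cramer's rule, gives the tests of [over_residues]. *)
Lemma over_residuesP ex m w x : (0 < m)%BZ -> L w ->
  (forall e, e \in ex -> exists2 v, L v & polars_of D s Q u1 u2 u3 v e) ->
  phi (m, Z0) *: w = cmb x ->
  exists r y w', [/\ r \in over_residues t n G ex m, w = cmb y + w', L w',
    phi (m, Z0) *: w' = cmb r & polars_of D s Q u1 u2 u3 w' (over_polars t n G m r)].
Proof.
move=> m0 Lw exP wE.
pose red (k : K) : K := (k.1 mod m, k.2 mod m)%BZ.
pose r : vec3 := (red x.1.1, red x.1.2, red x.2).
pose y : vec3 := (kdivz m x.1.1, kdivz m x.1.2, kdivz m x.2).
have kE k : phi k = phi (m, Z0) * phi (kdivz m k) + phi (red k).
  rewrite -(phi_mul F_eq) -phi_add; congr phi; case: k => a b.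
  have [ea eb] : (a = m * (a / m) + a mod m /\ b = m * (b / m) + b mod m)%BZ.
    by split; apply: Z.div_mod; lia.
  by rewrite /kadd /kmul /=; congr pair; [rewrite {1}ea | rewrite {1}eb]; ring.
pose w' := w - cmb y.
have Lw' : L w' by apply: (L_sub L_add L_scale Lw); apply: comb_lattice.
have w'E : phi (m, Z0) *: w' = cmb r.
  rewrite /w' scalerBr wE /combination !scalerDr !scalerA.
  apply/eqP; rewrite subr_eq; apply/eqP.
  rewrite (addrACA (phi r.1.1 *: u1 + _)) (addrACA (phi r.1.1 *: u1)) -!scalerDl.
  by rewrite /= !(addrC (phi (red _))) -!kE.
have [k1 e1] := polar_OF L_add L_OF Lu1 Lw'.
have [k2 e2] := polar_OF L_add L_OF Lu2 Lw'.
have [k3 e3] := polar_OF L_add L_OF Lu3 Lw'.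
have pc : polars_of D s Q u1 u2 u3 w' (k1, k2, k3) by [].
have [g1 g2 g3] := polars_comb r.
rewrite -w'E !(polar_scaler Q_quad) e1 e2 e3 in g1 g2 g3.
have [d1 q1] := kdvz_mul m0 (esym g1); have [d2 q2] := kdvz_mul m0 (esym g2).
have [d3 q3] := kdvz_mul m0 (esym g3).
have op : over_polars t n G m r = (k1, k2, k3) by rewrite /over_polars q1 q2 q3.
exists r, y, w'; split; rewrite ?op //; last by rewrite /w' addrC subrK.
rewrite mem_filter; cbv zeta beta; rewrite d1 d2 d3; apply/andP; split.
  have [q eq] := L_OF Lw'; apply/andP; split; last first.
    apply/allP => e /exP [v Lv hv]; have [k ek] := polar_OF L_add L_OF Lw' Lv.
    apply: (kdvz_mul (q := k) m0 _).1.
    by rewrite -(polar_comb r hv) -w'E (polar_scalel Q_quad) ek.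
  apply: (kdvz_mul (q := q) _ _).1; first by nia.
  rewrite -(polar_comb r (polars_comb r)) -w'E (polar_scalel Q_quad) (polar_scaler Q_quad).
  rewrite (polar_diag Q_quad) eq; have -> : phi (2 * (m * m), Z0)%BZ
    = 2 * (phi (m, Z0) * phi (m, Z0)).
    by rewrite -(phi_mul F_eq) -phi_dbl; congr phi; rewrite /kmul /kdbl /=; congr pair; ring.
  by ring.
have cr := cramer F_eq Q_quad dimU L_U Lu1 Lu2 Lu3 uG detG Lw' pc.
have dvd : [/\ kdvz m (kmul t n (gram_det t n G) r.1.1),
    kdvz m (kmul t n (gram_det t n G) r.1.2) & kdvz m (kmul t n (gram_det t n G) r.2)].
  set z := gram_app _ _ _ _ in cr.
  have := congr1 (fun v => phi (m, Z0) *: v) cr.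
  rewrite scalerA mulrC -scalerA w'E -!combination_scale //.
  move/comb_inj => e.
  split; [apply: (kdvz_mul (q := z.1.1) m0 _).1 | apply: (kdvz_mul (q := z.1.2) m0 _).1
    | apply: (kdvz_mul (q := z.2) m0 _).1]; rewrite -(phi_mul F_eq).
  - exact: (congr1 (fun v : vec3 => phi v.1.1) e).
  - exact: (congr1 (fun v : vec3 => phi v.1.2) e).
  - exact: (congr1 (fun v : vec3 => phi v.2) e).
have [v1 v2 v3] := dvd.
apply/allpairsP; exists (red x.1.1, red x.1.2, red x.2); split=> //=.
  apply/allpairsP; exists (red x.1.1, red x.1.2); split=> //=;
  by rewrite mem_filter ?v1 ?v2 mem_residues.
by rewrite mem_filter v3 mem_residues.
Qed.

End Frame.

Definition full_lattice (G : gram3) : Prop :=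
  exists u1 u2 u3, [/\ L u1, L u2 & L u3]
    /\ [/\ gram_of D s Q G u1 u2 u3, phi (gram_det t n G) != 0
         & forall v, L v -> exists x, v = comb x u1 u2 u3].

Variable gens : seq V.
Hypothesis gens_L : forall v, v \in gens -> L v.
Hypothesis L_gens : forall v, L v -> OF_span gens v.

(** Induction on the factors: if $pk\,w$ is in the frame lattice, then $k\,w$ is a class killed by
    $p$; either it is trivial and one continues with $k$, or it exhibits an element of T. *)
Lemma over_check_sound T G pcs : over_check t n T G pcs -> has_lattice D s Q L (G, [::]) ->
  full_lattice G \/ exists2 T', List.In T' T & has_lattice D s Q L T'.
Proof.
set P := exists2 T', _ & _.
case/andP=> /Z.eqb_eq prod_eq checks [u1 [u2 [u3 [[L1 L2 L3] [/= uG det0 _]]]]].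
pose M v := exists x, v = comb x u1 u2 u3.
have descend w : L w -> M (phi (foldr Z.mul 1%BZ (unzip1 pcs), Z0) *: w) -> M w \/ P.
  elim: pcs checks w {prod_eq} => [|[p cs] pcs' IHp] /= => [_ w _|].
    by rewrite phi_int zr1 scale1r; left.
  case/andP=> /andP [/Z.ltb_lt p0 ok] /IHp {}IHp w Lw.
  set k := foldr _ _ _ in IHp *; have -> : phi (p * k, Z0)%BZ = phi (p, Z0) * phi (k, Z0).
    by rewrite -(phi_mul F_eq); congr phi; rewrite /kmul /=; congr pair; ring.
  rewrite -scalerA => -[x wE].
  have Lw1 : L (phi (k, Z0) *: w) by apply: L_scale.
  have [//|r [y [w' [r_in w1E Lw' w'E pc]]]] :=
    @over_residuesP G u1 u2 u3 L1 L2 L3 uG det0 [::] p _ x p0 Lw1 _ wE.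
  have [/veqP r0|r0] := boolP (veq r vzero).
    apply: IHp => //; exists y; rewrite w1E; suff -> : w' = 0 by rewrite addr0.
    move: w'E; rewrite r0 /combination /= !phi0 !scale0r !addr0 => /eqP.
    rewrite scaler_eq0 => /orP [/eqP e|/eqP //]; exfalso.
    have [p00] : (p, Z0) = kzero by apply: phi_inj'; rewrite e phi0.
    by rewrite p00 in p0; lia.
  right; have : r \in [seq r <- over_residues t n G [::] p | ~~ veq r vzero].
    by rewrite mem_filter r0.
  elim: [seq _ <- _ | _] cs ok => //= r1 rs IH [|c cs] //= /andP [ok1 ok2].
  rewrite inE => /orP [/eqP er|]; last exact: IH ok2.
  move: ok1; rewrite -er; case: c => // i q1 q2 q3 qs ok1.
  apply: (accept_sound D_gt1 D_sqf F_eq Q_quad L_add L_scale L_OF dimU L_U ok1).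
  exists u1, u2, u3; split=> //; split=> // x'; rewrite inE => /eqP ->.
  by exists w'.
have all_M w : L w -> M w \/ P.
  move=> Lw; apply: descend => //; rewrite prod_eq phi_int.
  have [k1 e1] := polar_OF L_add L_OF L1 Lw; have [k2 e2] := polar_OF L_add L_OF L2 Lw.
  have [k3 e3] := polar_OF L_add L_OF L3 Lw.
  have pc : polars_of D s Q u1 u2 u3 w (k1, k2, k3) by [].
  have cr := cramer F_eq Q_quad dimU L_U L1 L2 L3 uG det0 Lw pc.
  exists (vscale t n (kconj t (gram_det t n G))
    (gram_app t n (adj_gram t n G) (k1, k2, k3))).
  by rewrite combination_scale // -cr scalerA mulrC -(phi_nm F_eq).
(* The alternative is settled on finitely many generators, so it need not be decided uniformly over
   L. *)
have [gens_M|] : (forall v, v \in gens -> M v) \/ P; last by right.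
  elim: (gens) gens_L => [_|g gs IH gL]; first by left.
  have [|gs_M|] := IH; [by move=> v vg; apply: gL; rewrite inE vg orbT | | by right].
  have [gM|] := all_M g (gL g (mem_head _ _)); last by right.
  by left=> v; rewrite inE => /orP [/eqP -> //|/gs_M].
left; exists u1, u2, u3; split=> //; split=> // v /L_gens [c cO ->].
elim/big_ind: _ => [|_ _ [x ->] [y ->]|i _].
- by exists vzero; rewrite /combination /= !phi0 !scale0r !addr0.
- by exists (vadd x y); rewrite combination_add.
have [k ->] := OF_phiP D_gt1 D_sqf F_eq (cO i).
have [x ->] := gens_M _ (mem_nth 0 (ltn_ord i)).
by exists (vscale t n k x); rewrite combination_scale.
Qed.

(** The hypothesis on [prev] is the invariant: containing a target already treated makes L equal to
    some target of the list. *)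
Lemma over_closed_sound prev rest certs T : over_closed t n prev rest certs ->
  (forall T', List.In T' prev -> has_lattice D s Q L T' ->
     exists2 T'', List.In T'' (prev ++ rest) & full_lattice T''.1) ->
  List.In T rest -> has_lattice D s Q L T ->
  exists2 T'', List.In T'' (prev ++ rest) & full_lattice T''.1.
Proof.
elim: rest prev certs => [|[G ex] rest IH] prev [|c certs] //= /and3P [/nilP -> ok cl] hp.
have all_eq : prev ++ (G, [::]) :: rest = rcons prev (G, [::]) ++ rest.
  by rewrite cat_rcons.
have first_ok : has_lattice D s Q L (G, [::]) ->
    exists2 T'', List.In T'' (prev ++ (G, [::]) :: rest) & full_lattice T''.1.
  move=> /(over_check_sound ok) [fl|[T' T'_in /(hp _ T'_in)]] //.
  exists (G, [::]) => //; elim: prev {hp ok all_eq IH cl} => [|T' prev IHp]; [by left|by right].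
case=> [<- //|T_in hT]; rewrite all_eq; apply: IH cl _ T_in hT => T' T'_in hT'.
have [T'_prev|eT] : List.In T' prev \/ (G, [::]) = T'.
  elim: (prev) T'_in => [|T1 r IHp] /=.
    by case=> // ->; right.
  by case=> [->|/IHp [|]]; auto.
- by rewrite -all_eq; apply: hp hT'.
- by rewrite -all_eq; apply: first_ok; rewrite eT.
Qed.

End Overlattices.

(** * Ternary forms *)

Record kform := KForm { kxx : K; kyy : K; kzz : K; kxy : K; kxz : K; kyz : K }.

Definition kform_gram (f : kform) : gram3 :=
  Gram (kdbl (kxx f)) (kxy f) (kxz f) (kdbl (kyy f)) (kyz f) (kdbl (kzz f)).

Definition kform_map (h : K -> K) (f : kform) : kform :=
  KForm (h (kxx f)) (h (kyy f)) (h (kzz f)) (h (kxy f)) (h (kxz f)) (h (kyz f)).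

Section Correspondence.

Variables (D : nat) (F : fieldExtType rat) (s : F).
Hypotheses (D_gt1 : (1 < D)%N) (D_sqf : squarefree D).
Hypothesis F_eq : is_quadratic_field D s.

Local Notation t := (omega_tr D).
Local Notation n := (omega_nm D).
Local Notation phi := (phi D s).

Definition phi_form (f : kform) : ternary_form F :=
  TForm (phi (kxx f)) (phi (kyy f)) (phi (kzz f)) (phi (kxy f)) (phi (kxz f)) (phi (kyz f)).

Lemma conj_phi_form f : conj_form s (phi_form f) = phi_form (kform_map (kconj t) f).
Proof. by rewrite /conj_form /map_form /phi_form /= !(gconj_phi D_gt1 D_sqf F_eq). Qed.

Lemma scale_phi_form c f :
  scale_form (phi c) (phi_form f) = phi_form (kform_map (kmul t n c) f).
Proof. by rewrite /scale_form /map_form /phi_form /= !(phi_mul F_eq). Qed.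

Variables (V : vectType F) (Q : V -> F) (L : V -> Prop).
Hypothesis L_lat : quadratic_lattice 3 Q L.

Local Notation B := (polar Q).
Local Notation comb := (combination D s).

Let Q_quad : quadratic_map Q := lattice_quad L_lat.

Lemma eval_phi_form f u1 u2 u3 x y z :
  gram_of D s Q (kform_gram f) u1 u2 u3 ->
  Q (x *: u1 + y *: u2 + z *: u3) = eval_form (phi_form f) x y z.
Proof.
case=> -[B11 B12 B13] [B22 B23 B33].
have two0 : 2 != 0 :> F by rewrite F_char0.
apply: (mulfI two0); rewrite -(polar_diag Q_quad).
rewrite !(polar_addl Q_quad) !(polar_addr Q_quad) !(polar_scalel Q_quad).
rewrite !(polar_scaler Q_quad) (polarC Q u2 u1) (polarC Q u3 u1) (polarC Q u3 u2).
by rewrite B11 B12 B13 B22 B23 B33 /eval_form /= !phi_dbl; ring.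
Qed.

Lemma corresponds_full f : full_lattice D s Q L (kform_gram f) ->
  corresponds Q L (phi_form f).
Proof.
case=> u1 [u2 [u3 [[L1 L2 L3] [uG det0 full]]]].
exists u1, u2, u3; split.
- exact: (frame_free F_eq Q_quad uG det0).
- move=> v; split=> [/full [x ->]|[x [y [z [xO yO zO ->]]]]].
    exists (phi x.1.1), (phi x.1.2), (phi x.2).
    by split=> //; apply: OF_phi.
  by apply: (lattice_add L_lat); [apply: (lattice_add L_lat)|];
     apply: (lattice_scaleOF L_lat).
- by move=> x y z _ _ _; apply: eval_phi_form.
Qed.

End Correspondence.

(** * Determinants and coordinates in rank three *)

Section Determinants.

Variables (F : fieldExtType rat) (V : vectType F).

Definition det33 (a b c d e f g h i : F) : F :=
  a * (e * i - f * h) - b * (d * i - f * g) + c * (d * h - e * g).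

Lemma det33_mul a b c d e f g h i a' b' c' d' e' f' g' h' i' :
  det33 a b c d e f g h i * det33 a' b' c' d' e' f' g' h' i' =
  det33 (a * a' + b * d' + c * g') (a * b' + b * e' + c * h') (a * c' + b * f' + c * i')
        (d * a' + e * d' + f * g') (d * b' + e * e' + f * h') (d * c' + e * f' + f * i')
        (g * a' + h * d' + i * g') (g * b' + h * e' + i * h') (g * c' + h * f' + i * i').
Proof. by rewrite /det33; ring. Qed.

Lemma OF_sub (x y : F) : OF x -> OF y -> OF (x - y). Proof. exact: integral_sub. Qed.
Lemma OF_mul (x y : F) : OF x -> OF y -> OF (x * y). Proof. exact: integral_mul. Qed.
Lemma OF_add (x y : F) : OF x -> OF y -> OF (x + y). Proof. exact: integral_add. Qed.

Lemma OF_det33 a b c d e f g h i : OF a -> OF b -> OF c -> OF d -> OF e -> OF f ->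
  OF g -> OF h -> OF i -> OF (det33 a b c d e f g h i).
Proof.
move=> *; apply: OF_add; [apply: OF_sub|]; apply: OF_mul => //;
  by apply: OF_sub; apply: OF_mul.
Qed.

Lemma free3_inj (b1 b2 b3 : V) (x y z x' y' z' : F) : free [:: b1; b2; b3] ->
  x *: b1 + y *: b2 + z *: b3 = x' *: b1 + y' *: b2 + z' *: b3 ->
  [/\ x = x', y = y' & z = z'].
Proof.
move=> fr e; have : (x - x') *: b1 + (y - y') *: b2 + (z - z') *: b3 = 0.
  rewrite !scalerBl -[RHS](subrr (x *: b1 + y *: b2 + z *: b3)) {2}e !opprD.
  by rewrite (addrACA (x *: b1)) (addrACA (x *: b1 + _)).
pose k (i : 'I_3) := nth 0 [:: x - x'; y - y'; z - z'] i.
have /freeP fr' : free [tuple b1; b2; b3] := fr.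
move=> e0; have k0 : forall i, k i = 0.
  by apply: fr'; rewrite !big_ord_recl big_ord0 addr0 addrA /k /=.
split; apply/eqP; rewrite -subr_eq0; apply/eqP.
- exact: (k0 ord0).
- exact: (k0 (Ordinal (isT : 1 < 3)%N)).
- exact: (k0 (Ordinal (isT : 2 < 3)%N)).
Qed.

End Determinants.

(** * Lattices with an ideal as third coefficient, and their non-freeness *)

Section Ideal.

Variables (D : nat) (F : fieldExtType rat) (s : F).
Hypotheses (D_gt1 : (1 < D)%N) (D_sqf : squarefree D).
Hypothesis F_eq : is_quadratic_field D s.

Local Notation t := (omega_tr D).
Local Notation n := (omega_nm D).
Local Notation phi := (phi D s).
Local Notation comb := (combination D s).

Variables (V : vectType F) (Q : V -> F) (L : V -> Prop).
Hypothesis L_lat : quadratic_lattice 3 Q L.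

Local Notation B := (polar Q).
Let Q_quad : quadratic_map Q := lattice_quad L_lat.
Let L_add := lattice_add L_lat.
Let L_scale := lattice_scale F_eq L_lat.
Let L_OF := lattice_OF D_gt1 D_sqf F_eq L_lat.
Let phi_inj' := phi_inj D_gt1 D_sqf F_eq.
Let phiE' := phiE F_eq.

(* The fractional ideal Z + Z eta, where 2 eta = c + omega. *)
Variables (c : Z) (eta : F).
Hypothesis eta_def : 2 * eta = phi (c, 1%BZ).

Definition half_ideal (z : F) : Prop :=
  exists a b : int, z = a%:~R + b%:~R * eta.

(** Since $2\eta=c+\omega$, one has $(a+b\omega)/m=(a-cb)/m+(2b/m)\eta$; the last two tests ask
    these coefficients to be integers. *)
Definition in_half_ideal (m : Z) (r : vec3) : bool :=
  [&& kdvz m r.1.1, kdvz m r.1.2, ((r.2.1 - c * r.2.2) mod m =? 0)%BZ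
    & ((2 * r.2.2) mod m =? 0)%BZ].

Lemma half_idealP z : half_ideal z <-> exists a b : Z, z = zr F a + zr F b * eta.
Proof.
split=> [[a [b ->]]|[a [b ->]]]; last by exists (int_of_Z a), (int_of_Z b).
by exists (Z_of_int a), (Z_of_int b); rewrite !zr_int.
Qed.

Lemma kdvz_div m k : (0 < m)%BZ -> kdvz m k -> phi k = phi (m, Z0) * phi (kdivz m k).
Proof.
case: k => a b m0; rewrite /kdvz /=; case: ifP => // /Z.eqb_eq ea /Z.eqb_eq eb.
rewrite -(phi_mul F_eq) /kmul /kdivz /=; congr phi.
have := Z.div_mod a m; have := Z.div_mod b m; rewrite ea eb.
by move=> h1 h2; congr pair; lia.
Qed.

Lemma half_ideal_residue m k r : (0 < m)%BZ ->
  ((r.1 - c * r.2) mod m = 0)%BZ -> ((2 * r.2) mod m = 0)%BZ ->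
  exists2 z, half_ideal z & phi (m, Z0) * z = phi (m, Z0) * phi k + phi r.
Proof.
case: r k => a b [a' b'] m0 /= h1 h2.
pose x := ((a - c * b) / m)%BZ; pose y := (2 * b / m)%BZ.
have hx : (a - c * b = m * x)%BZ by have := Z.div_mod (a - c * b) m; rewrite h1; lia.
have hy : (2 * b = m * y)%BZ by have := Z.div_mod (2 * b) m; rewrite h2; lia.
exists (zr F (a' - c * b' + x)%BZ + zr F (2 * b' + y)%BZ * eta).
  by apply/half_idealP; do 2!eexists.
have two0 : 2 != 0 :> F by rewrite F_char0.
apply: (mulfI two0).
transitivity (phi (m, Z0) * (2 * zr F (a' - c * b' + x)%BZ
   + zr F (2 * b' + y)%BZ * phi (c, 1%BZ))); first by rewrite -eta_def; ring.
have -> : 2 = phi (2, Z0)%BZ by rewrite phi_int.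
rewrite -!(phi_int D s) -!(phi_mul F_eq) -!phi_add -!(phi_mul F_eq).
congr phi; rewrite /kadd /kmul /=.
have -> : a = (m * x + c * b)%BZ by lia.
by congr pair; nia.
Qed.

(** The extra vector has the polars of [eta *: u3], hence equals it; this gives one inclusion. For
    the other, the determinant divides m, so m L lies in the frame lattice, and each class of L
    modulo it has been checked to have integral first coordinates and its third in
    $\mathbb{Z}+\mathbb{Z}\eta$. *)
Lemma corresponds_half f x m :
  has_lattice D s Q L (kform_gram f, [:: x]) ->
  phi x.1.1 = eta * phi (kxz f) -> phi x.1.2 = eta * phi (kyz f) ->
  phi x.2 = eta * phi (kdbl (kzz f)) ->
  (0 < m)%BZ -> kdvd t n (gram_det t n (kform_gram f)) (m, Z0) ->
  all (in_half_ideal m) (over_residues t n (kform_gram f) [:: x] m) ->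
  exists u1 u2 u3, [/\ free [:: u1; u2; u3],
    forall v, L v <-> exists x y z : F,
          [/\ OF x, OF y, half_ideal z & v = x *: u1 + y *: u2 + z *: u3]
    & forall x y z : F, Q (x *: u1 + y *: u2 + z *: u3) = eval_form (phi_form D s f) x y z].
Proof.
case=> u1 [u2 [u3 [[L1 L2 L3] [/= uG det0 exP]]]] x1 x2 x3 m0 dvd /allP ok.
have [U dimU L_U] := lattice_ambient L_lat.
have [e Le [e1 e2 e3]] := exP x (mem_head _ _).
have eE : e = eta *: u3.
  apply/eqP; rewrite -subr_eq0; apply/eqP.
  have wU : e - eta *: u3 \in U by rewrite memvB ?memvZ ?L_U.
  have [c1 [c2 [c3 wE]]] := frame_span F_eq Q_quad dimU L_U L1 L2 L3 uG det0 wU.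
  have [[_ _ B13] [_ B23 B33]] := uG.
  have pol u : B u (e - eta *: u3) = B u e - eta * B u u3.
    by rewrite (polar_addr Q_quad) (polar_oppr Q_quad) (polar_scaler Q_quad).
  have [] := gram_kernel F_eq Q_quad uG det0 wE.
  - by rewrite pol e1 B13 x1 subrr.
  - by rewrite pol e2 B23 x2 subrr.
  - by rewrite pol e3 B33 x3 subrr.
  by move=> c10 c20 c30; rewrite wE c10 c20 c30 !scale0r !addr0.
exists u1, u2, u3; split.
- exact: (frame_free F_eq Q_quad uG det0).
- move=> v; split=> [Lv|[a [b [z [aO bO /half_idealP [k [l ->]] ->]]]]]; last first.
    rewrite scalerDl -scalerA -eE -(phi_int D s k) -(phi_int D s l).
    by do ![apply: L_add]; do ?[exact: L_scale | exact: (lattice_scaleOF L_lat)].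
  have [k1 p1] := polar_OF L_add L_OF L1 Lv; have [k2 p2] := polar_OF L_add L_OF L2 Lv.
  have [k3 p3] := polar_OF L_add L_OF L3 Lv.
  have pc : polars_of D s Q u1 u2 u3 v (k1, k2, k3) by [].
  have cr := cramer F_eq Q_quad dimU L_U L1 L2 L3 uG det0 Lv pc.
  have mv : exists y, phi (m, Z0) *: v = comb y u1 u2 u3.
    move/keqP: dvd => <-; rewrite (phi_mul F_eq) -scalerA cr.
    by eexists; rewrite -combination_scale.
  have [y0 mvE] := mv.
  have exP' e' : e' \in [:: x] -> exists2 w, L w & polars_of D s Q u1 u2 u3 w e'.
    exact: exP.
  have [r [y [w [/ok /and4P [r1 r2 r3 r4] vE Lw wE _]]]] :=
    over_residuesP D_gt1 D_sqf F_eq Q_quad L_add L_scale L_OF dimU L_U L1 L2 L3 uG det0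
      m0 Lv exP' mvE.
  have m_neq0 : phi (m, Z0) != 0.
    by apply/eqP => h; have [h'] : (m, Z0) = kzero; [apply: phi_inj'; rewrite h phi0 | lia].
  move/Z.eqb_eq in r3; move/Z.eqb_eq in r4.
  have [z zH zE] := half_ideal_residue y.2 m0 r3 r4.
  exists (phi (kadd y.1.1 (kdivz m r.1.1))), (phi (kadd y.1.2 (kdivz m r.1.2))), z.
  split=> //; try exact: OF_phi.
  apply: (scalerI m_neq0); rewrite vE scalerDr wE /combination !scalerDr !scalerA zE.
  have dist k k' : kdvz m k' ->
      phi (m, Z0) * phi (kadd k (kdivz m k')) = phi (m, Z0) * phi k + phi k'.
    by move=> h; rewrite phi_add mulrDr -(kdvz_div m0 h).
  rewrite !dist // (scalerDl u1 (_ * _)) (scalerDl u2 (_ * _)) (scalerDl u3 (_ * _)).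
  by rewrite (addrACA (_ + _) (_ *: u3)) (addrACA (_ *: u1)).
- by move=> a b z; apply: (eval_phi_form L_lat).
Qed.

Lemma knm_mul x y : knm t n (kmul t n x y) = (knm t n x * knm t n y)%BZ.
Proof. by rewrite /knm /kmul /=; ring. Qed.

Lemma half_ideal_add x y : half_ideal x -> half_ideal y -> half_ideal (x + y).
Proof.
move=> /half_idealP [a [b ->]] /half_idealP [a' [b' ->]]; apply/half_idealP.
by exists (a + a')%BZ, (b + b')%BZ; rewrite !zrE; ring.
Qed.

Hypothesis omega_eta : half_ideal (omega D s * eta).

Lemma half_ideal_phi k : half_ideal (phi k).
Proof.
apply/half_idealP; exists (k.1 - c * k.2)%BZ, (2 * k.2)%BZ.
have -> : zr F (2 * k.2)%BZ * eta = zr F k.2 * (2 * eta) by rewrite !zrE; ring.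
by rewrite eta_def /phi /= !zrE; ring.
Qed.

(** Containing $\omega\eta$ is what turns the group $\mathbb{Z}+\mathbb{Z}\eta$ into a module over
    the integers. *)
Lemma half_ideal_mul a z : OF a -> half_ideal z -> half_ideal (a * z).
Proof.
move=> /(OF_phiP D_gt1 D_sqf F_eq) [k ->] /half_idealP [x [y ->]].
have -> : phi k * (zr F x + zr F y * eta)
  = phi (kmul t n k (x, Z0)) + (zr F (k.1 * y)%BZ * eta + zr F (k.2 * y)%BZ * (omega D s * eta)).
  by rewrite phi_mul // phi_int /phi !zrE; ring.
apply: half_ideal_add; first exact: half_ideal_phi.
apply: half_ideal_add; first by apply/half_idealP; exists Z0, (k.1 * y)%BZ; rewrite zr0 add0r.
move/half_idealP: omega_eta => [a' [b' ->]]; apply/half_idealP.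
by exists (k.2 * y * a')%BZ, (k.2 * y * b')%BZ; rewrite !zrE; ring.
Qed.

Lemma half_ideal_det33 a b z d e f g h i : OF a -> OF b -> half_ideal z -> OF d -> OF e ->
  half_ideal f -> OF g -> OF h -> half_ideal i -> half_ideal (det33 a b z d e f g h i).
Proof.
move=> aO bO cH dO eO fH gO hO iH.
have -> : det33 a b z d e f g h i
  = (d * h - e * g) * z + ((b * g - a * h) * f + (a * e - b * d) * i).
  by rewrite /det33; ring.
by apply: half_ideal_add; [|apply: half_ideal_add]; apply: half_ideal_mul => //;
  apply: OF_sub; apply: OF_mul.
Qed.

(* If L were free, the determinant of a basis with respect to b1, b2, b3 would generate
   the ideal Z + Z eta. *)
Lemma half_not_free b1 b2 b3 : free [:: b1; b2; b3] ->
  (forall v, L v <-> exists x y z : F,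
     [/\ OF x, OF y, half_ideal z & v = x *: b1 + y *: b2 + z *: b3]) ->
  (forall r r' a b, knm t n r * knm t n (2 * a + b * c, b) = 4 ->
     knm t n (c, 1) * knm t n r = 4 * knm t n r' -> False)%BZ ->
  ~ free_lattice L.
Proof.
move=> fr bL no_norm [e [e_free eL]].
have O0 : OF (0 : F) by exact: integral0.
have O1 : OF (1 : F) by exact: integral1.
have H0 : half_ideal 0 by exists 0, 0; rewrite mul0r addr0.
have H1 : half_ideal 1 by exists 1, 0; rewrite mul0r addr0.
have Heta : half_ideal eta by exists 0, 1; rewrite mul1r add0r.
have Lb1 : L b1 by apply/bL; exists 1, 0, 0; rewrite scale1r !scale0r !addr0.
have Lb2 : L b2 by apply/bL; exists 0, 1, 0; rewrite scale1r !scale0r addr0 add0r.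
have Lb3 : L b3 by apply/bL; exists 0, 0, 1; rewrite scale1r !scale0r !add0r.
have Lb4 : L (eta *: b3) by apply/bL; exists 0, 0, eta; rewrite !scale0r !add0r.
have e_span v : L v -> v \in <<e>>%VS.
  by move=> /eL [k _ ->]; apply: memv_suml => i _; rewrite memvZ // memv_span // mem_nth.
have e_L v : v \in e -> L v.
  move=> /(nthP 0) [i i_lt <-]; apply/eL.
  exists (fun j : 'I_(size e) => (j == Ordinal i_lt)%:R) => [j|]; first by case: eqP.
  rewrite (bigD1 (Ordinal i_lt)) //= eqxx scale1r big1 ?addr0 // => j /negbTE ->.
  by rewrite scale0r.
have b_span v : L v -> v \in <<[:: b1; b2; b3]>>%VS.
  by case/bL => x [y [z [_ _ _ ->]]]; rewrite !memvD // memvZ // memv_span // !inE eqxx ?orbT.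
have size_e : size e = 3%N.
  rewrite -(eqnP e_free); have -> : <<e>>%VS = <<[:: b1; b2; b3]>>%VS; last exact: (eqnP fr).
  apply/eqP; rewrite eqEsubv; apply/andP; split; apply/span_subvP => v.
    by move/e_L/b_span.
  by rewrite !inE => /or3P [] /eqP ->; apply: e_span.
case: e size_e eL e_L {e_free e_span} => [|e1 [|e2 [|e3 [|]]]] // _ eL e_L.
have [x1 [y1 [z1 [x1O y1O z1H E1]]]] : exists x y z : F,
  [/\ OF x, OF y, half_ideal z & e1 = x *: b1 + y *: b2 + z *: b3].
  by apply/bL/e_L; rewrite !inE eqxx.
have [x2 [y2 [z2 [x2O y2O z2H E2]]]] : exists x y z : F,
  [/\ OF x, OF y, half_ideal z & e2 = x *: b1 + y *: b2 + z *: b3].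
  by apply/bL/e_L; rewrite !inE eqxx orbT.
have [x3 [y3 [z3 [x3O y3O z3H E3]]]] : exists x y z : F,
  [/\ OF x, OF y, half_ideal z & e3 = x *: b1 + y *: b2 + z *: b3].
  by apply/bL/e_L; rewrite !inE eqxx !orbT.
have coords v x y z : L v -> v = x *: b1 + y *: b2 + z *: b3 ->
    exists p q r, [/\ OF p, OF q & OF r] /\ [/\ p * x1 + q * x2 + r * x3 = x,
      p * y1 + q * y2 + r * y3 = y & p * z1 + q * z2 + r * z3 = z].
  move=> /eL [k kO vE] vE'.
  exists (k ord0), (k (lift ord0 ord0)), (k (lift ord0 (lift ord0 ord0))); split=> //.
  apply: (free3_inj fr); rewrite -vE' vE !big_ord_recl big_ord0 addr0 /= E1 E2 E3.
  rewrite !scalerDr !scalerA !scalerDl.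
  set a1 := (_ * x1) *: b1; set b1' := (_ * y1) *: b2; set c1 := (_ * z1) *: b3.
  rewrite (addrACA (a1 + _)) (addrACA (a1 + _ + _)) (addrACA a1) (addrACA (a1 + _)).
  by rewrite -[LHS]addrA.
have [p1 [q1 [r1 [[p1O q1O r1O] [a11 a12 a13]]]]] :=
  coords b1 1 0 0 Lb1 ltac:(by rewrite scale1r !scale0r !addr0).
have [p2 [q2 [r2 [[p2O q2O r2O] [a21 a22 a23]]]]] :=
  coords b2 0 1 0 Lb2 ltac:(by rewrite scale1r !scale0r addr0 add0r).
have [p3 [q3 [r3 [[p3O q3O r3O] [a31 a32 a33]]]]] :=
  coords b3 0 0 1 Lb3 ltac:(by rewrite scale1r !scale0r !add0r).
have [p4 [q4 [r4 [[p4O q4O r4O] [a41 a42 a43]]]]] :=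
  coords (eta *: b3) 0 0 eta Lb4 ltac:(by rewrite !scale0r !add0r).
(* [tau] lies in the ideal. Writing [b1], [b2] and either [b3] or [eta *: b3] in the basis [e] gives
   the integral determinants $\rho=1/\tau$ and $\rho'=\eta/\tau$. *)
pose tau := det33 x1 y1 z1 x2 y2 z2 x3 y3 z3.
pose rho := det33 p1 q1 r1 p2 q2 r2 p3 q3 r3.
pose rho' := det33 p1 q1 r1 p2 q2 r2 p4 q4 r4.
have rho_tau : rho * tau = 1.
  by rewrite /rho /tau det33_mul a11 a12 a13 a21 a22 a23 a31 a32 a33 /det33; ring.
have rho'_tau : rho' * tau = eta.
  by rewrite /rho' /tau det33_mul a11 a12 a13 a21 a22 a23 a41 a42 a43 /det33; ring.
have [r rhoE] : exists r, rho = phi r by apply: (OF_phiP D_gt1 D_sqf F_eq); apply: OF_det33.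
have [r' rho'E] : exists r, rho' = phi r.
  by apply: (OF_phiP D_gt1 D_sqf F_eq); apply: OF_det33.
have /half_idealP [a [b tauE]] : half_ideal tau by apply: half_ideal_det33.
have tau2 : 2 * tau = phi (2 * a + b * c, b)%BZ.
  have -> : 2 * tau = 2 * zr F a + zr F b * (2 * eta) by rewrite tauE; ring.
  by rewrite eta_def /phi /= !zrE; ring.
(* $\rho\tau=1$ and $\rho\eta=\rho'$ are doubled to clear the denominator of [eta]; taking norms
   gives the equations excluded by [no_norm]. *)
have e1' : kmul t n r (2 * a + b * c, b)%BZ = (2, Z0)%BZ.
  apply: phi_inj'; rewrite phi_mul // -tau2 -rhoE phi_int zr2.
  by rewrite mulrCA rho_tau mulr1.
have e2' : kmul t n (c, 1%BZ) r = kdbl r'.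
  apply: phi_inj'; rewrite phi_mul // phi_dbl -eta_def -rhoE -rho'E -mulrA; congr (2 * _).
  by rewrite -rho'_tau -mulrA (mulrC tau) rho_tau mulr1.
apply: (no_norm r r' a b); rewrite -knm_mul ?e1' ?e2' /knm /kdbl /=; ring.
Qed.

End Ideal.

(** * The certificates *)

Section Certificates.

Import List.ListNotations.
Local Open Scope list_scope.
Local Open Scope Z_scope.

Fixpoint pairs (l : list Z) : list K :=
  match l with
  | [] => []
  | [a] => [(a, 0)]
  | a :: b :: l' => (a, b) :: pairs l'
  end.

(* Trailing zero coordinates are omitted. *)
Definition crow_of (l : list Z) : crow :=
  let r := pairs l in
  (nth kzero r 0, nth kzero r 1, nth kzero r 2, drop 3 r).

(** The fallback [Branch kzero []] always fails, zero not being totally positive. *)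
Definition Ac (i : nat) (l : list (list Z)) : cert :=
  if map crow_of l is r1 :: r2 :: r3 :: rs then Accept i r1 r2 r3 rs
  else Branch kzero [].

(** With an empty list [l], the branch is closed by showing that no vector of norm $a+b\omega$ is
    possible. *)
Local Notation Br a b l := (Branch (a, b) l).

(** Binary counterparts of [omega_tr] and [omega_nm], for the sweep over all D. *)
Definition disc_tr (D : Z) : Z := if D mod 4 =? 1 then 1 else 0.
Definition disc_nm (D : Z) : Z := if D mod 4 =? 1 then D / 4 else D.

(* Represent 1, 2 and an element al just above (t + sqrt disc) / 2; the conjugate of al
   is small and usually kills the remaining lattices. *)
Definition generic_cert (D : Z) : cert :=
  let t := disc_tr D in
  let al : K := ((Z.sqrt (t * t + 4 * disc_nm D) - t) / 2 + 1, 1) in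
  let al' := kconj t al in
  Br 2 0 [Branch al [foldr (fun a c => Either (Branch a []) c) (Branch kzero [])
    [al'; kconj t (ksub (kdbl al) (1, 0)); (3, 0); kdbl al'; (5, 0);
     kadd al' (1, 0)]]].

(** Each entry starts from a vector of norm 1, supplied by [excluded]. *)
Definition special_cert (D : Z) : cert :=
  match D with
  | 11 => Br 10 (-3) [Br 5 1 [Either (Br 7 2 []) (Either (Br 5 (-1) []) (Br 4 1 [Br 17 5 []]))];
  Br 4 1 [Either (Br 7 2 []) (Either (Br 5 (-1) []) (Br 4 1 [Br 17 5 []]))]]
  | 14 => Br 4 1 [Br 15 (-4) [Either (Br 4 (-1) []) (Either (Br 7 (-1) []) (Either (Br 21 5 [])
  (Br 16 (-3) [])))]; Br 5 0 [Either (Br 4 (-1) []) (Either (Br 7 (-1) []) (Either (Br 21 5 [])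
  (Br 16 (-3) [])))]]
  | 15 => Br 2 0 [Br 4 1 [Either (Br 8 (-2) []) (Either (Br 12 (-3) []) (Br 8 (-2) [Br 3 0
  []]))]]
  | 19 => Br 9 2 [Br 9 (-2) [Either (Br 5 1 []) (Either (Br 2 0 []) (Br 5 0 []))]; Br 5 (-1)
  [Either (Br 5 1 []) (Either (Br 2 0 []) (Br 5 0 []))]]
  | 22 => Br 5 (-1) [Br 5 1 [Either (Br 2 0 []) (Either (Br 6 (-1) []) (Either (Br 6 1 [])
  (Either (Br 10 2 [Br 17 3 []]) (Br 2 0 [Either (Br 18 (-3) [Br 197 42 []]) (Br 17 3 [])]))))];
  Br 6 1 [Either (Br 2 0 []) (Either (Br 6 (-1) []) (Either (Br 6 1 []) (Either (Br 10 2 [Br 17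
  3 []]) (Br 2 0 [Either (Br 18 (-3) [Br 197 42 []]) (Br 17 3 [])]))))]]
  | 23 => Br 5 1 [Br 5 (-1) [Either (Br 2 0 []) (Br 2 0 [Br 24 5 []])]]
  | 26 => Br 6 (-1) [Br 2 0 [Either (Br 6 1 []) (Either (Br 7 1 []) (Either (Br 11 2 []) (Br 6 1
  [Br 10 1 []])))]]
  | 29 => Br 3 1 [Br 2 0 [Either (Br 4 (-1) []) (Either (Br 7 (-2) []) (Br 17 (-5) []))]]
  | 30 => Br 6 1 [Br 11 (-2) [Either (Br 2 0 []) (Either (Br 7 1 []) (Br 17 3 []))]]
  | 31 => Br 6 (-1) [Br 2 0 [Either (Br 6 1 []) (Either (Br 17 3 []) (Br 14 1 []))]]
  | 34 => Br 6 1 [Br 6 (-1) [Br 2 0 []]]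
  | 35 => Br 6 1 [Br 2 0 [Either (Br 12 (-2) []) (Either (Br 3 0 []) (Br 18 (-3) []))]]
  | 37 => Br 3 1 [Br 4 (-1) [Either (Br 2 0 []) (Br 3 0 [])]]
  | 38 => Br 2 0 [Br 8 1 [Either (Br 7 (-1) []) (Either (Br 8 (-1) []) (Either (Br 7 (-1) [Br 56
  (-9) []]) (Br 19 (-3) [Br 56 (-9) []])))]; Br 7 1 [Either (Br 7 (-1) []) (Either (Br 8 (-1)
  []) (Either (Br 7 (-1) [Br 56 (-9) []]) (Br 19 (-3) [Br 56 (-9) []])))]]
  | 39 => Br 7 1 [Br 19 (-3) [Either (Br 2 0 []) (Either (Br 3 0 []) (Br 2 0 [Br 25 4 []]))]]
  | 42 => Br 7 1 [Br 13 (-2) [Either (Br 2 0 []) (Br 3 0 [])]]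
  | 43 => Br 2 0 [Br 7 1 [Br 7 (-1) []]]
  | 46 => Br 7 1 [Br 7 (-1) [Either (Br 2 0 []) (Br 2 0 [Br 41 6 []])]]
  | 47 => Br 7 1 [Br 7 (-1) [Either (Br 2 0 []) (Br 3 0 [])]]
  | 51 => Br 2 0 [Br 8 1 [Either (Br 8 (-1) []) (Br 15 (-2) [])]]
  | 53 => Br 2 0 [Br 4 1 [Either (Br 5 (-1) []) (Either (Br 9 (-2) []) (Br 7 2 []))]]
  | 55 => Br 15 2 [Br 15 (-2) [Either (Br 2 0 []) (Either (Br 8 1 []) (Br 5 0 []))]]
  | 57 => Br 4 1 [Br 10 3 [Either (Br 2 0 []) (Either (Br 13 (-3) []) (Either (Br 9 (-2) []) (Br
  13 (-3) [Br 171 (-40) []])))]]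
  | 58 => Br 23 3 [Br 23 (-3) [Either (Br 2 0 []) (Br 8 1 [])]]
  | 59 => Br 2 0 [Br 8 1 [Either (Br 8 (-1) []) (Br 3 0 [])]]
  | 61 => Br 7 2 [Br 9 (-2) [Either (Br 2 0 []) (Either (Br 4 1 []) (Br 133 39 []))]]
  | 62 => Br 8 1 [Br 8 (-1) [Either (Br 2 0 []) (Br 2 0 [Br 63 8 []])]]
  | 66 => Br 2 0 [Br 9 1 [Either (Br 9 (-1) []) (Either (Br 25 (-3) []) (Br 9 (-1) [Br 17 (-2)
  [Br 41 (-5) []]]))]]
  | 69 => Br 4 1 [Br 14 (-3) [Br 2 0 []]]
  | 73 => Br 4 1 [Br 5 (-1) [Either (Br 2 0 []) (Br 6 0 [])]]
  | 78 => Br 9 1 [Br 9 (-1) [Either (Br 2 0 []) (Br 2 0 [Br 53 6 []])]]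
  | 85 => Br 2 0 [Br 5 1 [Either (Br 6 (-1) []) (Either (Br 3 0 []) (Either (Br 16 (-3) []) (Br
  21 (-4) [Br 47 (-9) []])))]]
  | 91 => Br 2 0 [Br 10 1 [Either (Br 10 (-1) []) (Either (Br 3 0 []) (Br 10 (-1) [Br 10 0
  []]))]]
  | 93 => Br 9 2 [Br 16 (-3) [Br 2 0 []]]
  | 94 => Br 2 0 [Br 10 1 [Either (Br 10 (-1) []) (Br 10 (-1) [Br 49 (-5) []])]]
  | 105 => Br 6 (-1) [Br 3 0 [Either (Br 2 0 []) (Either (Br 5 0 []) (Either (Br 17 (-3) [Br 2 0
  [Br 19 4 []]]) (Br 2 0 [Br 7 1 []])))]; Br 14 3 [Either (Br 2 0 []) (Either (Br 5 0 [])
  (Either (Br 17 (-3) [Br 2 0 [Br 19 4 []]]) (Br 2 0 [Br 7 1 []])))]]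
  | 133 => Br 19 (-3) [Br 3 0 [Either (Br 2 0 []) (Either (Br 6 1 []) (Either (Br 3 0 [])
  (Either (Br 8 1 []) (Either (Br 9 1 []) (Br 6 1 [Br 18 2 []])))))]; Br 16 3 [Either (Br 2 0
  []) (Either (Br 6 1 []) (Either (Br 3 0 []) (Either (Br 8 1 []) (Either (Br 9 1 []) (Br 6 1
  [Br 18 2 []])))))]]
  | 161 => Br 6 1 [Br 7 (-1) [Either (Br 2 0 []) (Br 2 0 [Br 30 5 []])]]
  | 217 => Br 7 1 [Br 8 (-1) [Either (Br 2 0 []) (Br 21 3 [])]]
  | 253 => Br 15 2 [Br 17 (-2) [Either (Br 2 0 []) (Br 2 0 [Br 38 5 []])]]
  | 273 => Br 2 0 [Br 8 1 [Either (Br 9 (-1) []) (Either (Br 18 (-2) []) (Either (Br 3 0 []) (Br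
  9 (-1) [Br 53 (-6) []])))]]
  | 329 => Br 2 0 [Br 9 1 [Either (Br 10 (-1) []) (Br 10 (-1) [Br 67 (-7) []])]]
  | 341 => Br 2 0 [Br 9 1 [Either (Br 10 (-1) []) (Br 10 (-1) [Br 49 (-5) []])]]
  | _ => generic_cert D
  end.

Definition listed : list Z := [6; 7; 10; 13; 17; 21; 33; 41; 65; 77].

Definition excluded (D : Z) : bool :=
  let t := disc_tr D in let n := disc_nm D in
  if 1760 <? t * t + 4 * n then true
  (* These are the primes whose square is at most 1760. *)
  else if has (fun p => D mod (p * p) =? 0) [2; 3; 5; 7; 11; 13; 17; 19; 23; 29; 31; 37; 41]
  then true
  else if has (Z.eqb D) ([2; 3; 5] ++ listed) then true
  (* With no targets, a successful run contradicts the existence of L. *)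
  else run t n [] (Br 1 0 [special_cert D]) State0.

Lemma all_excluded : all excluded (zrange 2 1760).
Proof. by vm_cast_no_check (erefl true). Qed.

Definition targets (fs : list kform) : list (gram3 * list vec3) :=
  map (fun f => (kform_gram f, [])) fs.

Definition forms6 : list kform :=
  let f1 := KForm (1, 0) (1, 0) (2, 0) (0, 0) (1, 0) (0, 1) in
  let f2 := KForm (1, 0) (3, 0) (3, 1) (1, 0) (2, 1) (0, 0) in
  [f1; kform_map (kmul (omega_tr 6) (omega_nm 6) (5, 2)) f1; f2; kform_map (kmul (omega_tr 6)
  (omega_nm 6) (5, 2)) f2].

Definition cert6 : cert :=
  Br 1 0 [Br 5 2 [Br 4 1 [Br 4 (-1) []; Br 3 (-1) [Br 4 (-1) [Ac 0 [[0;0;-7;3;-3;1;0;0;-2]; [1];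
  [-1;1;-9;4;-3;1;1;0;-2]]; Ac 0 [[0;0;-3;1;-3;1;0;0;2]; [1]; [-1;1;-5;2;-3;1;1;0;2]]; Ac 0
  [[0;0;-5;2;0;0;0;0;1]; [1]; [-1;1;-5;2;0;0;1;0;1]]; Ac 0 [[0;0;-3;1;0;0;0;0;1]; [1];
  [-1;1;0;0;0;0;1]]]; Ac 0 [[-3;1;-2;1;-1;0;0;-1]; [1]; [-1;1;0;0;0;0;1]]; Ac 0
  [[3;-1;-2;1;-1;0;0;1]; [1]; [1;0;0;0;0;0;-1]]; Br 4 (-1) [Ac 0 [[0;0;-7;3;-3;1;0;0;-2]; [1];
  [-1;1;-7;3;-3;1;1;0;-2]]; Ac 0 [[0;0;-3;1;-3;1;0;0;2]; [1]; [-1;1;-3;1;-3;1;1;0;2]]; Ac 0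
  [[0;0;-5;2;0;0;0;0;1]; [1]; [-1;1;-3;1;0;0;1;0;1]]; Ac 0 [[0;0;-3;1;0;0;0;0;1]; [1];
  [-1;1;2;-1;0;0;1]]]]; Br 3 (-1) []; Br 3 (-1) []; Br 3 (-1) []; Br 3 (-1) [Ac 0 [[0;0;-1;0;1];
  [1]; [-1;1;-3;1;1;0;1]]; Ac 0 [[0;0;-1;0;1]; [1]; [-1;1;-4;1;2;0;1]]; Ac 0 [[0;0;-1;0;1]; [1];
  [-1;1;0;0;0;0;1]]; Ac 0 [[0;0;-1;0;1]; [1]; [-1;1;-1;0;1;0;1]]]; Br 3 (-1) []; Br 8 (-3) [];
  Br 4 (-1) []; Br 4 (-1) []; Br 3 (-1) []; Br 3 (-1) []; Br 3 (-1) []; Br 4 (-1) []; Br 4 (-1)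
  []; Br 8 (-3) []; Br 3 (-1) []; Br 8 (-3) []; Br 8 (-3) []; Br 8 (-3) [Ac 1
  [[4;-3;15;-6;-6;3;1]; [0;0;1]; [-1;0;-1;1;1]]; Ac 1 [[-10;3;-17;7;8;-3;1]; [0;0;1];
  [-1;0;-1;1;1]]; Ac 1 [[-7;3;-12;5;6;-2;1]; [0;0;1]; [-1;0;-1;1;1]]; Ac 1 [[3;-1;10;-4;-4;2;1];
  [0;0;1]; [-1;0;-1;1;1]]]; Br 4 (-1) [Ac 2 [[1]; [0;1;-2;1;3;-1;1;1]; [1;1;-4;2;3;-1;0;1]]; Ac
  2 [[-1]; [5;-1;-2;1;-3;1;1;1]; [5;-2;-4;2;-3;1;0;1]]; Ac 2 [[-1]; [-1;1;2;-1;3;-1;1;1];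
  [-1;0;4;-2;3;-1;0;1]]; Ac 2 [[1]; [6;-1;2;-1;-3;1;1;1]; [7;-1;4;-2;-3;1;0;1]]]; Br 8 (-3) [Ac
  1 [[4;-3;-15;6;-6;3;1]; [0;0;1]; [-1;0;1;0;1]]; Ac 1 [[-10;3;17;-7;8;-3;1]; [0;0;1];
  [-1;0;1;0;1]]; Ac 1 [[-7;3;12;-5;6;-2;1]; [0;0;1]; [-1;0;1;0;1]]; Ac 1 [[3;-1;-10;4;-4;2;1];
  [0;0;1]; [-1;0;1;0;1]]]; Br 8 (-3) []; Br 8 (-3) []; Br 3 (-1) []; Br 3 (-1) [Ac 1
  [[1;0;0;0;1]; [0;0;1]; [-1;0;-1;1;1;0;1]]; Ac 1 [[-1;-1;0;0;1]; [0;0;1]; [-1;0;1;0;1;0;1]]; Ac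
  1 [[-1;0;0;0;-1]; [0;0;-1]; [6;-2;1;-1;4;-2;1]]; Ac 1 [[-1;0;0;0;-1]; [0;0;1];
  [-6;3;1;0;-6;2;1]]]; Br 3 (-1) []; Br 8 (-3) []; Br 4 (-1) [Ac 3 [[0;0;-1];
  [-5;0;-8;3;-3;1;1]; [-2;1;-7;2;-2;1;1]]; Ac 3 [[0;0;-1]; [-1;-1;4;-2;1;-1;1];
  [2;0;5;-3;2;-1;1]]]; Br 3 (-1) []; Br 3 (-1) []; Br 3 (-1) []; Br 4 (-1) [Ac 3 [[0;0;-1];
  [-5;0;7;-3;-3;1;1]; [-2;1;5;-3;-2;1;1]]; Ac 3 [[0;0;-1]; [4;1;-5;2;1;-1;1];
  [0;-1;-7;2;2;-1;1]]]; Br 8 (-3) []; Br 3 (-1) []; Br 8 (-3) [Ac 1 [[4;0;-5;2;2;-1;1;1];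
  [0;0;1]; [7;0;-9;4;3;-2;0;1]]; Ac 1 [[0;-1;5;-2;-2;1;1;1]; [0;0;1]; [1;1;-4;2;1;-1;1]]; Ac 1
  [[-1;1;2;-1;-2;0;1]; [0;0;1]; [3;-1;-4;2;1;-1;1;1]]; Ac 1 [[-3;0;-2;1;2;0;1]; [0;0;1];
  [-1;-2;4;-1;-1;1;1;1]]]; Br 3 (-1) [Br 8 (-3) [Ac 1 [[-3;0;0;0;0;1;0;0;1]; [0;0;1];
  [-5;0;-1;1;0;1;1;0;1]]; Ac 1 [[-1;-1;0;0;0;1;0;0;-1]; [0;0;-1]; [-3;-1;-1;0;0;1;1;0;-1]]; Ac 1
  [[-1;-2;0;0;2;0;0;0;-1]; [0;0;-1]; [-1;-1;-1;0;2;0;1;0;-1]]; Ac 1 [[-3;0;0;0;2;0;0;0;1];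
  [0;0;-1]; [0;1;-1;0;0;0;1]]]; Br 8 (-3) [Ac 1 [[3;0;0;0;0;-1;0;0;-1]; [0;0;1];
  [3;1;1;0;0;-1;1;0;-1]]; Ac 1 [[-1;-1;0;0;0;1;0;0;-1]; [0;0;1]; [-3;-1;1;0;0;1;1;0;-1]]; Ac 1
  [[1;2;0;0;-2;0;0;0;1]; [0;0;1]; [-1;2;1;0;-2;0;1;0;1]]; Ac 1 [[-3;0;0;0;2;0;0;0;1]; [0;0;1];
  [0;1;1;0;0;0;1]]]; Ac 1 [[-3;-1;2;-1;-1;1;2]; [0;0;1]; [-1;0;3;-1;-3;1;3]]; Ac 1
  [[-1;0;-2;1;-1;1;-2]; [0;0;-1]; [1;0;3;-2;3;-1;3]]]; Br 8 (-3) [Ac 1 [[4;0;5;-2;2;-1;1;1];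
  [0;0;1]; [7;0;9;-3;3;-2;0;1]]; Ac 1 [[0;-1;-5;2;-2;1;1;1]; [0;0;1]; [1;1;4;-1;1;-1;1]]; Ac 1
  [[-1;1;-2;1;-2;0;1]; [0;0;1]; [3;-1;4;-1;1;-1;1;1]]; Ac 1 [[-3;0;2;-1;2;0;1]; [0;0;-1];
  [-1;-2;-4;1;-1;1;1;1]]]; Br 3 (-1) []]; Br 3 1 [Br 3 (-1) []; Ac 1 [[2;1;-1];
  [-5;-2;2;1;-2;-1]; [-5;-2;2;1;-3;-1]]; Ac 0 [[1]; [-2;1;-5;2;2;-1]; [3;-1;5;-2;-3;1]]; Ac 0
  [[1]; [0;0;5;-2;2;-1]; [0;0;-7;3;-3;1]]; Ac 1 [[2;1;-1]; [5;2;0;0;-2;-1]; [7;3;-1;0;-3;-1]]];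
  Br 4 1 [Br 4 (-1) []; Br 8 (-3) []; Br 4 (-1) []; Br 4 (-1) []; Br 8 (-3) []; Br 4 (-1) []; Br
  8 (-3) []]]].

(** The factors multiply to the norm of the Gram determinant; an empty list beside a factor says
    that no nonzero class killed by it is integral. *)
Definition over6 : list (list (Z * list cert)) :=
  [[(2, []); (2, [])]; [(2, []); (2, [])]; [(2, []); (2, []); (3, [])]; [(2, []); (2, []); (3,
  [])]].

Definition forms7 : list kform :=
  let f1 := KForm (1, 0) (1, 0) (2, 0) (0, 0) (0, 0) (0, 1) in
  [f1; kform_map (kmul (omega_tr 7) (omega_nm 7) (8, 3)) f1].

Definition cert7 : cert :=
  Br 1 0 [Br 8 3 [Br 3 1 [Br 3 (-1) []; Ac 0 [[1]; [0;0;-5;2;-3;1]; [0;0;3;-1;2;-1]]; Br 3 (-1)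
  [Ac 0 [[1]; [0;0;6;-2;-1;0;-1]; [0;0;-2;1;-1]]; Ac 0 [[1]; [0;0;-2;1;-1;0;1];
  [0;0;3;-1;0;0;-1]]; Ac 0 [[1]; [0;0;-5;2;2;-1;-1]; [0;0;3;-1;-1]]; Ac 0 [[1];
  [0;0;3;-1;2;-1;1]; [0;0;-2;1;-1]]]; Br 3 (-1) []; Br 3 (-1) [Ac 1 [[0;0;1]; [2;0;0;0;1;0;-1];
  [2;1;0;0;1]]; Ac 1 [[0;0;-1]; [-3;0;0;0;1;0;1]; [-3;-1;0;0;1]]; Ac 1 [[0;0;-1];
  [1;-1;0;0;-4;1;-1]; [-2;-1;0;0;-1]]; Ac 1 [[0;0;1]; [0;1;0;0;4;-1;-1]; [2;1;0;0;1]]]; Br 3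
  (-1) []; Ac 1 [[0;0;1]; [-8;-3;0;0;3;1]; [-8;-3;0;0;2;1]]]; Br 3 0 [Br 24 (-9) []; Br 3 (-1)
  [Br 9 (-3) [Ac 1 [[-2;0;6;-2;-3;0;0;0;1]; [3;1;-1]; [2;2;2;-1;0;0;1]]; Ac 1
  [[4;0;-12;4;3;0;0;0;1]; [0;0;-1]; [-3;0;2;-1;0;0;1]]; Ac 1 [[-1;1;7;-3;0;1;0;0;1]; [0;0;-1];
  [-3;0;2;-1;0;0;1]]; Ac 1 [[2;0;-9;3;3;0;0;0;1]; [-3;-1;1]; [-5;-1;1;0;0;0;1]]]; Br 9 (-3) [Ac
  1 [[1;1;4;-2;0;1;0;0;1]; [3;1;-1]; [3;2;-2;0;0;0;1]]; Ac 1 [[1;-1;-10;4;0;-1;0;0;1]; [0;0;-1];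
  [-2;0;-1;0;0;0;1]]; Ac 1 [[-1;1;7;-3;0;1;0;0;1]; [3;1;-1]; [3;2;-1;0;0;0;1]]; Ac 1
  [[2;0;-9;3;3;0;0;0;1]; [3;1;-1]; [3;2;-2;0;0;0;1]]]; Br 9 (-3) [Ac 1 [[-2;0;6;-2;-3;0;0;0;1];
  [3;1;-1]; [4;1;-7;2;0;0;1]]; Ac 1 [[4;0;-12;4;3;0;0;0;1]; [-3;-1;1]; [-3;-2;-6;3;0;0;1]]; Ac 1
  [[-1;1;7;-3;0;1;0;0;1]; [3;1;-1]; [4;1;-7;2;0;0;1]]; Ac 1 [[-1;-1;-7;3;0;-1;0;0;1]; [0;0;1];
  [-1;-1;-6;3;0;0;1]]]; Br 9 (-3) [Ac 1 [[1;1;4;-2;0;1;0;0;1]; [0;0;-1]; [0;1;6;-3;0;0;1]]; Ac 1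
  [[1;-1;-10;4;0;-1;0;0;1]; [0;0;1]; [-3;0;7;-2;0;0;1]]; Ac 1 [[-4;0;9;-3;-3;0;0;0;1]; [0;0;1];
  [-3;0;7;-2;0;0;1]]; Ac 1 [[-1;-1;-7;3;0;-1;0;0;1]; [0;0;1]; [-3;0;7;-2;0;0;1]]]]; Br 3 (-1)
  []; Br 3 (-1) [Ac 0 [[-2;0;-2;1;1;0;1]; [-1]; [-2;0;3;-1;0;0;1]]; Ac 0 [[-1;0;-5;2;1;0;1];
  [1]; [0;1;-3;1;0;0;1]]; Ac 0 [[0;-1;-10;4;1;0;1]; [1]; [0;0;-5;2;0;0;1]]; Ac 0
  [[-2;0;3;-1;1;0;1]; [1]; [-2;1;8;-3;0;0;1]]]; Br 3 (-1) []; Br 3 (-1) []; Br 3 (-1) [Ac 0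
  [[-2;1;5;-2;1;0;1]; [-1]; [-2;0;3;-1;0;0;1]]; Ac 0 [[-1;1;2;-1;1;0;1]; [1]; [0;1;-3;1;0;0;1]];
  Ac 0 [[0;0;-3;1;1;0;1]; [1]; [0;0;-5;2;0;0;1]]; Ac 0 [[-2;1;10;-4;1;0;1]; [1];
  [-2;1;8;-3;0;0;1]]]; Br 3 (-1) []; Br 3 (-1) [Ac 0 [[-2;0;3;-1;1]; [-1]; [-2;0;3;-1;0;0;1]];
  Ac 0 [[-2;0;3;-1;1]; [1]; [0;1;-3;1;0;0;1]]; Ac 0 [[-2;0;3;-1;1]; [1]; [0;0;-5;2;0;0;1]]; Ac 0
  [[-2;0;3;-1;1]; [1]; [-2;1;8;-3;0;0;1]]]; Br 3 (-1) [Br 9 (-3) [Ac 1 [[1;-1;-3;1;0;1;0;0;1];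
  [-3;-1;1]; [-5;-1;1;0;0;0;1]]; Ac 1 [[-2;0;-3;1;3;0;0;0;1]; [-3;-1;1]; [-5;-1;1;0;0;0;1]]; Ac
  1 [[-1;-1;0;0;0;1;0;0;1]; [0;0;1]; [0;1;1;0;0;0;1]]; Ac 1 [[-1;1;0;0;0;-1;0;0;1]; [0;0;-1];
  [-3;0;2;-1;0;0;1]]]; Br 9 (-3) [Ac 1 [[1;-1;-3;1;0;1;0;0;1]; [3;1;-1]; [3;2;-1;0;0;0;1]]; Ac 1
  [[1;1;-3;1;0;-1;0;0;1]; [0;0;1]; [1;1;-2;1;0;0;1]]; Ac 1 [[-1;-1;0;0;0;1;0;0;1]; [0;0;1];
  [1;1;-2;1;0;0;1]]; Ac 1 [[-1;1;0;0;0;-1;0;0;1]; [-3;-1;1]; [-4;-1;-2;1;0;0;1]]]; Br 9 (-3) [Ac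
  1 [[1;-1;-3;1;0;1;0;0;1]; [3;1;-1]; [4;1;-7;2;0;0;1]]; Ac 1 [[1;1;-3;1;0;-1;0;0;1]; [0;0;-1];
  [-1;-1;-6;2;0;0;1]]; Ac 1 [[-1;-1;0;0;0;1;0;0;1]; [0;0;-1]; [-1;-1;-6;2;0;0;1]]; Ac 1
  [[-4;0;0;0;3;0;0;0;1]; [3;1;-1]; [4;1;-7;2;0;0;1]]]; Br 9 (-3) [Ac 1 [[4;0;-3;1;-3;0;0;0;1];
  [0;0;1]; [-3;0;7;-2;0;0;1]]; Ac 1 [[1;1;-3;1;0;-1;0;0;1]; [0;0;-1]; [-3;0;7;-3;0;0;1]]; Ac 1
  [[-1;-1;0;0;0;1;0;0;1]; [0;0;-1]; [-3;0;7;-3;0;0;1]]; Ac 1 [[-4;0;0;0;3;0;0;0;1]; [3;1;-1];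
  [2;2;6;-3;0;0;1]]]]; Br 3 (-1) [Ac 0 [[0;0;-3;1;1]; [-1]; [-2;0;3;-1;0;0;1]]; Ac 0
  [[0;0;-3;1;1]; [1]; [0;1;-3;1;0;0;1]]; Ac 0 [[0;0;-3;1;1]; [1]; [0;0;-5;2;0;0;1]]; Ac 0
  [[0;0;-3;1;1]; [1]; [-2;1;8;-3;0;0;1]]]; Br 3 (-1) []; Br 3 (-1) []; Br 3 (-1) [Ac 0
  [[-2;0;3;-1;1;0;1]; [-1]; [-2;0;3;-1;0;0;1]]; Ac 0 [[-1;0;0;0;1;0;1]; [1]; [0;1;-3;1;0;0;1]];
  Ac 0 [[0;-1;-5;2;1;0;1]; [1]; [0;0;-5;2;0;0;1]]; Ac 0 [[-2;0;8;-3;1;0;1]; [1];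
  [-2;1;8;-3;0;0;1]]]; Br 3 (-1) [Ac 0 [[-1;0;0;0;1;0;1]; [-1]; [-2;0;3;-1;0;0;1]]; Ac 0
  [[0;0;-3;1;1;0;1]; [1]; [0;1;-3;1;0;0;1]]; Ac 0 [[1;-1;-8;3;1;0;1]; [1]; [0;0;-5;2;0;0;1]]; Ac
  0 [[-1;0;5;-2;1;0;1]; [1]; [-2;1;8;-3;0;0;1]]]]]].

Definition over7 : list (list (Z * list cert)) :=
  [[(2, []); (2, [])]; [(2, []); (2, [])]].

Definition form10 : kform := KForm (1, 0) (4, 1) (4, 0) (0, 0) (2, 0) (6, 1).
(** The third column of the Gram matrix times $\sqrt{10}/2$: the polars of
    $\frac{\sqrt{10}}{2}b_3$. *)
Definition extra10 : vec3 := ((0, 1), (5, 3), (0, 4)).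

Definition cert10 : cert :=
  Br 1 0 [Br 4 1 [Br 2 0 [Br 10 (-3) []; Br 4 (-1) []; Br 4 (-1) [Br 11 (-3) []; Br 11 (-3) [];
  Br 11 (-3) [Ac 0 [[-1]; [0;0;1;0;-1]; [4;-2;-1;1;2;-1;-1;0;0;1]; [3;-2;-7;3;6;-2;1;0;1;1]]; Ac
  0 [[-1]; [0;0;-1]; [4;-2;-9;3;2;-1;1;0;0;1]; [3;-2;1;0;-3;0;-1;0;1;1]]; Ac 0 [[-1]; [0;0;-1];
  [4;-2;1;-1;2;0;1;0;0;1]; [3;-2;7;-3;-2;1;-1;0;1;1]]; Ac 0 [[-1]; [0;0;1;0;-1];
  [4;-2;9;-3;-8;2;-1;0;0;1]; [3;-2;-1;0;-1;0;1;0;1;1]]]; Br 11 (-3) [Ac 0 [[-1]; [0;0;-1];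
  [4;-2;-9;3;6;-2;1;0;0;1]; [-2;0;6;-2;-3;1;-1;0;1]]; Ac 0 [[-1]; [0;0;-1];
  [4;-2;-9;3;1;-1;1;0;0;1]; [3;-2;1;0;-2;0;-1;0;1;1]]; Ac 0 [[-1]; [0;0;-1];
  [4;-2;1;-1;1;0;1;0;0;1]; [3;-2;7;-3;-1;1;-1;0;1;1]]; Ac 0 [[-1]; [0;0;-1];
  [4;-2;1;-1;-4;1;1;0;0;1]; [-2;0;2;-1;0;0;-1;0;1]]]]; Br 10 (-3) []; Br 4 (-1) []; Br 4 (-1)
  []; Br 10 (-3) []; Br 4 (-1) []; Br 4 (-1) []; Br 4 (-1) []; Br 4 (-1) []; Br 4 (-1) []; Br 4
  (-1) []; Br 4 (-1) []; Br 4 (-1) []; Br 4 (-1) []; Br 4 (-1) []; Br 4 (-1) []; Br 11 (-3) [Ac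
  0 [[-1]; [0;0;1]; [-2;0;1;0;1]; [-4;0;-1;1;2;0;1]]; Ac 0 [[-1]; [2;1;-1;0;-2;-1];
  [0;1;-1;0;-1;-1]; [4;1;1;-1;-6;-1;1]]; Ac 0 [[-1]; [2;1;-1;0;-2;-1]; [0;1;-1;0;-1;-1];
  [2;0;-1;0;-4;0;1]]; Ac 0 [[-1]; [2;1;-1;0;-2;-1]; [0;1;-1;0;-1;-1]; [5;0;1;-1;-7;0;1]]]; Br 4
  (-1) []; Br 4 (-1) []; Br 4 (-1) []; Br 11 (-3) [Ac 0 [[-1]; [-2;-1;-1;0;2;1];
  [-2;-1;-1;0;1;1]; [-5;-1;-1;0;3;1;1]]; Ac 0 [[-1]; [0;0;1]; [0;0;1;0;-1]; [-3;0;1;0;1;0;1]];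
  Ac 0 [[-1]; [0;0;1]; [0;0;1;0;-1]; [-1;1;-1;1;-1;-1;1]]; Ac 0 [[-1]; [2;1;1;0;-2;-1];
  [0;1;1;0;-1;-1]; [1;1;1;0;-3;-1;1]]]]; Br 2 0 [Br 4 (-1) []; Br 4 (-1) []; Br 10 (-3) []; Br 5
  (-1) []; Br 5 (-1) []; Br 5 (-1) []; Br 10 (-3) []; Br 10 (-3) []; Br 4 (-1) []; Br 10 (-3)
  []; Br 4 (-1) []; Br 4 (-1) []; Br 4 (-1) []; Br 4 (-1) []; Br 10 (-3) []; Br 4 (-1) []; Br 10
  (-3) []; Br 5 (-1) []; Br 5 (-1) []; Br 4 (-1) []; Br 5 (-1) []]; Br 10 3 [Br 5 (-1) []; Br 5
  (-1) []; Br 5 (-1) []; Br 6 (-1) [Ac 0 [[1;0;3;-1;3;-1;-1]; [0;0;1]; [0;0;4;-1;3;-1;-1];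
  [1;-1;2;0;0;0;-1]]; Ac 0 [[-1;1;-1;0;3;-1;1]; [0;0;-1]; [0;1;-2;0;3;-1;1]; [-1;1;-2;0;0;0;1]];
  Ac 0 [[0;1;-1;0;3;-1;-1]; [0;0;-1]; [1;1;-2;0;3;-1;-1]; [0;1;-2;0;0;0;-1]]; Ac 0
  [[0;0;3;-1;3;-1;1]; [0;0;1]; [-1;0;4;-1;3;-1;1]; [0;-1;2;0;0;0;1]]]; Br 5 (-1) []; Br 5 (-1)
  []; Br 6 (-1) [Ac 0 [[-2;0;1;0;3;-1;-1]; [0;0;-1]; [-1;0;0;0;3;-1;-1]; [1;0;2;-1;0;0;-1]]; Ac
  0 [[4;-1;3;-1;-3;1;-1]; [2;1;-1]; [5;0;2;-1;-3;1;-1]; [6;0;2;-1;0;0;-1]]; Ac 0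
  [[3;-1;3;-1;-3;1;1]; [2;1;-1]; [4;0;2;-1;-3;1;1]; [5;0;2;-1;0;0;1]]; Ac 0 [[-3;0;1;0;3;-1;1];
  [-2;-1;1]; [-4;-1;2;0;3;-1;1]; [-5;-1;2;0;0;0;1]]]; Br 11 (-3) []; Br 5 (-1) []; Br 6 (-1) [Ac
  0 [[6;1;1;-1;-1;0;-1]; [0;0;1]; [5;1;2;-1;-1;0;-1]; [-1;0;-2;1;0;0;1]]; Ac 0
  [[4;2;-3;0;-1;0;1]; [-2;-1;1]; [3;1;-2;0;-1;0;1]; [-4;-1;2;0;0;0;-1]]; Ac 0
  [[5;2;-3;0;-1;0;-1]; [-2;-1;1]; [4;1;-2;0;-1;0;-1]; [-5;-1;2;0;0;0;1]]; Ac 0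
  [[5;1;1;-1;-1;0;1]; [0;0;1]; [4;1;2;-1;-1;0;1]; [0;0;-2;1;0;0;-1]]]; Br 6 (-1) [Ac 0
  [[-1;-1;3;0;-1;0;-1]; [0;0;-1]; [0;-1;2;0;-1;0;-1]; [-1;1;-2;0;0;0;1]]; Ac 0
  [[-3;0;-1;1;-1;0;1]; [2;1;-1]; [-2;1;-2;1;-1;0;1]; [6;0;2;-1;0;0;-1]]; Ac 0
  [[-2;0;-1;1;-1;0;-1]; [2;1;-1]; [-1;1;-2;1;-1;0;-1]; [5;0;2;-1;0;0;1]]; Ac 0
  [[-2;-1;3;0;-1;0;1]; [0;0;-1]; [-1;-1;2;0;-1;0;1]; [0;1;-2;0;0;0;-1]]]; Br 5 (-1) []; Br 11
  (-3) []]]].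

Definition forms13 : list kform :=
  let f1 := KForm (1, 0) (1, 0) (2, 0) (0, 0) (0, 1) (1, -1) in
  let f2 := KForm (1, 0) (1, 0) (2, 0) (1, 0) (0, 0) (0, 1) in
  let f3 := KForm (1, 0) (2, 0) (3, 1) (0, 1) (2, 0) (0, 0) in
  let f4 := KForm (1, 0) (1, 0) (2, 1) (0, 0) (0, 0) (0, 1) in
  let f5 := KForm (1, 0) (2, 0) (2, 1) (0, 0) (0, 1) (0, 1) in
  [f1; f2; kform_map (kconj (omega_tr 13)) f2; f3; kform_map (kconj (omega_tr 13)) f3; f4; f5;
  kform_map (kconj (omega_tr 13)) f5].

Definition cert13 : cert :=
  Br 1 0 [Br 2 1 [Br 3 (-1) [Br 2 0 []; Ac 1 [[1]; [1;1;1;0;2;1]; [2;1;-1;1;2;2]]; Br 2 0 [Ac 1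
  [[-1]; [0;1;1;0;2;1;-1]; [0;0;0;0;0;0;1]]; Ac 1 [[-1]; [-1;1;0;0;1;0;-1]; [1;0;1;0;1;1;1]]; Ac
  1 [[1]; [0;0;0;0;1;0;1]; [1;1;1;0;1;1;-1]]]; Br 2 0 []; Br 2 0 [Ac 1 [[1]; [1;1;-1;0;2;1;1];
  [0;0;0;0;0;0;-1]]; Ac 1 [[1]; [0;0;0;0;1;0;1]; [1;1;-1;0;1;1;-1]]; Ac 1 [[-1];
  [-1;1;0;0;1;0;-1]; [1;0;-1;0;1;1;1]]]; Ac 1 [[1]; [1;1;-1;0;2;1]; [2;1;1;-1;2;2]]; Br 2 0 [];
  Ac 1 [[1]; [1;0;1;0;1;1]; [1;0;0;1;2;2]]; Ac 3 [[1]; [-1;1;0;0;1]; [1;0;1]]; Ac 1 [[1];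
  [3;-1;-2;1;-1;1]; [-2;1;3;-1;2]]; Br 5 3 []; Br 3 0 []; Br 5 3 []; Ac 1 [[1];
  [3;-1;2;-1;-1;1]; [-2;1;-3;1;2]]; Ac 3 [[1]; [-1;1;0;0;1]; [1;0;-1]]; Ac 1 [[1];
  [1;0;-1;0;1;1]; [1;0;0;-1;2;2]]; Br 2 0 []; Ac 5 [[1]; [0;0;-2;1;1]; [0;0;1]]; Br 4 1 [Br 2 0
  []]; Br 2 0 []; Br 5 3 []; Br 4 1 []; Br 2 0 []; Ac 5 [[1]; [0;0;-1;0;1;1]; [0;0;1]]; Br 3 0
  []; Br 2 0 []; Ac 1 [[1]; [0;0;-2;1;1]; [-1;0;-2;1;2]]; Br 2 0 [Ac 1 [[1]; [1;0;0;0;-1;0;-1];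
  [0;0;0;0;0;0;-1]]; Ac 1 [[1]; [0;-1;1;0;1;1;1]; [-1;-1;1;0;2;1;1]]; Ac 1 [[1];
  [0;0;1;0;1;1;-1]; [-1;0;1;0;2;1;-1]]]; Br 2 0 []; Br 2 0 []; Br 2 0 []; Br 2 0 [Ac 1 [[-1];
  [-1;0;0;0;1;0;-1]; [0;0;0;0;0;0;-1]]; Ac 1 [[-1]; [-1;0;-1;0;1;1;-1]; [-1;0;-1;0;2;1;-1]]; Ac
  1 [[-1]; [-1;-1;-1;0;1;1;1]; [-1;-1;-1;0;2;1;1]]]; Ac 1 [[1]; [0;0;2;-1;1]; [-1;0;2;-1;2]]; Br
  2 0 []; Br 3 0 []]; Br 3 (-1) [Ac 6 [[1]; [0;-1;-1;0;-2;-1]; [-1;0;0;0;-1;-1]]; Br 4 2 [Ac 0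
  [[0;0;2;0;0;1;1]; [-1]; [-1;0;1;2;2;1;1;1]]; Ac 0 [[1;0;-1;1;1;1;1]; [3;2;2;1;6;5;1;1];
  [1;0;1;0;0;1;1]]; Ac 0 [[-4;-3;-2;-1;-6;-5;1;1]; [-1]; [-4;-3;-2;-1;-7;-5;1;1]]; Ac 0
  [[0;0;-1;0;0;0;1]; [-1]; [-1;0;-2;-1;-1;-1;1;1]]; Ac 0 [[-5;-3;2;0;-4;-3;1;1];
  [-5;-2;1;0;-3;-3;0;1]; [-4;-3;0;1;-3;-3;1;1]]; Ac 0 [[-1;-2;-2;1;-2;-2;1];
  [-5;-4;1;0;-6;-4;1;1]; [-2;-2;0;0;-3;-2;1]]; Ac 0 [[1;1;2;-1;2;2;1]; [2;2;-1;0;6;4;1;1];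
  [2;1;0;0;3;2;1]]; Ac 0 [[1;1;-2;0;3;2;0;1]; [1]; [2;0;-2;0;2;2;0;1]]; Ac 0
  [[-1;-2;2;0;0;1;0;1]; [-1]; [-2;-1;2;0;1;1;0;1]]; Ac 0 [[1]; [0;-2;-1;1;1;1;0;1];
  [-1;-1;-1;1;3;2;1;1]]; Ac 0 [[-1]; [-3;-3;-1;0;-2;-2;0;1]; [-4;-4;-2;0;-2;-2;1;1]]; Ac 0
  [[-3;-2;0;-1;0;0;1;1]; [-2;-2;-2;0;0;-1;0;1]; [-2;-2;-2;0;1;0;1;1]]]; Ac 2 [[1]; [1;0;-2;1;1];
  [1;0;-3;1;1]]; Ac 2 [[1]; [-1;1;2;-1;1]; [-2;1;3;-1;1]]; Br 4 2 [Ac 0 [[1];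
  [-1;-2;1;1;-2;-1;0;1]; [-3;-1;3;1;-1;-1;1;1]]; Ac 0 [[1]; [-3;-1;1;0;-2;-2;1];
  [-4;-2;3;0;-4;-3;0;1]]; Ac 0 [[5;3;-2;-1;6;5;1;1]; [-1]; [2;3;-1;-1;5;3;0;1]]; Ac 0
  [[2;0;-2;0;0;1;1]; [-1]; [1;1;-2;0;1;1;1]]; Ac 0 [[1]; [0;1;2;0;4;3;1;1]; [0;1;1;0;2;1;1]]; Ac
  0 [[1]; [1;0;0;0;1;1;1]; [-1;3;3;-1;5;3;0;1]]; Ac 0 [[1]; [-3;-1;2;-1;-2;-2;1];
  [-4;-2;0;0;-4;-3;0;1]]; Ac 0 [[-4;-2;-1;0;-3;-3;0;1]; [1]; [-3;-3;-1;0;-4;-3;0;1]]; Ac 0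
  [[-4;-2;2;0;0;-1;0;1]; [1]; [0;-2;-1;1;-1;0;1]]; Ac 0 [[-1]; [-2;-3;-1;1;-1;-1;0;1];
  [-3;-4;-1;1;-2;-2;0;1]]; Ac 0 [[1]; [1;-1;-1;0;2;2;0;1]; [0;-1;-1;0;1;1;0;1]]; Ac 0 [[1];
  [-3;-2;0;-1;0;0;1;1]; [-3;1;2;-1;1;0;1]]]; Ac 6 [[1]; [-1;-1;1;0;-2;-1]; [-1;0;0;0;-1;-1]]; Ac
  0 [[1]; [0;0;-1;0;-1;-1]; [1;0;-1;1;1;1]]; Ac 3 [[1]; [-1;1;0;0;1]; [1;0;-1;0;-1;-1]]; Br 3 0
  []; Ac 0 [[1]; [0;0;-2;1;1]; [1;0;0;0;-1]]; Ac 0 [[1]; [2;-1;-2;1;-1]; [6;-2;-5;2;-2;1]]; Br 3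
  0 []; Ac 3 [[1]; [-1;1;0;0;1]; [0;0;1;0;-1;-1]]; Ac 0 [[1]; [-1;0;1;0;-1;-1]; [0;1;1;-1;1;1]];
  Br 3 0 []; Br 2 0 []; Br 2 0 []; Br 2 0 [Ac 2 [[-1]; [0;0;-2;1;1;0;1]; [1;0;-3;1;1;0;1]]; Ac 2
  [[-2;1;2;-1;-1;0;1]; [-1;1;2;-1;-1;0;1]; [1;-1;0;0;0;0;-1]]; Ac 2 [[0;0;1;0;0;0;-1]; [1];
  [-1;0;3;-1;-1;0;-1]]]; Br 2 0 []; Ac 2 [[1]; [1;0;-1;0;1;1]; [1;0;-2;0;1;1]]; Br 4 2 [Ac 0
  [[-1;0;1;0;0;0;1]; [1]; [0;-1;-1;1;1;0;1]]; Ac 0 [[1;1;-1;0;-2;-2;1]; [2;2;1;-1;-6;-4;1;1];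
  [1;1;-1;0;-3;-2;1]]; Ac 0 [[-2;0;2;-1;1;1;1]; [-4;-3;1;0;6;5;1;1]; [-2;0;2;-1;0;1;1]]; Ac 0
  [[-1;0;1;-1;0;1;1]; [-1]; [-1;0;-1;0;1;1;1]]; Ac 0 [[-5;-3;3;1;4;3;1;1]; [-4;-2;2;1;3;2;0;1];
  [-3;-2;1;1;3;2;0;1]]; Ac 0 [[-1]; [-1;-1;1;0;1;1;1]; [-2;-2;2;0;2;2;1]]; Ac 0 [[-1];
  [1;1;0;-1;-2;-2;1]; [0;0;1;-1;-1;-1;1]]; Ac 0 [[2;2;-2;-2;-5;-4;1;1]; [2;1;-4;0;-3;-3;0;1];
  [3;1;-5;0;-3;-3;0;1]]; Ac 0 [[1]; [-3;-3;0;1;0;0;1;1]; [-1;0;0;0;-1;0;1]]; Ac 0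
  [[-2;0;2;-1;-1;0;1]; [1]; [-1;-1;0;0;0;0;1]]; Ac 0 [[-2;-1;0;0;1;1;1]; [-1];
  [-2;-1;-2;1;2;1;1]]; Ac 0 [[1]; [-3;-2;0;-1;0;0;1;1]; [-4;-2;1;-1;1;1;1;1]]]; Ac 0 [[1];
  [0;1;1;-1;-1;-1]; [-1;0;1;0;1;1]]; Br 2 0 []; Br 2 0 []; Br 2 0 []; Br 2 0 []; Ac 0 [[1];
  [1;0;-1;1;-1;-1]; [0;0;-1;0;1;1]]; Br 4 2 [Ac 0 [[-1]; [-2;-1;2;0;2;1;0;1];
  [-2;-1;3;0;1;0;0;1]]; Ac 0 [[-1;-1;-1;0;2;2;1]; [-4;-2;1;-1;6;4;1;1]; [-1;-1;-1;0;3;2;1]]; Ac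
  0 [[3;1;-1;1;-6;-4;1;1]; [-1]; [1;2;1;0;-5;-4;1;1]]; Ac 0 [[0;0;-1;0;0;0;1]; [1];
  [-1;0;1;-1;1;0;1]]; Ac 0 [[-1;0;2;1;-3;-2;0;1]; [1]; [1;-1;0;1;-1;-1;1]]; Ac 0 [[-1];
  [1;0;0;1;-2;-2;1]; [1;-1;-1;1;-1;-1;1]]; Ac 0 [[-1]; [-1;-1;0;-1;2;2;1]; [-1;-1;1;-1;1;1;1]];
  Ac 0 [[-1;-2;-4;0;3;3;0;1]; [-1]; [-2;0;1;-1;2;1;1]]; Ac 0 [[1]; [-3;-3;0;1;0;0;1;1];
  [-3;-3;-1;1;1;1;1;1]]; Ac 0 [[-2;-1;0;0;1;1;1]; [-1]; [-5;-3;0;0;3;2;1;1]]; Ac 0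
  [[-1;0;0;0;-1;-1;1]; [1]; [1;-1;-2;1;-2;-1;1]]; Ac 0 [[1]; [-3;-2;0;-1;0;0;1;1];
  [-1;0;0;0;-1;0;1]]]]; Br 2 0 [Ac 2 [[1]; [0;0;1;0;1]; [0;0;1;-1;0;-1]]; Ac 0 [[1];
  [-4;2;-3;1;2;-1]; [-6;3;-4;2;3;-1]]; Ac 6 [[-1]; [-1;0;-2;1;-1]; [0;-1;1]]; Ac 6 [[1];
  [-2;1;-2;1;1]; [0;0;1]]; Ac 0 [[1]; [1;0;-3;1;-2;1]; [1;0;-2;1;-2;1]]; Ac 2 [[1];
  [0;1;-1;0;1]; [-3;0;-1;1;0;-1]]; Br 6 (-2) []; Br 6 (-2) [Ac 2 [[1]; [-1;1;0;0;0;0;1];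
  [0;0;0;0;-1]]; Ac 2 [[1]; [2;-1;0;0;0;0;-1]; [0;0;0;0;-1]]; Ac 2 [[1]; [2;0;-1;0;1;0;-1];
  [0;0;0;0;-1]]; Ac 2 [[1]; [-1;1;-1;0;1;0;1]; [0;0;0;0;-1]]; Ac 2 [[1]; [-1;1;-2;1;2;-1;-1];
  [0;0;0;0;1]]; Ac 2 [[1;0;2;-1;-2;1;-1]; [-1]; [-2;1;-3;1;2;-1;1]]]; Ac 6 [[1]; [0;0;0;0;1];
  [0;0;1]]; Br 10 (-4) [Ac 1 [[1]; [3;-1;0;0;0;0;-1]; [0;0;0;0;1]]; Ac 1 [[3;-1;0;0;0;0;-1];
  [2;-1;0;0;0;0;-1]; [1;-1;-2;1;0;0;-1]]; Ac 1 [[1]; [-3;2;-5;2;-1;1;1]; [0;0;0;0;1]]; Ac 1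
  [[3;-1;5;-2;1;-1;1]; [2;-1;5;-2;1;-1;1]; [1;-1;3;-1;1;-1;1]]; Ac 1 [[1]; [4;-1;2;-1;1;0;-1];
  [0;0;0;0;1]]; Ac 1 [[-1]; [0;0;-2;1;-1;0;-1]; [0;0;0;0;-1]]]; Ac 7 [[1]; [0;0;0;0;1];
  [2;-1;2;-1]]; Ac 0 [[1]; [2;0;1;-1;-1]; [0;-1;2;0;0;1]]; Ac 0 [[1]; [-2;1;-5;2;-2;1];
  [-2;1;-4;2;-2;1]]; Br 10 (-4) []; Br 6 (-2) []; Br 6 (-2) []; Br 10 (-4) []; Ac 0 [[1];
  [-4;2;-5;2;2;-1]; [-6;3;-7;3;3;-1]]; Ac 0 [[1]; [1;0;1;-1;1]; [1;0;2;-1;1]]; Ac 0 [[1];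
  [-1;0;0;0;1]; [-1;0;1;0;1]]; Ac 0 [[1]; [1;0;4;-2;2;-1]; [0;0;5;-2;3;-1]]; Ac 5 [[-1;0;0;0;1];
  [1]; [0;1;-1]]; Ac 0 [[1]; [5;-2;4;-2;-2;1]; [5;-2;5;-2;-2;1]]; Ac 0 [[1]; [1;0;0;0;-1];
  [0;0;-1;0;0;1]]; Ac 0 [[1]; [0;1;-1;0;-1]; [-3;0;-1;1;0;1]]; Ac 7 [[1]; [0;-1;1;0;1];
  [2;-1;2;-1]]; Ac 1 [[1]; [-1;0;-2;1;1]; [0;-1;3;-1;-1;1]]; Ac 1 [[1]; [2;-1;2;-1;1];
  [-3;1;-3;1;-1;1]]; Ac 7 [[1]; [0;0;-1;0;1]; [-1;0;-2;1]]; Ac 0 [[1]; [0;0;-1;0;1];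
  [0;0;0;0;1]]]; Br 3 (-1) [Ac 2 [[1]; [1;0;1;0;1;1]; [1;0;0;-1;-2;-1]]; Ac 6 [[-1];
  [0;1;-1;0;1]; [1;0;0;0;1;1]]; Ac 0 [[1]; [2;0;2;-1;0;1]; [1;-1;3;-1;-2]]; Ac 0 [[-1];
  [1;0;-2;1;0;1]; [0;-1;-2;1;-1]]; Ac 6 [[1]; [-1;0;1;0;1]; [1;1;0;0;1;1]]; Ac 2 [[1];
  [2;1;-1;0;1;1]; [-2;-2;0;1;-2;-1]]; Ac 0 [[-1]; [1;-1;1;0;0;1]; [1;-1;0;0;-1]]; Br 5 3 []; Br
  10 6 [Ac 0 [[-2;1;1;0;6;3;0;1]; [1;-1;-1;1;1;2;1]; [2;0;-1;0;-1]]; Ac 0 [[-1];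
  [5;1;-1;-1;3;4;0;1]; [1;-1;0;0;-1]]; Ac 0 [[2;2;-2;-1;-1;-1;1]; [-1]; [5;4;-2;-3;-3;-2;0;1]];
  Ac 0 [[3;1;-1;-1;-1;0;1]; [-1]; [-1;0;1]]; Ac 0 [[-9;-6;4;2;-2;-2;1;1]; [-1]; [0;1;-1]]; Ac 0
  [[-6;-2;2;1;5;3;0;1]; [-1]; [-6;-4;2;2;6;5;1;1]]; Ac 0 [[1]; [0;1;-3;-2;-6;-5;1;1];
  [-1;1;0;0;1]]; Ac 0 [[2;0;0;-1;1;1;1]; [3;3;-3;-3;3;2;1;1]; [-2;0;1;0;1]]; Ac 0
  [[-8;-6;2;1;-1;-1;1;1]; [-1]; [-3;-1;1;0;0;0;1]]; Ac 0 [[-3;-5;1;1;1;2;0;1]; [1]; [0;-1;1]];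
  Ac 0 [[-3;-3;-1;-1;-3;-2;1;1]; [-3;-2;-2;0;-2;-2;0;1]; [-1;-1;-1;0;-1;0;1]]; Ac 0 [[-1];
  [0;-1;-1;0;0;1;1]; [-1;-2;-1;-2;1;1;1;1]]]; Br 10 6 [Ac 0 [[1]; [-1;-2;2;0;-6;-4;0;1];
  [-1;1;0;0;1]]; Ac 0 [[-1]; [-1;2;-1;-1;-3;-4;0;1]; [2;0;0;-1;-2;-1;1]]; Ac 0
  [[5;4;-1;-3;3;2;0;1]; [3;2;-2;-1;1;1;1]; [0;-1;1;0;-1]]; Ac 0 [[1]; [5;4;-4;-2;0;0;0;1];
  [2;3;0;-2;1;0;1]]; Ac 0 [[1]; [-3;-2;1;1;1;0;1]; [-8;-5;4;2;3;2;1;1]]; Ac 0 [[1];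
  [-9;-6;3;2;-6;-5;1;1]; [-6;-3;2;1;-4;-3;0;1]]; Ac 0 [[1;2;-2;-2;6;4;1;1];
  [-1;2;-2;-1;5;3;0;1]; [1;0;-2;0;1;1;1]]; Ac 0 [[1]; [1;0;0;-1;-1;-1;1]; [-1;1;0;0;1]]; Ac 0
  [[1]; [-1;-2;1;0;0;1;1]; [-8;-6;1;2;1;1;1;1]]; Ac 0 [[1]; [-9;-6;2;1;-3;-3;1;1];
  [-6;-3;2;0;-1;-2;0;1]]; Ac 0 [[1]; [-3;-2;-1;-1;3;2;1;1]; [0;-1;-1;-1;2;2;0;1]]; Ac 0 [[1];
  [-1;0;-2;0;0;0;1]; [-2;-2;-2;-1;-2;-1;1;1]]]; Br 5 3 []; Ac 0 [[1]; [2;0;-1;0;0;1];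
  [1;-1;-1;1;-2]]; Ac 4 [[1]; [0;-1;1]; [1;0;0;0;-1]]; Ac 2 [[1]; [0;0;-2;1;1];
  [-1;0;-4;2;1;-1]]; Br 3 0 []; Br 5 3 []; Ac 2 [[1]; [2;1;0;-1;1;1]; [-1;-1;2;0;-2;-1]]; Ac 0
  [[1]; [4;3;-2;-1;-3;-2]; [-3;-2;1;1;2;2]]; Br 3 0 []; Ac 4 [[1]; [0;-1;1]; [0;0;-2;1;1]]; Ac 0
  [[-1]; [1;0;1;-1;0;1]; [0;-1;1;0;-1]]; Ac 0 [[1]; [-1;-1;-1;1;0;1]; [1;1;-3;1;-2]]; Ac 4 [[1];
  [0;-1;1]; [1;0;-2;1;-1]]; Br 3 0 []; Ac 0 [[1]; [-1;-1;2;1;-3;-2]; [1;1;-1;-1;2;2]]]]].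

(** Only the last two forms have integral overlattices to treat, and these contain the first
    form. *)
Definition over13 : list (list (Z * list cert)) :=
  [[(2, []); (2, [])]; [(2, []); (2, []); (3, [])]; [(2, []); (2, []); (3, [])]; [(2, []); (2,
  []); (17, [])]; [(2, []); (2, []); (17, [])]; [(2, []); (2, []); (13, [])]; [(2, []); (2, []);
  (3, [Ac 0 [[1]; [-1;1;-1;1;-2;1;-1]; [-2;1;-1;0;-3;1;1]]; Ac 0 [[1]; [-1;0;-1;0;-2;0;1];
  [-1;0;-1;0;-1;0;1]]]); (3, [Ac 0 [[1]; [-1;1;-1;1;-2;1;-1]; [-2;1;-1;0;-3;1;1]]; Ac 0 [[1];
  [-1;0;-1;0;-2;0;1]; [-1;0;-1;0;-1;0;1]]])]; [(2, []); (2, []); (3, [Ac 0 [[-1];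
  [0;0;-1;0;1;0;1]; [-1;-1;-1;0;0;-1;1]]; Ac 0 [[1]; [-1;-1;0;-1;-2;-1;1]; [1;1;1;0;1;1]]]); (3,
  [Ac 0 [[-1]; [0;0;-1;0;1;0;1]; [-1;-1;-1;0;0;-1;1]]; Ac 0 [[1]; [-1;-1;0;-1;-2;-1;1];
  [1;1;1;0;1;1]]])]].

Definition forms17 : list kform :=
  let f1 := KForm (1, 0) (1, 0) (2, 0) (0, 0) (1, 0) (0, 1) in
  let f2 := KForm (1, 0) (2, 0) (2, 0) (0, 1) (1, -1) (-1, 0) in
  let f3 := KForm (1, 0) (4, 0) (6, 0) (0, 0) (1, -1) (1, -4) in
  let f4 := KForm (1, 0) (1, 0) (2, 0) (0, 0) (0, 0) (0, 1) in
  let f5 := KForm (1, 0) (2, 1) (6, 2) (1, 1) (3, 0) (0, 0) in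
  let f6 := KForm (1, 0) (2, 1) (3, 0) (0, 0) (0, 1) (2, 0) in
  [f1; kform_map (kconj (omega_tr 17)) f1; f2; f3; kform_map (kconj (omega_tr 17)) f3; f4;
  kform_map (kconj (omega_tr 17)) f4; f5; kform_map (kconj (omega_tr 17)) f5; f6; kform_map
  (kconj (omega_tr 17)) f6].

Definition cert17 : cert :=
  Br 1 0 [Br 2 1 [Br 3 0 [Ac 10 [[1]; [-3;1;5;-2;2;-1]; [-2;0;2;-1;1;-1]]; Br 3 (-1) []; Br 3
  (-1) [Br 9 (-3) [Ac 8 [[-1]; [-2;1;-2;1;0;0;1]; [-3;1;3;-1;0;0;0;0;1]]; Ac 8 [[-1];
  [-2;1;0;0;0;0;1]; [-3;1;-3;1;0;0;0;0;1]]; Ac 2 [[2;0;1;0;-2;1;1;0;1]; [-1;1;-2;1;1;0;1];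
  [-1;0;0;0;0;0;1]]; Ac 2 [[-1]; [-1;0;0;0;0;0;1]; [-1;1;-3;1;0;0;0;0;1]]; Ac 2
  [[0;0;-5;2;0;0;1;0;-1]; [0;0;0;0;-1;0;1]; [-1;0;-2;1;0;0;1]]; Ac 2 [[3;-1;1;0;-2;1;1;0;-1];
  [3;-1;1;0;-2;1;0;0;-1]; [0;0;0;0;-1;0;1]]; Ac 8 [[-1]; [-2;1;-2;1;0;0;1];
  [1;-1;3;-1;-3;1;0;0;1]]; Ac 8 [[-1]; [-2;1;-2;1;0;0;1]; [-3;1;1;0;1;0;0;0;1]]; Ac 8 [[1];
  [0;0;0;0;0;0;1]; [1;0;-1;0;-1;0;0;0;1]]; Ac 8 [[-1]; [-2;1;-2;1;0;0;1];
  [-3;1;3;-1;1;0;0;0;1]]; Ac 8 [[1]; [0;0;-2;1;0;0;1]; [4;-1;1;0;-2;1;0;0;1]]; Ac 8 [[-1];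
  [-2;1;0;0;0;0;1]; [-5;1;-1;0;2;-1;0;0;1]]]; Ac 2 [[-1]; [-1;0;0;0;0;0;1]; [0;1;0;0;1;0;1;1]];
  Ac 2 [[1]; [-1;1;0;0;0;0;1]; [2;-1;0;0;-1;0;1;1]]; Br 9 (-3) [Ac 8 [[1]; [0;0;0;0;0;0;1];
  [0;1;3;-1;0;0;0;0;1]]; Ac 8 [[1]; [0;0;0;0;0;0;1]; [3;0;3;-1;-2;1;0;0;1]]; Ac 2
  [[2;0;3;-1;-2;1;1;0;1]; [-1;1;0;0;1;0;1]; [-1;0;2;-1;0;0;1]]; Ac 2 [[1]; [-1;1;2;-1;0;0;1];
  [0;0;-3;1;0;0;0;0;1]]; Ac 2 [[-2;1;5;-2;0;0;1;0;1]; [0;0;3;-1;0;0;0;0;1]; [-1;0;2;-1;-1;0;1]];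
  Ac 2 [[1]; [-1;1;0;0;0;0;1]; [4;-2;1;0;-2;1;0;0;-1]]; Ac 8 [[-1]; [-2;1;2;-1;0;0;1];
  [-2;0;-3;1;-1;0;0;0;1]]; Ac 8 [[1]; [0;0;0;0;0;0;1]; [0;1;1;0;1;0;0;0;1]]; Ac 8 [[-1];
  [-2;1;0;0;0;0;1]; [1;-1;5;-2;-3;1;0;0;1]]; Ac 8 [[1]; [0;0;0;0;0;0;1]; [0;1;3;-1;1;0;0;0;1]];
  Ac 8 [[-1]; [-2;1;2;-1;0;0;1]; [-2;0;-5;2;0;0;0;0;1]]; Ac 8 [[-1]; [-2;1;2;-1;0;0;1];
  [-5;1;-1;0;2;-1;0;0;1]]]; Ac 10 [[-1]; [0;0;-3;1;0;0;1]; [-1;1;0;0;1]]; Ac 10 [[-1];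
  [0;0;0;0;0;0;1]; [0;0;0;0;-1]]; Ac 2 [[-1]; [0;0;-3;1;0;0;0;-1]; [-1;0;-3;1;-1;0;2]]; Br 2 0
  [Ac 2 [[-2;0;-1;0;1;-1;1;0;-1]; [-1;1;1;0;0;0;1;0;2]; [-2;1;-1;1;1;0;1;0;2]]; Ac 2 [[-1];
  [-4;1;-1;0;1;-1;1;0;2]; [-1;1;0;0;0;0;0;0;1]]; Ac 8 [[-1]; [-1;0;2;-1;-1;0;0;0;1];
  [-5;1;-3;1;2;-1;1]]; Ac 8 [[1]; [0;0;-2;1;1;0;0;0;1]; [1;0;3;-1;0;0;1]]; Ac 8 [[1];
  [1;-1;-2;1;0;0;0;0;1]; [1;0;3;-1;0;0;1]]; Ac 8 [[-1]; [-1;0;0;0;0;0;0;0;1];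
  [-2;0;3;-1;0;0;1]]]; Br 2 0 [Ac 2 [[1]; [1;1;-1;1;-1;1;1;0;2]; [1;-1;0;0;0;0;0;0;-1]]; Ac 2
  [[1]; [-1;1;1;-1;-1;0;1;0;2]; [1;-1;0;0;0;0;0;0;-1]]; Ac 8 [[-1]; [-1;0;2;-1;-1;0;0;0;1];
  [-2;0;-3;1;0;0;1]]; Ac 8 [[-1]; [-2;1;-2;1;1;0;0;0;1]; [1;-1;3;-1;-2;1;1]]; Ac 8 [[1];
  [1;-1;-2;1;0;0;0;0;1]; [4;-1;3;-1;-2;1;1]]; Ac 8 [[-1]; [-1;0;0;0;0;0;0;0;1];
  [1;-1;3;-1;-2;1;1]]]; Ac 2 [[0;0;-2;1;0;0;-1]; [-1;0;3;-1;1;0;2]; [0;0;-3;1;0;0;-1]]]; Br 3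
  (-1) []; Br 6 (-1) []; Br 3 (-1) []; Br 3 (-1) [Br 9 (-3) [Ac 8 [[-1]; [-2;1;0;0;0;0;1];
  [0;0;-3;1;-2;1;0;0;1]]; Ac 8 [[-1]; [-2;1;-2;1;0;0;1]; [-6;2;3;-1;2;-1;0;0;1]]; Ac 2 [[-1];
  [-1;0;0;0;0;0;1]; [3;-1;-1;0;-2;1;0;0;-1]]; Ac 2 [[0;0;3;-1;0;0;1;0;-1]; [0;0;-2;1;-1;0;1];
  [-1;0;0;0;0;0;1]]; Ac 2 [[-1]; [-1;0;0;0;0;0;1]; [0;0;-3;1;0;0;0;0;-1]]; Ac 2
  [[2;0;-3;1;-2;1;1;0;1]; [-1;1;0;0;1;0;1]; [-1;0;-2;1;0;0;1]]; Ac 8 [[-1]; [-2;1;0;0;0;0;1];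
  [1;-1;-5;2;-3;1;0;0;1]]; Ac 8 [[-1]; [-2;1;-2;1;0;0;1]; [-6;2;3;-1;3;-1;0;0;1]]; Ac 8 [[-1];
  [-2;1;-2;1;0;0;1]; [-2;0;3;-1;-1;0;0;0;1]]; Ac 8 [[-1]; [-2;1;-2;1;0;0;1];
  [-6;2;5;-2;3;-1;0;0;1]]; Ac 8 [[-1]; [-2;1;-2;1;0;0;1]; [-5;1;1;0;2;-1;0;0;1]]; Ac 8 [[-1];
  [-2;1;-2;1;0;0;1]; [-2;0;5;-2;0;0;0;0;1]]]; Ac 2 [[-1]; [-1;0;0;0;0;0;1]; [0;1;0;0;1;0;1;1]];
  Ac 2 [[1]; [-1;1;0;0;0;0;1]; [2;-1;0;0;-1;0;1;1]]; Br 9 (-3) [Ac 8 [[1]; [0;0;0;0;0;0;1];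
  [0;1;3;-1;0;0;0;0;1]]; Ac 8 [[1]; [0;0;0;0;0;0;1]; [-3;2;3;-1;2;-1;0;0;1]]; Ac 2 [[1];
  [-1;1;2;-1;0;0;1]; [4;-2;-1;0;-2;1;0;0;-1]]; Ac 2 [[-2;1;-3;1;0;0;1;0;1]; [-2;1;2;-1;1;0;1];
  [-1;1;0;0;0;0;1]]; Ac 2 [[1]; [-1;1;2;-1;0;0;1]; [1;-1;-3;1;0;0;0;0;-1]]; Ac 2 [[1];
  [-1;1;2;-1;0;0;1]; [3;-1;-1;0;-2;1;0;0;1]]; Ac 8 [[1]; [0;0;0;0;0;0;1]; [1;0;1;0;-1;0;0;0;1]];
  Ac 8 [[1]; [0;0;0;0;0;0;1]; [-3;2;3;-1;3;-1;0;0;1]]; Ac 8 [[-1]; [-2;1;2;-1;0;0;1];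
  [1;-1;-3;1;-3;1;0;0;1]]; Ac 8 [[-1]; [-2;1;2;-1;0;0;1]; [-3;1;-1;0;1;0;0;0;1]]; Ac 8 [[-1];
  [-2;1;0;0;0;0;1]; [-5;1;1;0;2;-1;0;0;1]]; Ac 8 [[1]; [0;0;2;-1;0;0;1];
  [4;-1;-1;0;-2;1;0;0;1]]]; Ac 10 [[1]; [0;0;0;0;0;0;-1]; [1;-1;-3;1;-1;0;1]]; Ac 10 [[1];
  [0;0;3;-1;0;0;-1]; [0;0;0;0;1]]; Ac 2 [[0;0;2;-1;0;0;-1]; [-1;0;-3;1;0;0;1];
  [0;0;3;-1;0;0;0;1]]; Br 2 0 [Ac 2 [[1]; [-1;1;-1;1;-1;0;1;0;2]; [1;-1;0;0;0;0;0;0;-1]]; Ac 2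
  [[1]; [1;1;1;-1;-1;1;1;0;2]; [1;-1;0;0;0;0;0;0;-1]]; Ac 8 [[1]; [0;0;0;0;1;0;0;0;1];
  [1;0;3;-1;0;0;1]]; Ac 8 [[1]; [1;-1;-2;1;-1;0;0;0;1]; [1;0;3;-1;0;0;1]]; Ac 8 [[1];
  [1;-1;-2;1;0;0;0;0;1]; [1;0;3;-1;0;0;1]]; Ac 8 [[-1]; [-1;0;0;0;0;0;0;0;1];
  [-2;0;3;-1;0;0;1]]]; Br 2 0 [Ac 2 [[-1]; [-4;1;1;0;1;-1;1;0;2]; [-1;1;0;0;0;0;0;0;1]]; Ac 2
  [[-2;0;1;0;1;-1;1;0;-1]; [-1;1;-1;0;0;0;1;0;2]; [-2;1;1;-1;1;0;1;0;2]]; Ac 8 [[-1];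
  [-2;1;0;0;1;0;0;0;1]; [-5;1;3;-1;2;-1;1]]; Ac 8 [[-1]; [-1;0;-2;1;-1;0;0;0;1];
  [-5;1;3;-1;2;-1;1]]; Ac 8 [[1]; [1;-1;-2;1;0;0;0;0;1]; [-2;1;3;-1;2;-1;1]]; Ac 8 [[-1];
  [-1;0;0;0;0;0;0;0;1]; [-5;1;3;-1;2;-1;1]]]; Ac 2 [[-1]; [0;0;3;-1;0;0;0;-1];
  [-1;0;3;-1;-1;0;2]]]; Br 3 (-1) []; Ac 10 [[1]; [-3;1;-5;2;2;-1]; [-2;0;-2;1;1;-1]]; Br 9 (-3)
  []; Br 3 (-1) []; Br 3 (-1) [Br 21 (-8) [Ac 2 [[-2;1;8;-3;-3;1;0;0;1]; [-4;2;8;-3;-3;1;1;0;1];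
  [1;0;-4;2;1;0;1;0;1;1]]; Ac 2 [[-3;1;-2;1;2;-1;0;0;1]; [-3;1;-4;2;2;-1;1;0;1];
  [0;0;4;-1;-2;1;1;0;1;1]]; Ac 2 [[-3;1;5;-2;-3;1;0;0;1]; [-3;1;3;-1;-3;1;1;0;1];
  [0;0;-1;0;1;0;1;0;1;1]]; Ac 2 [[-2;1;-8;3;2;-1;0;0;1]; [-4;2;-8;3;2;-1;1;0;1];
  [1;0;4;-2;-2;1;1;0;1;1]]; Ac 9 [[1]; [-2;1;6;-2;-4;1;1;0;1]; [-1;1;6;-2;-3;1;0;0;1]]; Ac 9
  [[-1]; [-2;1;-12;5;4;-2;1;0;1]; [-1;0;-12;5;5;-2;0;0;1]]; Ac 9 [[1]; [-2;1;8;-3;-4;1;1;0;1];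
  [-1;1;8;-3;-3;1;0;0;1]]; Ac 9 [[-1]; [-2;1;-10;4;4;-2;1;0;1]; [-1;0;-10;4;5;-2;0;0;1]]; Ac 8
  [[-1]; [-2;1;0;0;0;0;1]; [-4;1;0;0;-2;1;1;0;1]]; Ac 8 [[-1]; [-2;1;-2;1;0;0;1];
  [-4;1;-12;5;5;-2;1;0;1]]; Ac 8 [[-1]; [-2;1;-2;1;0;0;1]; [-4;1;3;-1;-3;1;1;0;1]]; Ac 8 [[1];
  [0;0;-2;1;0;0;1]; [-1;1;-10;4;3;-1;1;0;1]]; Ac 8 [[-1]; [-2;1;-2;1;0;0;1];
  [-4;1;6;-2;0;0;1;0;1]]; Ac 8 [[1]; [0;0;-2;1;0;0;1]; [-1;1;6;-2;0;0;1;0;1]]; Ac 8 [[-1];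
  [-2;1;0;0;0;0;1]; [-4;1;10;-4;-5;2;1;0;1]]; Ac 8 [[-1]; [-2;1;-2;1;0;0;1];
  [-4;1;-2;1;2;-1;1;0;1]]; Ac 2 [[0;0;0;0;-2;1;0;0;1]; [-2;1;0;0;-2;1;1;0;1];
  [-1;0;-4;2;2;-1;1;0;1;1]]; Ac 2 [[0;0;-10;4;2;-1;0;0;1]; [-2;1;-10;4;2;-1;1;0;1];
  [-1;0;6;-2;-2;1;1;0;1;1]]; Ac 2 [[0;0;10;-4;-3;1;0;0;1]; [-2;1;10;-4;-3;1;1;0;1];
  [-1;0;-6;2;1;0;1;0;1;1]]; Ac 2 [[-1;0;-3;1;3;-1;0;0;1]; [-2;0;2;-1;-2;1;1;0;1;1];
  [-1;1;-2;1;0;0;1]]]; Ac 9 [[-1]; [0;0;-1]; [-1;0;-3;1;1;0;1]]; Ac 9 [[1]; [0;0;-1];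
  [1;0;-3;1;1;0;-1]]; Br 21 (-8) [Ac 2 [[-3;1;8;-3;-3;1;0;0;1]; [-3;1;10;-4;-3;1;1;0;1];
  [0;0;-2;1;1;0;1;0;1;1]]; Ac 2 [[-2;1;-2;1;2;-1;0;0;1]; [1;0;1;0;-1;0;1;0;1;1];
  [-1;0;2;-1;0;0;1]]; Ac 2 [[-3;1;2;-1;-2;1;0;0;1]; [0;0;1;-1;1;0;1;0;1;1]; [-1;1;0;0;0;0;1]];
  Ac 2 [[-2;1;-8;3;3;-1;0;0;1]; [1;0;6;-3;-2;1;1;0;1;1]; [-1;0;2;-1;0;0;1]]; Ac 9 [[1];
  [-2;1;8;-3;-4;1;1;0;1]; [-1;1;6;-2;-3;1;0;0;1]]; Ac 9 [[-1]; [-2;1;-10;4;4;-2;1;0;1];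
  [-1;0;-12;5;5;-2;0;0;1]]; Ac 9 [[1]; [-2;1;10;-4;-4;1;1;0;1]; [-1;1;8;-3;-3;1;0;0;1]]; Ac 9
  [[-1]; [-2;1;-8;3;4;-2;1;0;1]; [-1;0;-10;4;5;-2;0;0;1]]; Ac 8 [[-1]; [-2;1;2;-1;0;0;1];
  [-4;1;2;-1;-2;1;1;0;1]]; Ac 8 [[-1]; [-2;1;0;0;0;0;1]; [-4;1;-10;4;5;-2;1;0;1]]; Ac 8 [[-1];
  [-2;1;2;-1;0;0;1]; [-4;1;-6;2;0;0;1;0;1]]; Ac 8 [[1]; [0;0;0;0;0;0;1];
  [-1;1;-8;3;3;-1;1;0;1]]; Ac 8 [[-1]; [-2;1;0;0;0;0;1]; [-4;1;8;-3;0;0;1;0;1]]; Ac 8 [[1];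
  [0;0;0;0;0;0;1]; [-1;1;8;-3;0;0;1;0;1]]; Ac 8 [[-1]; [-2;1;2;-1;0;0;1];
  [-4;1;12;-5;-5;2;1;0;1]]; Ac 8 [[-1]; [-2;1;0;0;0;0;1]; [-4;1;0;0;2;-1;1;0;1]]; Ac 2 [[-1];
  [-1;0;2;-1;0;0;1]; [-2;1;2;-1;-2;1;1;0;1]]; Ac 2 [[0;0;-10;4;2;-1;0;0;1];
  [-2;1;-8;3;2;-1;1;0;1]; [-1;0;8;-3;-2;1;1;0;1;1]]; Ac 2 [[0;0;10;-4;-3;1;0;0;1];
  [-2;1;12;-5;-3;1;1;0;1]; [-1;0;-4;1;1;0;1;0;1;1]]; Ac 2 [[-1;0;-3;1;3;-1;0;0;1];
  [-2;0;4;-2;-2;1;1;0;1;1]; [-1;1;0;0;0;0;1]]]; Br 2 0 [Ac 10 [[-1]; [0;0;2;-1;-2;1;1];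
  [-1;1;-3;1;1;0;0;0;1]]; Ac 10 [[-1]; [0;0;-3;1;0;0;1]; [-1;1;0;0;-1;0;0;0;1]]; Ac 10 [[1];
  [0;0;5;-2;-2;1;1]; [0;0;2;-1;-1;1;1;0;1]]; Ac 10 [[-1]; [0;0;0;0;0;0;1];
  [-1;1;3;-1;-1;0;0;0;1]]; Ac 2 [[0;0;1;0;0;0;0;0;1]; [1;0;0;0;0;0;0;0;-1];
  [0;0;1;-1;0;0;0;0;0;-1]]; Ac 2 [[-1;0;1;0;0;0;0;0;1]; [0;0;0;0;0;0;0;0;-1];
  [0;1;1;-1;0;0;0;0;0;-1]]; Ac 2 [[0;0;2;-1;-1;1;1;0;1]; [-1;0;-1;0;1;1;1;0;1;1];
  [0;0;0;0;0;0;0;0;1]]; Ac 2 [[-1;0;0;0;0;0;1;0;1]; [-1;0;0;0;0;0;0;0;1];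
  [0;0;3;-1;-2;0;0;0;0;1]]; Ac 2 [[0;0;2;-1;-2;1;1;0;1]; [-1;0;1;-1;0;1;1;0;1;1];
  [0;0;2;-1;-1;1;0;0;1]]; Ac 2 [[-1]; [0;-1;5;-2;-2;0;0;0;0;1]; [-1;0;2;-1;-2;0;1;0;1;1]]; Ac 2
  [[-1]; [0;-1;1;-1;0;0;0;0;0;1]; [-1;0;0;-1;0;0;0;0;1;1]]; Ac 2 [[0;0;-1;0;0;0;0;0;1];
  [-1;0;0;-1;0;0;0;0;1;1]; [0;0;0;0;0;0;0;0;1]]; Ac 9 [[1]; [0;0;2;-1;-1;1;1];
  [0;0;3;-1;-2;1;1;0;1]]; Ac 9 [[1]; [0;0;-1]; [0;0;-3;1;1;0;0;0;1]]; Ac 9 [[1]; [0;0;1];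
  [0;0;3;-1;-1;0;0;0;1]]; Ac 9 [[1]; [0;0;2;-1;-1;1;1]; [0;0;4;-2;-2;1;1;0;1]]]; Br 2 0 [Ac 10
  [[1]; [0;0;-3;1;0;0;1]; [0;0;-3;1;1;0;1;0;1]]; Ac 10 [[-1]; [0;0;-8;3;2;-1;1];
  [-1;1;0;0;-1;0;0;0;1]]; Ac 10 [[1]; [0;0;0;0;0;0;1]; [0;0;-3;1;1;0;1;0;1]]; Ac 10 [[-1];
  [0;0;-5;2;2;-1;1]; [-1;1;3;-1;-1;0;0;0;1]]; Ac 2 [[0;0;1;0;0;0;0;0;1]; [1;0;0;0;0;0;0;0;-1];
  [0;0;1;-1;0;0;0;0;0;-1]]; Ac 2 [[0;0;1;0;0;0;0;0;1]; [1;0;0;0;0;0;0;0;-1];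
  [0;0;1;-1;0;0;0;0;0;-1]]; Ac 2 [[-1;0;-3;1;1;0;1;0;1]; [0;-1;-6;2;3;0;1;0;1;1];
  [-1;0;0;0;0;0;0;0;1]]; Ac 2 [[-1;0;-5;2;1;-1;1;0;1]; [0;-1;-2;1;-1;-1;1;0;1;1];
  [-1;0;0;0;0;0;0;0;1]]; Ac 2 [[-1;0;-3;1;0;0;1;0;1]; [0;-1;-4;1;2;0;1;0;1;1];
  [-1;0;2;-1;-1;1;0;0;1]]; Ac 2 [[-1;0;-8;3;2;-1;1;0;1]; [-1;0;0;0;0;0;0;0;1];
  [0;0;3;-1;-2;0;0;0;0;1]]; Ac 2 [[0;0;-1;0;0;0;0;0;1]; [-1;0;0;-1;0;0;0;0;1;1];
  [0;0;0;0;0;0;0;0;1]]; Ac 2 [[0;0;1;0;0;0;0;0;-1]; [0;-1;1;-1;-1;0;0;0;1;1];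
  [0;0;0;0;0;0;0;0;-1]]; Ac 9 [[1]; [0;0;-3;1;1;0;1]; [0;0;-3;1;0;0;1;0;1]]; Ac 9 [[1]; [0;0;1];
  [0;1;3;-1;-1;0;0;0;-1]]; Ac 9 [[1]; [0;0;-1]; [0;1;-3;1;1;0;0;0;-1]]; Ac 9 [[1];
  [0;0;-5;2;1;-1;1]; [0;0;-5;2;2;-1;1;0;1]]]; Ac 2 [[-1]; [0;0;-3;1;0;0;0;-1];
  [-1;0;0;0;1;0;1;1]]; Ac 2 [[-1;0;-2;1;0;0;1]; [0;-1;1;0;0;0;1;1]; [-1;0;-3;1;0;0;1]]; Ac 8
  [[1]; [1;-1;-7;3;2;-1;0;1]; [1;0;3;-1;0;0;1]]; Ac 8 [[-1]; [-1;0;5;-2;-2;1;0;1];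
  [-2;0;-8;3;3;-1;1]]; Ac 8 [[-1]; [-1;0;-3;1;2;-1;0;1]; [-2;0;-3;1;0;0;1]]; Ac 8 [[-1];
  [-1;0;5;-2;-2;1;0;1]; [-2;0;-5;2;3;-1;1]]; Ac 2 [[-1;0;2;-1;0;0;1]; [0;0;-3;1;0;0;-1];
  [0;1;3;-1;0;0;0;-1]]; Ac 2 [[-1]; [0;-1;-3;1;0;0;0;1]; [-1;0;-1;0;0;0;1;1]]]; Br 3 (-1) []; Br
  3 (-1) [Br 9 (-3) [Ac 4 [[-1]; [-1;0;0;0;1;0;0;0;1]; [-1;0;-2;1;1;0;1]]; Ac 4 [[1];
  [-1;0;0;0;-1;0;0;0;1]; [-1;1;0;0;-1;0;1]]]; Br 9 (-3) [Ac 4 [[-1]; [-1;0;-2;1;1;-1;0;0;1];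
  [-1;0;2;-1;-1;0;1]]; Ac 4 [[-1]; [-1;0;0;0;-1;0;0;0;1]; [-1;0;2;-1;-1;0;1]]]]; Br 3 (-1) [];
  Br 3 (-1) [Br 11 (-4) []]; Br 3 (-1) []; Br 2 0 [Ac 10 [[1]; [0;0;-1;0;1]; [0;0;-1;-1;2;1;1]];
  Ac 10 [[1]; [0;0;2;-1;1]; [0;0;1;0;0;0;1]]; Ac 10 [[1]; [0;0;2;-1;1]; [0;0;-1;-1;2;1;1]]; Ac
  10 [[-1]; [0;0;1;0;-1]; [-1;1;3;0;-1;-1;1]]; Ac 2 [[0;0;1;0;0;0;1]; [0;0;2;0;-1;0;1];
  [0;-1;1;1;0;-1;0;1]]; Ac 2 [[0;0;1;0;0;0;1]; [0;0;3;-1;1;0;1]; [0;-1;-3;1;0;1;0;1]]; Ac 2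
  [[1]; [0;0;3;1;-2;-2;0;1]; [0;-1;4;2;-4;-3;1;1]]; Ac 2 [[1]; [0;0;-5;0;2;2;0;1];
  [0;-1;-3;-1;3;2;1;1]]; Ac 2 [[-1]; [0;-1;3;1;-2;-2;0;1]; [-1;0;4;2;-4;-3;1;1]]; Ac 2
  [[-1;0;-1;0;1;0;1]; [0;-1;-2;-2;3;2;1;1]; [-1;0;-2;-1;3;1;1]]; Ac 2 [[-1;0;-2;1;-1;0;1];
  [0;-1;1;0;-1;-1;1;1]; [-1;0;-3;1;-1;0;1]]; Ac 2 [[-1;0;-1;0;0;0;1]; [0;-1;0;-1;0;0;1;1];
  [-1;0;0;0;0;0;1]]; Ac 9 [[1]; [0;0;-1;-1;2;1]; [0;0;-1;0;1;0;1]]; Ac 9 [[1]; [0;0;-1];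
  [0;0;-3;0;1;1;1]]; Ac 9 [[1]; [0;0;-1]; [0;0;0;1;-1;-1;1]]; Ac 9 [[1]; [0;0;-1;-1;2;1];
  [0;0;2;-1;1;0;1]]]; Br 3 (-1) [Ac 2 [[-1]; [-1;0;0;0;0;0;1]; [-2;1;-2;1;1;0;1]]; Ac 2 [[1];
  [-1;1;2;-1;0;0;1]; [-1;0;0;0;1;0;1]]; Ac 2 [[-1]; [1;-1;3;-1;-2;1;1]; [1;0;5;-2;-3;1;1]]; Ac 2
  [[0;0;-2;1;1]; [-2;1;-8;3;3;-1;1]; [-1;1;-12;4;3;-2;1]]; Ac 2 [[0;0;-2;1;1];
  [-3;1;-7;3;4;-1;1]; [-2;1;-11;4;4;-2;1]]; Ac 2 [[1]; [1;0;7;-3;-3;1;1]; [1;-1;5;-2;-2;1;1]]];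
  Br 3 (-1) []; Br 11 (-4) []; Br 3 (-1) [Ac 2 [[1;-1;0;0;1;0;-2]; [1;-1;0;0;1;0;-1];
  [1;-1;1;0;1;0;-2]]; Ac 2 [[-3;1;0;0;1;0;2]; [-1;0;0;0;1;0;1]; [-3;1;1;0;1;0;2]]; Ac 2
  [[-1;0;2;-1;1;0;0;1]; [1;-1;-3;1;-1;1;3]; [-1;0;3;-1;1;0;0;1]]; Ac 2 [[1;0;2;-1;-1;0;0;1];
  [-1;1;-6;2;1;-1;3]; [1;0;1;-1;-1;0;0;1]]; Ac 2 [[-1]; [0;-1;3;-1;0;0;0;1];
  [0;1;-3;1;-1;0;0;-1]]; Ac 2 [[-1;0;2;-1;0;0;1]; [0;0;3;-1;1;0;0;-1]; [-1;0;3;-1;0;0;1]]]; Br 9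
  (-3) []; Br 3 (-1) []; Br 11 (-4) []; Br 3 (-1) []; Br 11 (-4) []; Br 3 (-1) []; Br 9 (-3) [];
  Br 3 (-1) [Ac 2 [[-1;1;0;0;-1;0;2]; [2;-1;-1;0;1;0;-2]; [-1;0;0;0;0;0;1]]; Ac 2
  [[3;-1;0;0;-1;0;-2]; [-2;1;-1;0;1;0;2]; [1;-1;0;0;0;0;-1]]; Ac 2 [[-1;0;2;-1;1;0;0;1];
  [1;-1;-6;2;-1;1;3]; [-1;0;1;-1;1;0;0;1]]; Ac 2 [[1;0;2;-1;-1;0;0;1]; [-1;1;-3;1;1;-1;3];
  [1;0;3;-1;-1;0;0;1]]; Ac 2 [[-1;0;-2;1;0;0;1]; [0;0;-3;1;1;0;0;-1]; [-1;0;-3;1;0;0;1]]; Ac 2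
  [[-1]; [0;0;3;-1;0;0;0;-1]; [-1;0;-3;1;1;0;0;1]]]; Br 11 (-4) []; Br 3 (-1) []; Br 3 (-1) [Ac
  2 [[-1]; [-1;0;-2;1;0;0;1]; [-2;1;0;0;1;0;1]]; Ac 2 [[1]; [-1;1;0;0;0;0;1];
  [-1;0;2;-1;1;0;1]]; Ac 2 [[0;0;-2;1;-1]; [2;-1;-8;3;-3;1;1]; [1;-1;-12;4;-3;2;1]]; Ac 2 [[-1];
  [-1;0;5;-2;2;-1;1]; [-1;1;3;-1;1;-1;1]]; Ac 2 [[-1]; [1;-1;-7;3;-3;1;1]; [0;0;-5;2;-2;1;1]];
  Ac 2 [[0;0;2;-1;1]; [-3;1;7;-3;4;-1;1]; [-2;1;11;-4;4;-2;1]]]; Ac 6 [[1]; [-1;0;1;0;1];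
  [-1;0;0;0;1]]; Br 3 (-1) []; Br 3 (-1) [Br 11 (-4) []]; Br 3 (-1) [Ac 5 [[1];
  [1;0;2;-1;-1;0;1]; [1;0;0;0;-1]]; Ac 5 [[1]; [-1;0;0;0;1;0;1]; [-1;0;-2;1;1]]]; Br 3 (-1) [];
  Br 3 (-1) [Br 11 (-4) [Ac 0 [[-2;1;-2;1;0;0;0;0;1]; [1]; [-3;2;-2;1;0;0;1;0;1]]; Ac 0
  [[2;-1;2;-1;0;0;0;0;-1]; [1]; [-1;1;0;0;0;0;1]]; Ac 0 [[-2;1;2;-1;0;0;0;0;1]; [1];
  [-1;1;0;0;0;0;1]]; Ac 0 [[2;-1;-2;1;0;0;0;0;-1]; [1]; [1;0;-2;1;0;0;1;0;-1]]; Ac 0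
  [[-1;0;3;-1;1;0;0;0;-1]; [1]; [-2;1;3;-1;1;0;1;0;-1]]; Ac 0 [[-1;0;-3;1;1;0;0;0;1]; [1];
  [-1;1;0;0;0;0;1]]; Ac 0 [[-2;1;0;0;2;-1;0;0;-1]; [1]; [-1;1;0;0;0;0;1]]; Ac 0
  [[2;-1;0;0;-2;1;0;0;-1]; [1]; [-1;1;0;0;0;0;1]]]; Ac 0 [[2;-1;-2;1;1;0;-1;1]; [-1];
  [1;-1;0;0;0;0;-1]]; Ac 0 [[2;0;0;0;-1;0;1;1]; [1]; [-1;1;0;0;0;0;1]]; Ac 0
  [[2;-1;2;-1;1;0;-1;1]; [-1]; [1;-1;0;0;0;0;-1]]; Ac 0 [[2;0;0;0;-1;0;1;1]; [1];
  [-1;1;0;0;0;0;1]]; Br 11 (-4) [Ac 0 [[-2;1;-2;1;0;0;0;0;1]; [-1]; [-3;1;0;0;0;0;1;0;1]]; Ac 0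
  [[2;-1;2;-1;0;0;0;0;-1]; [-1]; [-1;0;2;-1;0;0;1]]; Ac 0 [[-2;1;2;-1;0;0;0;0;1]; [-1];
  [-1;0;2;-1;0;0;1]]; Ac 0 [[2;-1;-2;1;0;0;0;0;-1]; [1]; [1;0;0;0;0;0;1;0;-1]]; Ac 0
  [[-1;0;3;-1;1;0;0;0;-1]; [1]; [-1;1;0;0;0;0;1]]; Ac 0 [[-1;0;-3;1;1;0;0;0;1]; [-1];
  [-1;0;2;-1;0;0;1]]; Ac 0 [[2;-1;0;0;-2;1;0;0;1]; [-1]; [1;-1;2;-1;-2;1;1;0;1]]; Ac 0
  [[-2;1;0;0;2;-1;0;0;1]; [-1]; [-3;1;2;-1;2;-1;1;0;1]]]; Ac 6 [[-1]; [0;0;-2;1;0;0;1];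
  [0;0;-3;1;0;0;1]]; Ac 6 [[1]; [0;0;2;-1;0;0;-1]; [-1;0;0;0;1]]]; Br 3 (-1) []; Br 3 (-1) [Ac 5
  [[-1]; [2;-1;-3;1;-2;1;1]; [-1;0;2;-1;1]]; Ac 5 [[-1]; [-1;0;2;-1;1;0;1]; [-1;0;0;0;1]]]; Br 3
  (-1) [Br 11 (-4) []]; Br 3 (-1) []; Ac 6 [[1]; [-1;0;-1;0;1]; [-1;0;0;0;1]]; Ac 2 [[1];
  [0;-1;1;0;0;1]; [-1;-2;1;0;1;1]]; Br 3 (-1) [Ac 2 [[-1]; [-1;0;0;0;0;0;1]; [-3;1;0;0;1;0;1]];
  Ac 2 [[1]; [-1;1;2;-1;0;0;1]; [-2;0;2;-1;1;0;1]]; Ac 2 [[1]; [3;-1;-3;1;-2;1;1];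
  [2;-2;-3;1;-1;1;1]]; Ac 2 [[1]; [-3;2;2;-1;2;-1;1]; [-4;1;2;-1;3;-1;1]]; Ac 2 [[1];
  [-5;2;5;-2;3;-1;1]; [-6;1;5;-2;4;-1;1]]; Ac 2 [[1]; [4;-1;-3;1;-3;1;1]; [3;-2;-3;1;-2;1;1]]];
  Br 3 (-1) []; Br 3 (-1) [Ac 2 [[-1]; [-1;0;-2;1;0;0;1]; [-3;1;-2;1;1;0;1]]; Ac 2 [[1];
  [-1;1;0;0;0;0;1]; [-2;0;0;0;1;0;1]]; Ac 2 [[1]; [3;-1;0;0;-2;1;1]; [2;-2;0;0;-1;1;1]]; Ac 2
  [[1]; [-3;2;-5;2;2;-1;1]; [-4;1;-5;2;3;-1;1]]; Ac 2 [[1]; [4;-1;3;-1;-3;1;1];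
  [3;-2;3;-1;-2;1;1]]; Ac 2 [[1]; [-5;2;-5;2;3;-1;1]; [-6;1;-5;2;4;-1;1]]]; Ac 2 [[1];
  [0;-1;-1;0;0;1]; [-1;-2;-1;0;1;1]]; Br 3 (-1) [Ac 9 [[-1]; [-3;-1;0;1;2;1;1]; [0;-1;1;0;1]];
  Ac 9 [[1]; [-3;-1;2;0;2;1;1]; [0;0;1;0;1]]; Ac 9 [[-1]; [-2;-1;-1;1;1;1;1]; [0;-1;1;0;1]]; Ac
  9 [[1]; [-2;-2;0;1;3;1;1]; [0;0;0;0;1]]; Ac 2 [[1]; [0;-1;-1;1;2;0;0;1]; [0;0;0;0;-1;0;1]]; Ac
  2 [[-1]; [0;0;-1;0;-2;0;0;1]; [1;1;1;-1;0;-1;1]]; Ac 2 [[-1]; [0;-2;3;-1;2;0;0;1];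
  [-1;1;-1;0;-1;0;1]]; Ac 2 [[1]; [0;1;-1;0;-2;0;0;1]; [2;0;-1;0;0;-1;1]]]; Br 3 (-1) []; Br 3
  (-1) [Ac 5 [[-1;0;-2;1;1;0;1]; [-1]; [-1;0;-2;1;0;0;1]]; Ac 5 [[-1;0;0;0;1;0;1]; [1];
  [-1;1;0;0;0;0;1]]]; Ac 9 [[1]; [0;0;1]; [0;0;3;-1;1]]; Br 11 (-4) []; Br 3 (-1) []; Br 11 (-4)
  []; Ac 9 [[1]; [0;0;1]; [0;0;0;0;1]]; Br 3 (-1) [Ac 5 [[-1;0;0;0;1;0;1]; [-1];
  [-1;0;-2;1;0;0;1]]; Ac 5 [[-1;0;2;-1;1;0;1]; [1]; [-1;1;0;0;0;0;1]]]; Br 3 (-1) []; Br 3 (-1)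
  [Ac 9 [[-1]; [-3;-1;-2;0;2;1;1]; [0;-1;0;0;1]]; Ac 9 [[1]; [-3;-1;0;-1;2;1;1]; [0;0;0;0;1]];
  Ac 9 [[-1]; [-2;-1;-2;0;1;1;1]; [0;-1;0;0;1]]; Ac 9 [[1]; [2;1;-1;1;-1;-1;1]; [0;1;0;0;-1]];
  Ac 2 [[-1;-1;0;0;1;0;1;1]; [0;0;1;0;-1;0;1]; [-3;-1;1;-1;1;1;1]]; Ac 2 [[-1];
  [0;0;1;0;-2;0;0;1]; [1;1;1;0;0;-1;1]]; Ac 2 [[-1]; [0;-2;1;-1;2;0;0;1]; [-1;1;0;0;-1;0;1]]; Ac
  2 [[1;1;2;0;-2;-1;1;1]; [2;0;-1;1;0;-1;1]; [-1;-1;-1;0;2;0;1]]]]; Br 3 (-1) [Ac 2 [[1];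
  [-1;1;0;0;1]; [0;0;1;0;2;1]]; Ac 1 [[1]; [0;0;2;-1;-1]; [0;0;3;-1;-1]]; Ac 1 [[1];
  [-2;1;2;-1;1]; [-2;1;3;-1;1]]; Ac 2 [[1]; [-1;1;0;0;1]; [1;0;-1;0;2;1]]; Br 2 0 []; Br 2 0 [Ac
  7 [[1]; [0;1;0;0;0;0;1]; [2;0;-1;0;2;1]]; Ac 7 [[1]; [0;1;0;0;0;0;1]; [1;0;1;0;-2;-1]]; Ac 7
  [[1]; [1;0;-2;1;-1;-1;1]; [2;0;-1;0;2;1]]; Ac 7 [[1]; [-1;1;2;-1;0;0;1]; [2;0;-1;0;2;1]]; Ac 2
  [[1]; [0;1;0;0;0;0;-1]; [-1;-1;3;-1;0;1;2]]; Ac 2 [[-1]; [0;-1;0;0;0;0;1];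
  [1;-1;-3;1;1;0;2]]]; Ac 2 [[1]; [-1;1;2;-1;1]; [0;0;1;-1;2;1]]; Ac 2 [[1]; [-2;1;3;-1;1];
  [-1;-1;1;0;2;1]]; Br 2 0 []; Br 2 0 []; Ac 2 [[1]; [1;0;-3;1;1]; [0;-1;-1;0;2;1]]]; Br 3 0 [Ac
  6 [[-1;0;1;0;1]; [1]; [0;-1;1]]; Br 7 4 []; Ac 10 [[1]; [5;-2;5;-2;-3;1]; [2;-1;2;-1;-1]]; Ac
  10 [[1]; [2;-1;-5;2;-3;1]; [1;-1;0;0;-1]]; Br 7 4 []; Ac 6 [[0;1;-1;0;1]; [1]; [0;-1;1]]; Br 9
  (-3) []; Br 6 3 [Ac 3 [[-1]; [-2;-1;2;0;0;1;1]; [0;1;-1;0;-1]]; Ac 3 [[-1]; [-1;0;0;0;-1;0;1];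
  [0;1;-1;0;-1]]]; Ac 10 [[1]; [2;-1;8;-3;-3;1]; [1;-1;3;-1;-1]]; Br 7 4 []; Br 21 (-8) [Ac 2
  [[-4;1;-4;2;0;0;1]; [5;-3;7;-2;0;0;0;1]; [-4;1;-5;2;0;0;1]]; Ac 2 [[-4;1;-4;2;0;0;1];
  [5;-3;7;-2;0;0;0;1]; [-4;1;-5;2;0;0;1]]; Ac 2 [[-1]; [-1;0;5;-2;0;0;1]; [-1;0;1]]; Ac 2
  [[-1;1;4;-2;0;0;1]; [1;0;-1]; [4;1;-9;2;0;1;0;1]]; Ac 7 [[-1]; [-1;-1;1]; [-5;0;-3;2;-3;0;1]];
  Ac 7 [[1]; [1;1;-1]; [-3;-1;-1;2;1;-1;1]]; Ac 7 [[1]; [1;1;-1]; [0;2;-7;2;0;1;1]]; Ac 7 [[1];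
  [1;1;-1]; [-4;-1;-3;3;0;-1;1]]; Ac 7 [[1]; [0;0;1]; [5;2;3;-3;0;1;1]]; Ac 7 [[1]; [1;1;-1];
  [2;0;5;-2;2;0;1]]; Ac 7 [[1]; [0;0;1]; [4;2;1;-2;-1;1;1]]; Ac 7 [[1]; [1;1;-1];
  [3;1;3;-2;3;0;1]]; Ac 10 [[-1]; [-2;2;-7;2;-1;1;1]; [-2;3;-8;2;0;1;1]]; Ac 10 [[1];
  [-4;0;-3;2;1;-1;1]; [-5;-1;-4;3;0;-1;1]]; Ac 10 [[-1]; [1;1;3;-2;-1;1;1]; [2;2;4;-3;0;1;1]];
  Ac 10 [[-1]; [0;0;5;-2;0;0;1]; [1;1;6;-3;1;0;1]]; Ac 2 [[1]; [-2;1;-5;2;0;0;1]; [0;-1;1]]; Ac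
  2 [[-2;1;-6;2;0;0;1]; [1;0;-1]; [4;0;7;-4;0;1;0;1]]; Ac 2 [[0;-1;6;-2;-1;0;1]; [1;0;-1];
  [-4;0;-9;4;0;0;0;1]]; Ac 2 [[1]; [2;0;7;-3;1;0;1]; [0;-1;1]]]; Ac 2 [[1]; [1;1;-1;0;-1];
  [0;-1;1]]; Br 9 (-3) []; Br 7 4 []; Br 7 4 []; Br 7 4 []; Br 7 4 []; Br 9 (-3) []; Ac 2 [[1];
  [0;0;1;0;-1]; [1;0;-1]]; Ac 1 [[-2;0;-2;1;1]; [1]; [-2;-1;-1;1;1]]; Br 7 4 []; Br 7 4 [Ac 1
  [[-1;-1;0;0;1;1;1]; [1]; [0;-1;-1;0;1;1;1]]; Ac 1 [[-1;-1;0;0;1;1;-1]; [1];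
  [-1;-2;1;0;1;1;-1]]; Ac 1 [[1;1;0;-1;1;0;1]; [1]; [2;1;-1;-1;1;0;1]]; Ac 1 [[3;1;0;-1;-1;0;1];
  [-1]; [3;2;-1;-1;-1;0;1]]; Ac 1 [[2;2;-2;0;0;0;-1]; [1]; [2;1;-1;0;0;0;-1]]; Ac 1
  [[-2;-2;2;0;0;0;1]; [1]; [-1;-2;1;0;0;0;1]]; Ac 1 [[0;0;-2;0;0;0;1]; [1]; [1;0;-1]]; Ac 1
  [[0;0;-2;0;0;0;1]; [1]; [0;-1;-1;0;0;0;1]]]; Br 7 4 []; Ac 1 [[0;0;2;-1;1]; [1]; [0;-1;1]]; Ac
  2 [[1]; [2;1;-1;0;-1]; [1;0;-1]]; Ac 2 [[1]; [1;0;1;0;-1]; [0;-1;1]]; Ac 2 [[1];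
  [1;1;2;-1;-1]; [0;-1;1]]; Br 6 3 [Ac 7 [[1]; [1;1;-1]; [-2;-2;2;1;0;0;1]]; Ac 7 [[1];
  [1;1;-1]; [-2;-1;-2;1;1;1;1]]; Ac 2 [[2;2;-1;-1;0;0;-1]; [0;1;-1;0;-1]; [2;2;0;-1;0;0;-1]]; Ac
  2 [[-3;-1;-1;1;1;1;-1]; [0;-1;1;0;1]; [-3;-1;-2;1;1;1;-1]]; Ac 2 [[3;2;1;-1;-1;-1;-1];
  [1;0;-1]; [-1;-1;1;0;1]]; Ac 2 [[2;1;-1;-1;0;0;1]; [1;0;-1]; [-1;-1;1;0;1]]; Ac 7 [[1];
  [0;0;1]; [2;-1;2;-1;1;0;1]]; Ac 7 [[-1]; [-1;-1;1]; [2;2;0;-1;-2;-1;1]]; Ac 7 [[1]; [0;0;1];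
  [3;0;0;-1;1;0;1]]; Ac 7 [[1]; [0;0;1]; [6;3;-2;-1;-2;-1;1]]; Ac 7 [[1]; [1;1;-1];
  [-1;-2;0;1;0;0;1]]; Ac 7 [[1]; [0;0;1]; [3;0;0;-1;0;0;1]]]; Br 9 (-3) []; Br 6 3 [Ac 7 [[1];
  [0;0;1]; [0;-1;2;-1;1;1;1]]; Ac 7 [[1]; [0;0;1]; [4;2;-2;-1;0;0;1]]; Ac 2 [[-2;-2;1;1;0;0;1];
  [0;0;1;0;-1]; [-2;-2;0;1;0;0;1]]; Ac 2 [[-1;-1;1;-1;1;1;1]; [1;0;-1]; [-1;0;1;0;-1]]; Ac 2
  [[1;0;-1;1;-1;-1;1]; [-1;0;1]; [1;0;-1;0;1]]; Ac 2 [[3;1;-1;-1;0;0;1]; [0;1;-1];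
  [0;0;1;0;-1]]; Ac 7 [[1]; [0;0;1]; [1;-1;0;-1;2;1;1]]; Ac 7 [[-1]; [-1;-1;1];
  [-1;0;2;-1;-1;0;1]]; Ac 7 [[-1]; [-1;-1;1]; [-1;0;-2;-1;2;1;1]]; Ac 7 [[-1]; [-1;-1;1];
  [0;1;0;-1;-1;0;1]]; Ac 7 [[1]; [0;0;1]; [1;-1;0;-1;1;1;1]]; Ac 7 [[1]; [1;1;-1];
  [1;-1;0;1;-1;-1;1]]]; Ac 2 [[1]; [-1;1;-2;1;-1]; [1;0;-1]]]]].

(** Overlattices occur only for the last six forms and contain one of the first three; the order of
    [forms17] is chosen accordingly. *)
Definition over17 : list (list (Z * list cert)) :=
  [[(2, []); (2, []); (2, [])]; [(2, []); (2, []); (2, [])]; [(2, []); (2, [])]; [(2, []); (2,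
  []); (13, [])]; [(2, []); (2, []); (13, [])]; [(2, [Ac 1 [[0;0;-1]; [-1];
  [-1;0;-2;-1;0;0;1]]]); (2, [Ac 1 [[0;0;-1]; [-1]; [-1;0;-2;-1;0;0;1]]]); (2, [Ac 1 [[0;0;-1];
  [-1]; [-1;0;-2;-1;0;0;1]]]); (2, [Ac 1 [[0;0;-1]; [-1]; [-1;0;-2;-1;0;0;1]]]); (2, [Ac 1
  [[0;0;-1]; [-1]; [-1;0;-2;-1;0;0;1]]])]; [(2, [Ac 0 [[0;0;1]; [-1]; [0;-1;2;-1;-1;0;1]]]); (2,
  [Ac 0 [[0;0;1]; [-1]; [0;-1;2;-1;-1;0;1]]]); (2, [Ac 0 [[0;0;1]; [-1]; [0;-1;2;-1;-1;0;1]]]);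
  (2, [Ac 0 [[0;0;1]; [-1]; [0;-1;2;-1;-1;0;1]]]); (2, [Ac 0 [[0;0;1]; [-1];
  [0;-1;2;-1;-1;0;1]]])]; [(2, [Ac 2 [[1]; [-3;1;-1;0;1;-1;1]; [0;-1;1]]]); (2, [Ac 2 [[1];
  [-3;1;-1;0;1;-1;1]; [0;-1;1]]]); (2, [Ac 2 [[1]; [-3;1;-1;0;1;-1;1]; [0;-1;1]]]); (2, [Ac 2
  [[1]; [-3;1;-1;0;1;-1;1]; [0;-1;1]]])]; [(2, [Ac 2 [[1]; [-1;1;1]; [-2;-1;0;-1;1;0;1]]]); (2,
  [Ac 2 [[1]; [-1;1;1]; [-2;-1;0;-1;1;0;1]]]); (2, [Ac 2 [[1]; [-1;1;1]; [-2;-1;0;-1;1;0;1]]]);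
  (2, [Ac 2 [[1]; [-1;1;1]; [-2;-1;0;-1;1;0;1]]])]; [(2, [Ac 2 [[1;-1;-3;1;1;-1;1];
  [-1;0;2;-1;-2;0;1]; [2;-1;-5;2;2;-1]]; Ac 2 [[-1]; [-2;0;5;-2;-2;1]; [-2;0;1;-1;-1;0;1]]]);
  (2, [Ac 2 [[1;-1;-3;1;1;-1;1]; [-1;0;2;-1;-2;0;1]; [2;-1;-5;2;2;-1]]; Ac 2 [[-1];
  [-2;0;5;-2;-2;1]; [-2;0;1;-1;-1;0;1]]]); (2, [Ac 2 [[1;-1;-3;1;1;-1;1]; [-1;0;2;-1;-2;0;1];
  [2;-1;-5;2;2;-1]]; Ac 2 [[-1]; [-2;0;5;-2;-2;1]; [-2;0;1;-1;-1;0;1]]]); (2, [Ac 2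
  [[1;-1;-3;1;1;-1;1]; [-1;0;2;-1;-2;0;1]; [2;-1;-5;2;2;-1]]; Ac 2 [[-1]; [-2;0;5;-2;-2;1];
  [-2;0;1;-1;-1;0;1]]])]; [(2, [Ac 2 [[1]; [-1;0;1;1;0;-1;1]; [-1;-1;3;2;-1;-1]]; Ac 2 [[1];
  [1;0;-1;-1;0;0;1]; [2;0;-3;-2;1;1]]]); (2, [Ac 2 [[1]; [-1;0;1;1;0;-1;1]; [-1;-1;3;2;-1;-1]];
  Ac 2 [[1]; [1;0;-1;-1;0;0;1]; [2;0;-3;-2;1;1]]]); (2, [Ac 2 [[1]; [-1;0;1;1;0;-1;1];
  [-1;-1;3;2;-1;-1]]; Ac 2 [[1]; [1;0;-1;-1;0;0;1]; [2;0;-3;-2;1;1]]]); (2, [Ac 2 [[1];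
  [-1;0;1;1;0;-1;1]; [-1;-1;3;2;-1;-1]]; Ac 2 [[1]; [1;0;-1;-1;0;0;1]; [2;0;-3;-2;1;1]]])]].

Definition forms21 : list kform :=
  let f1 := KForm (1, 0) (1, 0) (2, 1) (0, 0) (0, 0) (-1, -1) in
  [f1; kform_map (kmul (omega_tr 21) (omega_nm 21) (2, 1)) f1].

Definition cert21 : cert :=
  Br 1 0 [Br 2 1 [Br 4 1 [Ac 1 [[0;0;1]; [-1;0;1;0;1]; [-1;0;-1;-1;-1;-1]]; Br 2 0 [Ac 1
  [[-1;1;1;0;1;0;1]; [0;1;1;0;0;0;1]; [-2;-1]]; Ac 1 [[-1;1;0;0;1;0;1]; [-1;0;0;0;0;0;1];
  [2;1]]; Ac 1 [[-1;0;0;1;1;0;1;1]; [0;0;-1]; [-1;-1;-2;2;0;0;0;1]]; Ac 1 [[-1;0;1;-1;1;0;1;1];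
  [0;0;-1]; [1;0;3;-1;0;0;0;1]]; Ac 1 [[-3;0;-2;1;1;0;0;1]; [0;0;1]; [1;0;1;-1;0;0;1]]; Ac 1
  [[-3;0;3;-1;1;0;0;1]; [0;0;1]; [-1;-1;-2;0;0;0;1]]]; Br 2 0 []; Br 2 0 [Ac 1
  [[-1;1;0;0;1;0;1]; [0;1;1;0;0;0;1]; [-2;-1]]; Ac 1 [[-1;1;-1;0;1;0;1]; [-1;0;0;0;0;0;1];
  [2;1]]; Ac 1 [[-1;0;-1;1;1;0;1;1]; [0;0;-1]; [-1;-1;-2;2;0;0;0;1]]; Ac 1 [[-1;0;0;-1;1;0;1;1];
  [0;0;-1]; [1;0;3;-1;0;0;0;1]]; Ac 1 [[-3;0;-3;1;1;0;0;1]; [0;0;1]; [1;0;1;-1;0;0;1]]; Ac 1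
  [[-3;0;2;-1;1;0;0;1]; [0;0;1]; [-1;-1;-2;0;0;0;1]]]; Ac 1 [[0;0;1]; [-1;0;-1;0;1];
  [-1;0;1;1;-1;-1]]; Br 5 (-1) []; Br 2 0 []; Br 2 0 []; Br 2 0 []; Br 2 0 []; Br 2 0 []; Br 7
  (-2) []; Br 6 (-2) [Ac 1 [[0;0;1]; [1;0;-1;1;1;0;1;1]; [1;0;-3;0;-1;-1;1;1]]; Ac 1 [[0;0;1];
  [-3;1;8;-2;2;0;2]; [-3;1;6;-3;0;-1;2]]; Ac 1 [[0;0;1]; [1;0;3;-1;1;0;1;1];
  [1;0;1;-2;-1;-1;1;1]]; Ac 1 [[0;0;1]; [-3;1;-4;2;2;0;2]; [-3;1;-6;1;0;-1;2]]; Ac 1 [[0;0;1];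
  [-1;1;-3;0;-3;0;0;-1]; [-3;0;-1;1;-1;1;0;-1]]; Ac 1 [[0;0;1]; [-4;1;3;0;3;0;0;-1];
  [-4;1;1;-1;1;-1;0;-1]]; Ac 1 [[0;0;1]; [-2;0;-1;0;-1;0;1]; [-3;1;0;1;0;1;2]]; Ac 1 [[0;0;1];
  [2;-1;-1;0;-1;0;-1]; [1;-1;1;1;1;1;1;1]]; Ac 1 [[0;0;1]; [0;1;6;-3;1;-1;0;1];
  [-1;-1;-3;2;0;1;1]]; Ac 1 [[0;0;1]; [0;1;-4;1;1;-1;0;-1]; [-1;-1;3;0;0;1;-1]]; Ac 1 [[0;0;1];
  [1;0;-2;1;-2;1;0;-1]; [1;0;-4;0;-4;0;0;-1]]; Ac 1 [[0;0;1]; [1;-1;-2;1;-2;1;0;1];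
  [1;-1;-4;0;-4;0;0;1]]]; Br 2 0 []; Br 2 0 [Ac 1 [[2;0;2;0;1;0;0;1]; [0;1;1;0;0;0;1]; [-2;-1]];
  Ac 1 [[2;0;2;-1;1;0;0;1]; [-1;0;0;0;0;0;1]; [2;1]]; Ac 1 [[-1;0;4;-1;1;0;1]; [0;0;-1];
  [-1;-1;-2;2;0;0;0;1]]; Ac 1 [[-1;0;0;0;1;0;1]; [0;0;-1]; [1;0;3;-1;0;0;0;1]]; Ac 1
  [[-3;-1;1;0;1;0;1;1]; [0;0;1]; [1;0;1;-1;0;0;1]]; Ac 1 [[-3;-1;3;-1;1;0;1;1]; [0;0;1];
  [-1;-1;-2;0;0;0;1]]]; Br 2 0 []; Br 5 (-1) []; Br 2 0 []; Br 2 0 []; Br 2 0 []; Br 5 (-1) [];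
  Br 2 0 []; Br 2 0 [Ac 1 [[2;0;-2;1;1;0;0;1]; [0;1;1;0;0;0;1]; [-2;-1]]; Ac 1
  [[2;0;-2;0;1;0;0;1]; [-1;0;0;0;0;0;1]; [2;1]]; Ac 1 [[-1;0;0;0;1;0;1]; [0;0;-1];
  [-1;-1;-2;2;0;0;0;1]]; Ac 1 [[-1;0;-4;1;1;0;1]; [0;0;-1]; [1;0;3;-1;0;0;0;1]]; Ac 1
  [[-3;-1;-3;1;1;0;1;1]; [0;0;1]; [1;0;1;-1;0;0;1]]; Ac 1 [[-3;-1;-1;0;1;0;1;1]; [0;0;1];
  [-1;-1;-2;0;0;0;1]]]; Br 2 0 []; Br 6 (-2) [Ac 1 [[0;0;1]; [1;0;-3;1;1;0;1;1];
  [1;0;-1;2;-1;-1;1;1]]; Ac 1 [[0;0;1]; [-3;1;4;-2;2;0;2]; [-3;1;6;-1;0;-1;2]]; Ac 1 [[0;0;1];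
  [1;0;1;-1;1;0;1;1]; [1;0;3;0;-1;-1;1;1]]; Ac 1 [[0;0;1]; [-3;1;-8;2;2;0;2];
  [-3;1;-6;3;0;-1;2]]; Ac 1 [[0;0;1]; [-1;1;3;0;-3;0;0;-1]; [-3;0;1;-1;-1;1;0;-1]]; Ac 1
  [[0;0;1]; [-4;1;-3;0;3;0;0;-1]; [-4;1;-1;1;1;-1;0;-1]]; Ac 1 [[0;0;1]; [1;-1;-1;0;1;0;-1];
  [2;0;1;1;-1;-1;1;1]]; Ac 1 [[0;0;1]; [-3;0;-1;0;1;0;1]; [-3;2;0;1;0;-1;2]]; Ac 1 [[0;0;1];
  [0;1;4;-1;1;-1;0;1]; [-1;-1;-3;0;0;1;1]]; Ac 1 [[0;0;1]; [0;1;-6;3;1;-1;0;-1];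
  [-1;-1;3;-2;0;1;-1]]; Ac 1 [[0;0;1]; [1;0;2;-1;-2;1;0;-1]; [1;0;4;0;-4;0;0;-1]]; Ac 1
  [[0;0;1]; [1;-1;2;-1;-2;1;0;1]; [1;-1;4;0;-4;0;0;1]]]; Br 6 (-2) [Ac 0 [[-1;0;1;0;1];
  [2;-1;6;-2;0;0;0;1]; [-1;1;-2;1;0;0;1]]; Ac 0 [[-1;0;1;0;1]; [3;-1;-4;1;0;0;0;1];
  [-2;0;3;-1;0;0;1]]; Ac 0 [[-1;0;1;0;1]; [0;-1;-2;1;0;0;1;1]; [3;-1;-3;1;0;0;0;1]]; Ac 0
  [[-1;0;1;0;1]; [1;-1;0;0;0;0;1;1]; [2;-2;2;-1;0;0;0;1]]; Ac 0 [[1]; [0;0;-3;1;0;0;1];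
  [0;0;1]]; Ac 0 [[1]; [0;0;-3;1;0;0;1]; [0;0;1]]; Ac 0 [[-1]; [-1;0;1;0;1];
  [-2;2;5;-3;2;-2;0;1]]; Ac 0 [[-1]; [-1;0;1;0;1]; [3;-1;-1;0;-3;1;0;1]]; Ac 0 [[-1];
  [-3;1;-3;1;3;-1;0;1]; [2;0;0;-1;-2;0;1]]; Ac 0 [[-1]; [2;-1;-6;2;-2;1;0;1];
  [-1;1;4;-2;1;-1;1]]; Ac 0 [[-1;0;1;0;1]; [0;0;-3;1;0;0;1]; [0;0;1]]; Ac 0 [[-1;0;1;0;1];
  [-1;0;5;-2;0;0;1]; [0;0;1]]]; Br 6 (-2) [Ac 0 [[-1]; [0;0;-3;1;0;0;1]; [0;0;1]]; Ac 0 [[1];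
  [0;0;-3;1;0;0;1]; [0;0;1]]; Ac 0 [[1]; [2;-1;3;-1;-2;1;1]; [0;0;1]]; Ac 0 [[1];
  [2;-1;6;-2;-2;1;-1]; [0;0;1]]; Ac 0 [[-1]; [3;-1;10;-4;-3;1;2]; [0;0;1]]; Ac 0 [[-1];
  [3;-1;0;0;-3;1;-2]; [-4;1;1;0;4;-1;2]]]; Br 2 0 []; Br 2 0 []; Ac 0 [[1]; [3;-1;-6;2;-3;1];
  [0;0;1]]; Br 5 (-1) [Br 2 0 []]; Ac 0 [[1]; [3;-1;8;-3;-3;1]; [0;0;1]]; Br 2 0 []; Br 2 0 [];
  Br 6 (-2) [Ac 0 [[1]; [0;0;-3;1;0;0;1]; [0;0;1]]; Ac 0 [[1]; [0;0;-3;1;0;0;1]; [0;0;1]]; Ac 0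
  [[1]; [2;-1;-4;1;-2;1;1]; [0;0;1]]; Ac 0 [[1]; [2;-1;-1;0;-2;1;-1]; [0;0;1]]; Ac 0 [[-1];
  [3;-1;0;0;-3;1;2]; [-4;1;-1;0;4;-1;-2]]; Ac 0 [[-1]; [3;-1;-8;3;-3;1;-2]; [0;0;1]]]; Br 6 (-2)
  [Ac 0 [[-1;0;-1;0;1]; [2;-1;6;-2;0;0;0;1]; [-1;1;-2;1;0;0;1]]; Ac 0 [[-1;0;-1;0;1];
  [3;-1;-4;1;0;0;0;1]; [-2;0;3;-1;0;0;1]]; Ac 0 [[-1;0;-1;0;1]; [0;-1;-2;1;0;0;1;1];
  [3;-1;-3;1;0;0;0;1]]; Ac 0 [[-1;0;-1;0;1]; [1;-1;0;0;0;0;1;1]; [2;-2;2;-1;0;0;0;1]]; Ac 0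
  [[1]; [0;0;-3;1;0;0;1]; [0;0;1]]; Ac 0 [[1]; [0;0;-3;1;0;0;1]; [0;0;1]]; Ac 0 [[-1];
  [-1;0;-1;0;1]; [-2;2;1;1;2;-2;0;1]]; Ac 0 [[-1]; [0;-1;0;-1;0;1;1;1]; [0;0;-1]]; Ac 0 [[1];
  [-2;1;-6;2;2;-1;0;1]; [1;-1;4;-2;-1;1;1]]; Ac 0 [[1]; [3;-1;-3;1;-3;1;0;1];
  [-2;0;0;-1;2;0;1]]; Ac 0 [[-1;0;-1;0;1]; [0;0;-3;1;0;0;1]; [0;0;1]]; Ac 0 [[-1;0;-1;0;1];
  [-1;0;5;-2;0;0;1]; [0;0;1]]]; Ac 1 [[0;0;1]; [-3;-2;2;1;2;1]; [11;6;-7;-4;-7;-4]]; Br 6 (-2)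
  [Ac 0 [[1;-1;2;0;1;0;1;1]; [2;-1;6;-2;0;0;0;1]; [-1;1;-2;1;0;0;1]]; Ac 0 [[1;-1;-3;1;1;0;1;1];
  [3;-1;-4;1;0;0;0;1]; [-2;0;3;-1;0;0;1]]; Ac 0 [[-2;0;1;0;1;0;1]; [0;-1;-2;1;0;0;1;1];
  [3;-1;-3;1;0;0;0;1]]; Ac 0 [[-2;0;-2;1;1;0;1]; [1;-1;0;0;0;0;1;1]; [2;-2;2;-1;0;0;0;1]]; Ac 0
  [[0;-1;7;-2;1;0;0;1]; [0;0;-3;1;0;0;1]; [0;0;1]]; Ac 0 [[0;-1;-8;3;1;0;0;1];
  [-1;0;5;-2;0;0;1]; [0;0;1]]]; Br 2 0 []; Br 2 0 []; Br 2 0 [Ac 1 [[2;0;2;0;1;0;1;1];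
  [0;1;1;0;0;0;1]; [-2;-1]]; Ac 1 [[2;0;1;-1;1;0;1;1]; [-1;0;0;0;0;0;1]; [2;1]]; Ac 1
  [[0;-1;-1;1;1;0;0;1]; [0;0;-1]; [-1;-1;-2;2;0;0;0;1]]; Ac 1 [[0;-1;4;-2;1;0;0;1]; [0;0;-1];
  [1;0;3;-1;0;0;0;1]]; Ac 1 [[0;-1;3;-1;1;0;1]; [0;0;1]; [1;0;1;-1;0;0;1]]; Ac 1
  [[0;-1;0;0;1;0;1]; [0;0;1]; [-1;-1;-2;0;0;0;1]]]; Br 2 0 []; Br 2 0 [Ac 1 [[2;0;-1;1;1;0;1;1];
  [0;1;1;0;0;0;1]; [-2;-1]]; Ac 1 [[2;0;-2;0;1;0;1;1]; [-1;0;0;0;0;0;1]; [2;1]]; Ac 1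
  [[0;-1;-4;2;1;0;0;1]; [0;0;-1]; [-1;-1;-2;2;0;0;0;1]]; Ac 1 [[0;-1;1;-1;1;0;0;1]; [0;0;-1];
  [1;0;3;-1;0;0;0;1]]; Ac 1 [[0;-1;0;0;1;0;1]; [0;0;1]; [1;0;1;-1;0;0;1]]; Ac 1
  [[0;-1;-3;1;1;0;1]; [0;0;1]; [-1;-1;-2;0;0;0;1]]]; Br 2 0 []; Br 2 0 []; Br 6 (-2) [Ac 0
  [[1;-1;3;-1;1;0;1;1]; [2;-1;6;-2;0;0;0;1]; [-1;1;-2;1;0;0;1]]; Ac 0 [[1;-1;-2;0;1;0;1;1];
  [3;-1;-4;1;0;0;0;1]; [-2;0;3;-1;0;0;1]]; Ac 0 [[-2;0;2;-1;1;0;1]; [0;-1;-2;1;0;0;1;1];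
  [3;-1;-3;1;0;0;0;1]]; Ac 0 [[-2;0;-1;0;1;0;1]; [1;-1;0;0;0;0;1;1]; [2;-2;2;-1;0;0;0;1]]; Ac 0
  [[0;-1;8;-3;1;0;0;1]; [0;0;-3;1;0;0;1]; [0;0;1]]; Ac 0 [[0;-1;-7;2;1;0;0;1];
  [-1;0;5;-2;0;0;1]; [0;0;1]]]; Ac 1 [[0;0;1]; [-3;-2;-2;-1;2;1]; [11;6;7;4;-7;-4]]; Br 2 0 [];
  Br 7 (-2) []; Br 2 0 []; Br 2 0 []; Br 2 0 []; Br 2 0 []; Br 2 0 []; Br 7 (-2) []; Br 2 0 [];
  Br 2 0 []; Br 6 (-2) [Ac 0 [[0;-1;4;-1;1;0;1;1]; [2;-1;6;-2;0;0;0;1]; [-1;1;-2;1;0;0;1]]; Ac 0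
  [[0;-1;-1;0;1;0;1;1]; [3;-1;-4;1;0;0;0;1]; [-2;0;3;-1;0;0;1]]; Ac 0 [[-3;0;3;-1;1;0;1];
  [0;-1;-2;1;0;0;1;1]; [3;-1;-3;1;0;0;0;1]]; Ac 0 [[-3;0;0;0;1;0;1]; [1;-1;0;0;0;0;1;1];
  [2;-2;2;-1;0;0;0;1]]; Ac 0 [[-1;-1;9;-3;1;0;0;1]; [0;0;-3;1;0;0;1]; [0;0;1]]; Ac 0
  [[-1;-1;-6;2;1;0;0;1]; [-1;0;5;-2;0;0;1]; [0;0;1]]]; Br 2 0 []; Br 6 (-2) [Ac 0
  [[0;-1;1;0;1;0;1;1]; [2;-1;6;-2;0;0;0;1]; [-1;1;-2;1;0;0;1]]; Ac 0 [[0;-1;-4;1;1;0;1;1];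
  [3;-1;-4;1;0;0;0;1]; [-2;0;3;-1;0;0;1]]; Ac 0 [[-3;0;0;0;1;0;1]; [0;-1;-2;1;0;0;1;1];
  [3;-1;-3;1;0;0;0;1]]; Ac 0 [[-3;0;-3;1;1;0;1]; [1;-1;0;0;0;0;1;1]; [2;-2;2;-1;0;0;0;1]]; Ac 0
  [[-1;-1;6;-2;1;0;0;1]; [0;0;-3;1;0;0;1]; [0;0;1]]; Ac 0 [[-1;-1;-9;3;1;0;0;1];
  [-1;0;5;-2;0;0;1]; [0;0;1]]]; Br 2 0 []]; Br 4 1 [Ac 1 [[-1;0;1;0;1]; [-1;-1;1]; [4;2;-1;-1]];
  Ac 1 [[0;1;-1;0;1]; [-1;-1;1]; [4;2;-1;-1]]; Br 5 (-1) []; Br 7 (-2) []; Ac 1 [[0;-1;4;-1;1];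
  [-1;-1;1]; [4;2;-1;-1]]; Br 5 (-1) []; Br 5 (-1) []; Ac 1 [[-1;1;-4;1;1]; [-1;-1;1];
  [4;2;-1;-1]]; Ac 0 [[-2;-1;2;0;1]; [1]; [-1;-1;1]]; Br 5 (-1) []; Ac 0 [[0;1;-2;0;1]; [1];
  [-1;-1;1]]; Ac 0 [[-2;-1;-1;1;1]; [1]; [-1;-1;1]]; Ac 1 [[1;-1;3;-1;1]; [-1;-1;1];
  [4;2;-1;-1]]; Ac 1 [[-1;0;-3;1;1]; [-1;-1;1]; [4;2;-1;-1]]; Ac 0 [[2;0;1;-1;1]; [1];
  [-1;-1;1]]; Br 7 (-2) []; Br 7 (-2) []; Ac 0 [[0;-1;3;-1;1]; [1]; [-1;-1;1]]; Ac 0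
  [[-2;0;-3;1;1]; [1]; [-1;-1;1]]]]].

Definition over21 : list (list (Z * list cert)) :=
  [[(2, []); (2, [])]; [(2, []); (2, [])]].

(** Here $\varepsilon_{33}=23+4\sqrt{33}=19+8\omega$. *)
Definition forms33 : list kform :=
  let f1 := KForm (1, 0) (1, 0) (38, 16) (0, 0) (7, 3) (2, 1) in
  [f1; kform_map (kmul (omega_tr 33) (omega_nm 33) (19, 8)) f1].

Definition cert33 : cert :=
  Br 1 0 [Br 2 0 [Br 19 8 [Br 14 (-4) []; Br 5 2 [Br 13 5 []]; Br 7 (-2) []; Br 7 (-2) [Br 18
  (-5) []]; Br 14 (-4) []]; Br 19 8 [Br 7 (-2) []; Br 5 2 [Ac 1 [[0;0;-2;-1;4;-1;1];
  [0;0;0;0;1]; [0;0;-19;-8;2;1]]; Ac 1 [[0;0;-2;-1;0;0;1]; [0;0;0;0;1]; [19;8;-19;-8;2;1]]; Ac 1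
  [[-1;0;-1;-1;7;-2;1]; [0;0;0;0;1]; [19;8;-19;-8;2;1]]; Ac 1 [[0;0;-3;-1;-3;1;1]; [0;0;0;0;-1];
  [0;0;-19;-8]]]; Br 14 (-4) []; Br 7 (-2) [Ac 1 [[0;0;0;0;-1]; [-5;-1;7;3;7;-3;1];
  [0;0;19;8;-7;-3]]; Ac 1 [[0;0;0;0;-1]; [-5;-1;7;3;-10;2;1]; [0;0;19;8;-7;-3]]; Ac 1
  [[0;0;0;0;-1]; [-5;-1;6;3;-3;0;1]; [0;0;19;8;-7;-3]]; Ac 1 [[0;0;0;0;1]; [-6;-1;8;3;0;-1;1];
  [-19;-8;19;8]]]; Br 14 (-4) []]; Br 19 8 [Br 14 (-4) [Ac 0 [[1;0;-1]; [1];
  [5;2;-5;-1;14;-4;1]]; Ac 0 [[1;0;-1]; [1]; [5;2;-5;-1;-14;4;1]]; Ac 0 [[1;0;-1]; [1];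
  [2;3;-2;-2;14;-4;1]]; Ac 0 [[1;0;-1]; [1]; [2;3;-2;-2;-14;4;1]]; Ac 0 [[-1]; [1;0;-1];
  [-3;-1;-2;0;13;-4;1]]; Ac 0 [[-1]; [1;0;-1]; [-3;-1;-2;0;-13;4;1]]; Ac 0 [[-1]; [-1;0;1];
  [-7;-1;2;0;13;-4;1]]; Ac 0 [[-1]; [-1;0;1]; [-7;-1;2;0;-13;4;1]]]; Br 14 (-4) []]]].

Definition over33 : list (list (Z * list cert)) :=
  [[(2, []); (2, [])]; [(2, []); (2, [])]].

Definition forms41 : list kform :=
  let f1 := KForm (1, 0) (4, 0) (15, -4) (3, 0) (4, -1) (0, 0) in
  [f1].

Definition cert41 : cert :=
  Br 1 0 [Br 3 1 [Br 4 (-1) [Br 3 0 []; Br 2 0 []; Br 2 0 []; Br 5 (-1) []; Br 2 0 []; Br 5 (-1)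
  []]; Br 4 (-1) [Br 2 0 []; Br 4 1 []; Ac 0 [[-1]; [-5;0;4;-1;3;1]; [4;-1;-11;3;-1]]; Ac 0
  [[-1]; [-1;-1;-4;1;3;1]; [-7;2;11;-3;-1]]]]].

Definition over41 : list (list (Z * list cert)) :=
  [[(2, []); (2, [])]].

Definition form65 : kform := KForm (1, 0) (2, 0) (4, 0) (1, 0) (2, 0) (2, -1).
(** The third column of the Gram matrix times $(1+\omega)/2$; note $(1+\omega)(2-\omega)=-14$. *)
Definition extra65 : vec3 := ((1, 1), (-7, 0), (4, 4)).

Definition cert65 : cert :=
  Br 1 0 [Br 2 0 [Br 4 1 [Br 14 (-3) []; Br 5 (-1) []; Br 23 (-5) []; Br 5 (-1) []; Br 5 (-1)
  []; Br 5 (-1) [Ac 0 [[1]; [-10;2;5;-1;18;-4;3]; [-10;2;5;-1;19;-4;3]; [2;0;-1;0;-3;1]]; Ac 0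
  [[1]; [-7;2;5;-1;18;-4;-3]; [-7;2;5;-1;19;-4;-3]; [2;0;-1;0;-3;1]]]; Br 5 (-1) []; Br 5 (-1)
  [Ac 0 [[1]; [-7;2;-5;1;18;-4;-3]; [-7;2;-5;1;19;-4;-3]; [2;0;1;0;-3;1]]; Ac 0 [[1];
  [-10;2;-5;1;18;-4;3]; [-10;2;-5;1;19;-4;3]; [2;0;1;0;-3;1]]]; Br 5 (-1) []]; Br 4 1 [Br 3 0
  []; Br 5 (-1) []; Br 14 (-3) []; Br 10 (-2) []; Br 5 (-1) [Ac 0 [[1]; [0;0;1]; [0;0;1;0;1];
  [-1;0;-1;1;3;0;1]]; Ac 0 [[-1]; [-1;0;1]; [-2;0;1;0;1]; [-1;-1;2;0;-2;1;1]]]; Br 5 (-1) []; Br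
  5 (-1) []; Br 5 (-1) [Ac 0 [[-1]; [0;0;-1]; [-1;0;-1;0;1]; [1;-1;-2;0;-2;1;1]]; Ac 0 [[-1];
  [0;0;-1]; [-1;0;-1;0;1]; [-3;0;1;-1;3;0;1]]]]; Br 4 1 [Br 3 0 []; Br 5 (-1) []]]].

Definition forms77 : list kform :=
  let f1 := KForm (1, 0) (1, 0) (8, 2) (0, 0) (0, 0) (3, 1) in
  [f1; kform_map (kmul (omega_tr 77) (omega_nm 77) (4, 1)) f1].

Definition cert77 : cert :=
  Br 1 0 [Br 8 2 [Br 4 1 [Br 2 0 [Br 11 (-1) []]; Br 15 (-3) [Ac 0 [[1]; [0;0;5;-1;0;0;-1];
  [0;0;1;0;-1]]; Ac 0 [[1]; [0;0;5;-1;-5;1;1]; [0;0;1;0;-1]]]; Br 2 0 [Ac 1 [[0;0;1;0;-1];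
  [0;0;0;0;1]; [-2;-1;0;0;11;-1;0;1]]; Ac 1 [[0;0;0;0;1]; [0;0;1;0;-1];
  [-2;-1;11;-1;-11;1;0;1]]; Ac 1 [[0;0;0;0;1]; [0;0;-1;0;1]; [2;0;-11;1;11;-1;0;1]]; Ac 1
  [[0;0;1;0;-1]; [0;0;0;0;-1]; [2;0;0;0;-11;1;0;1]]]]; Br 10 1 [Ac 1 [[-2;0;1;0;1]; [3;1;-2];
  [12;3;-3;-1]]; Ac 1 [[1;1;-1;0;1]; [3;1;-2]; [12;3;-3;-1]]; Br 11 (-1) []; Br 31 (-6) []; Br
  11 (-1) []; Br 11 (-1) []; Br 11 (-1) []; Br 11 (-1) []; Br 31 (-6) []; Br 11 (-1) []; Br 31
  (-6) []; Br 11 (-1) []; Br 11 (-1) []; Br 11 (-1) []; Br 11 (-1) []; Br 31 (-6) []; Br 11 (-1)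
  []; Br 31 (-6) []; Ac 0 [[-5;-1;-3;1;1]; [1]; [0;0;1]]; Ac 1 [[2;-1;5;-1;1]; [3;1;-2];
  [12;3;-3;-1]]; Ac 1 [[-2;0;-5;1;1]; [3;1;-2]; [12;3;-3;-1]]; Ac 0 [[5;0;3;-1;1]; [1];
  [0;0;1]]; Br 27 (-5) [Ac 0 [[-13;1;-18;4;1;0;1]; [-1]; [0;0;-1]]; Ac 0 [[-9;3;-20;4;-1;0;1];
  [1]; [0;0;1]]; Ac 0 [[8;-1;19;-4;0;0;1]; [1]; [0;0;1]]; Ac 0 [[8;-1;19;-4;0;0;1]; [-1];
  [0;0;-1]]]; Br 27 (-5) [Ac 0 [[-11;2;-19;4;0;0;1]; [-1]; [-3;-1;1]]; Ac 0
  [[-12;2;-18;4;-1;0;1]; [-1]; [-3;-1;1]]; Ac 0 [[9;-1;18;-4;1;0;1]; [-1]; [-3;-1;1]]; Ac 0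
  [[7;-1;20;-4;-1;0;1]; [-1]; [-3;-1;1]]]; Br 31 (-6) []]]].

Definition over77 : list (list (Z * list cert)) :=
  [[(2, []); (2, [])]; [(2, []); (2, [])]].

Lemma check6 : run (omega_tr 6) (omega_nm 6) (targets forms6) cert6 State0
  && over_closed (omega_tr 6) (omega_nm 6) [] (targets forms6) over6.
Proof. by vm_cast_no_check (erefl true). Qed.

Lemma check7 : run (omega_tr 7) (omega_nm 7) (targets forms7) cert7 State0
  && over_closed (omega_tr 7) (omega_nm 7) [] (targets forms7) over7.
Proof. by vm_cast_no_check (erefl true). Qed.

Lemma check13 : run (omega_tr 13) (omega_nm 13) (targets forms13) cert13 State0
  && over_closed (omega_tr 13) (omega_nm 13) [] (targets forms13) over13.
Proof. by vm_cast_no_check (erefl true). Qed.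

Lemma check17 : run (omega_tr 17) (omega_nm 17) (targets forms17) cert17 State0
  && over_closed (omega_tr 17) (omega_nm 17) [] (targets forms17) over17.
Proof. by vm_cast_no_check (erefl true). Qed.

Lemma check21 : run (omega_tr 21) (omega_nm 21) (targets forms21) cert21 State0
  && over_closed (omega_tr 21) (omega_nm 21) [] (targets forms21) over21.
Proof. by vm_cast_no_check (erefl true). Qed.

Lemma check33 : run (omega_tr 33) (omega_nm 33) (targets forms33) cert33 State0
  && over_closed (omega_tr 33) (omega_nm 33) [] (targets forms33) over33.
Proof. by vm_cast_no_check (erefl true). Qed.

Lemma check41 : run (omega_tr 41) (omega_nm 41) (targets forms41) cert41 State0
  && over_closed (omega_tr 41) (omega_nm 41) [] (targets forms41) over41.
Proof. by vm_cast_no_check (erefl true). Qed.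

Lemma check77 : run (omega_tr 77) (omega_nm 77) (targets forms77) cert77 State0
  && over_closed (omega_tr 77) (omega_nm 77) [] (targets forms77) over77.
Proof. by vm_cast_no_check (erefl true). Qed.

(** The Gram determinant of [form10] is 4. *)
Lemma check10 : run (omega_tr 10) (omega_nm 10)
    [(kform_gram form10, [extra10])] cert10 State0
  && (kdvd (omega_tr 10) (omega_nm 10)
        (gram_det (omega_tr 10) (omega_nm 10) (kform_gram form10)) (4, 0)
      && all (in_half_ideal 0 4)
           (over_residues (omega_tr 10) (omega_nm 10) (kform_gram form10) [extra10] 4)).
Proof. by vm_cast_no_check (erefl true). Qed.

(** The Gram determinant of [form65] is $8+2\omega$, of norm 16; the least positive integer it
    divides is 8. *)
Lemma check65 : run (omega_tr 65) (omega_nm 65)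
    [(kform_gram form65, [extra65])] cert65 State0
  && (kdvd (omega_tr 65) (omega_nm 65)
        (gram_det (omega_tr 65) (omega_nm 65) (kform_gram form65)) (8, 0)
      && all (in_half_ideal 1 8)
           (over_residues (omega_tr 65) (omega_nm 65) (kform_gram form65) [extra65] 8)).
Proof. by vm_cast_no_check (erefl true). Qed.

End Certificates.

(** * The classification *)

Lemma divmod4E D : (Z.of_nat D / 4)%BZ = Z.of_nat (D %/ 4)
  /\ (Z.of_nat D mod 4)%BZ = Z.of_nat (D %% 4).
Proof.
have e : Z.of_nat D = (4 * Z.of_nat (D %/ 4) + Z.of_nat (D %% 4))%BZ by lia.
have h : (0 <= Z.of_nat (D %% 4) < 4)%BZ by have := ltn_pmod D (isT : 0 < 4)%N; lia.
by rewrite -(Z.mod_unique _ _ _ _ (or_introl h) e) -(Z.div_unique _ _ _ _ (or_introl h) e).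
Qed.

Lemma modn4E D : (Z.of_nat D mod 4 =? 1)%BZ = (D %% 4 == 1)%N.
Proof.
have [_ ->] := divmod4E D.
by case: eqP => [->//|ne]; apply/Z.eqb_spec; lia.
Qed.

Lemma disc_trE D : disc_tr (Z.of_nat D) = omega_tr D.
Proof. by rewrite /disc_tr modn4E. Qed.

Lemma disc_nmE D : disc_nm (Z.of_nat D) = omega_nm D.
Proof. by have [e _] := divmod4E D; rewrite /disc_nm /omega_nm modn4E e. Qed.

Section Classification.

Variables (D : nat) (F : fieldExtType rat) (s : F).
Variables (V : vectType F) (Q : V -> F) (L : V -> Prop).
Hypotheses (D_gt1 : (1 < D)%N) (D_sqf : squarefree D).
Hypothesis F_eq : is_quadratic_field D s.
Hypothesis L_lat : quadratic_lattice 3 Q L.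
Hypothesis L_univ : universal Q L.

Lemma universal_listed : D \notin [:: 2; 3; 5]%N ->
  D \in [:: 6; 7; 10; 13; 17; 21; 33; 41; 65; 77]%N.
Proof.
move=> D_n235; have disc_le := discriminant_le D_gt1 D_sqf F_eq L_lat L_univ.
have D_le : (Z.of_nat D <= 1760)%BZ.
  by move: disc_le; rewrite /omega_tr /omega_nm; case: eqP; lia.
have D_in : Z.of_nat D \in zrange 2 1760 by apply: mem_zrange; lia.
have := allP all_excluded _ D_in; rewrite /excluded disc_trE disc_nmE.
case: Z.ltb_spec => [|_]; first by lia.
case: ifP => [/hasP [p p_in /Z.eqb_eq p_dvd] _|_].
  have p_ge2 : (2 <= p)%BZ.
    have /allP : all (fun q => (2 <=? q)%BZ)
      [:: 2; 3; 5; 7; 11; 13; 17; 19; 23; 29; 31; 37; 41]%BZ by [].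
    by move=> /(_ _ p_in); lia.
  have p_sq : (Z.to_nat p ^ 2 %| D)%N.
    apply/dvdnP; exists (Z.to_nat (Z.of_nat D / (p * p))%BZ).
    have := Z.div_mod (Z.of_nat D) (p * p); rewrite p_dvd -mulnn => h.
    have : (0 <= Z.of_nat D / (p * p))%BZ by apply: Z.div_pos; nia.
    move: (_ / _)%BZ h => q h q0.
    apply: (can_inj Nat2Z.id); rewrite -!multE !Nat2Z.inj_mul !Z2Nat.id; nia.
  by have := D_sqf p_sq; lia.
case: ifP => [/hasP [k k_in /Z.eqb_eq e] _|_ ok].
  move: k_in D_n235; rewrite -e !inE.
  by lia.
by have [T] := universal_run D_gt1 D_sqf F_eq L_lat L_univ ok.
Qed.

(** The run puts some target inside L; closure under overlattices then makes some target equal to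
    L. *)
Lemma universal_classification fs c oc :
  run (omega_tr D) (omega_nm D) (targets fs) c State0
  && over_closed (omega_tr D) (omega_nm D) [::] (targets fs) oc ->
  exists2 f, List.In f fs & corresponds Q L (phi_form D s f).
Proof.
case/andP=> ok cl.
have [T T_in hT] := universal_run D_gt1 D_sqf F_eq L_lat L_univ ok.
have [U dimU L_U] := lattice_ambient L_lat.
have [_ [e [eL _]] _] := L_lat.
have eL1 v : v \in e -> L v.
  move=> /(nthP 0) [i i_lt <-]; apply/eL.
  exists (fun j : 'I_(size e) => (j == Ordinal i_lt)%:R) => [j|].
    by case: eqP => _; [exact: integral1 | exact: integral0].
  rewrite (bigD1 (Ordinal i_lt)) //= eqxx scale1r big1 ?addr0 // => j /negbTE ->.
  by rewrite scale0r.
have [T' T'_in fT'] := over_closed_sound D_gt1 D_sqf F_eq (lattice_quad L_lat)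
  (lattice_add L_lat) (lattice_scale F_eq L_lat) (lattice_OF D_gt1 D_sqf F_eq L_lat)
  dimU L_U eL1 (fun v => (eL v).1) cl (fun _ h => match h with end) T_in hT.
move: T'_in fT'; rewrite /= /targets => /List.in_map_iff [f [<- f_in]] fl.
by exists f => //; apply: corresponds_full.
Qed.

Lemma phi_omega : phi D s (0, 1)%BZ = omega D s.
Proof. by rewrite /phi /= zr0 zr1 add0r mul1r. Qed.

Lemma gconj_omega : gconj s (omega D s) = phi D s (kconj (omega_tr D) (0, 1)%BZ).
Proof. by rewrite -phi_omega (gconj_phi D_gt1 D_sqf F_eq). Qed.

End Classification.

Lemma zr_pos (R : pzRingType) p : zr R (Zpos p) = (Pos.to_nat p)%:R.
Proof. by []. Qed.
Lemma zr_neg (R : pzRingType) p : zr R (Zneg p) = - (Pos.to_nat p)%:R.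
Proof. by rewrite -[Zneg p]/(Z.opp (Zpos p)) zrN. Qed.


Section FinalForms.

Variables (D : nat) (F : fieldExtType rat) (s : F).
Hypotheses (D_gt1 : (1 < D)%N) (D_sqf : squarefree D).
Hypothesis F_eq : is_quadratic_field D s.

Lemma corresponds_scale (V : vectType F) (Q : V -> F) (L : V -> Prop) k f c phi0 :
  phi D s k = c -> phi_form D s f = phi0 ->
  corresponds Q L (phi_form D s (kform_map (kmul (omega_tr D) (omega_nm D) k) f)) ->
  corresponds Q L (scale_form c phi0).
Proof. by move=> <- <-; rewrite (scale_phi_form F_eq). Qed.

Lemma corresponds_conj (V : vectType F) (Q : V -> F) (L : V -> Prop) f phi0 :
  phi_form D s f = phi0 ->
  corresponds Q L (phi_form D s (kform_map (kconj (omega_tr D)) f)) ->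
  corresponds Q L (conj_form s phi0).
Proof. by move=> <-; rewrite (conj_phi_form D_gt1 D_sqf F_eq). Qed.

Lemma corresponds_eq (V : vectType F) (Q : V -> F) (L : V -> Prop) f phi0 :
  phi_form D s f = phi0 -> corresponds Q L (phi_form D s f) -> corresponds Q L phi0.
Proof. by move=> ->. Qed.

Lemma phi_form_eq f g : phi D s (kxx f) = cxx g -> phi D s (kyy f) = cyy g ->
  phi D s (kzz f) = czz g -> phi D s (kxy f) = cxy g -> phi D s (kxz f) = cxz g ->
  phi D s (kyz f) = cyz g -> phi_form D s f = g.
Proof. by case: g => *; congr TForm. Qed.

End FinalForms.

(** * The norm equations behind non-freeness for D = 10 and D = 65 *)

Section Halves.

Local Open Scope Z_scope.

Lemma square_mod5 a : exists k, a * a = 5 * k \/ a * a = 5 * k + 1 \/ a * a = 5 * k + 4.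
Proof.
have [q [r [-> h]]] : exists q r, a = 5 * q + r /\ - 2 <= r <= 2.
  exists ((a + 2) / 5), ((a + 2) mod 5 - 2).
  by have := Z.div_mod (a + 2) 5; have := Z.mod_pos_bound (a + 2) 5; lia.
exists (5 * (q * q) + 2 * (q * r)).
have : r = -2 \/ r = -1 \/ r = 0 \/ r = 1 \/ r = 2 by lia.
by case=> [|[|[|[|]]]] ->; lia.
Qed.

(** The second equation makes the norm of [r] even, so the first forces $2a^2-5b^2=\pm1$; but $2a^2$
    is 0 or $\pm2$ modulo 5. *)
Lemma no_norm10 r r' a b : knm 0 10 r * knm 0 10 (2 * a + b * 0, b) = 4 ->
  knm 0 10 (0, 1) * knm 0 10 r = 4 * knm 0 10 r' -> False.
Proof.
set k := knm 0 10 r; set k' := knm 0 10 r'; rewrite /knm /= => e1 e2.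
have [q hq] := square_mod5 a.
have e : 2 * (k * (2 * (a * a) - 5 * (b * b))) = 4 by rewrite -e1; ring.
set z := (_ - _) in e; have kj : k = 2 * (- k' - 2 * k) by lia.
set j := (_ - _) in kj; have /Z.mul_eq_1 k_z : z * j = 1 by rewrite kj in e; lia.
by lia.
Qed.

(** As before, $2a^2+3ab-7b^2=\pm1$. Multiplied by 8 this is $(4a+3b)^2-65b^2=\pm8$, impossible
    modulo 5. *)
Lemma no_norm65 r r' a b : knm 1 16 r * knm 1 16 (2 * a + b * 1, b) = 4 ->
  knm 1 16 (1, 1) * knm 1 16 r = 4 * knm 1 16 r' -> False.
Proof.
set k := knm 1 16 r; set k' := knm 1 16 r'; rewrite /knm /= => e1 e2.
have [q hq] := square_mod5 (4 * a + 3 * b).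
have e : 2 * (k * (2 * (a * a) + 3 * (a * b) - 7 * (b * b))) = 4 by rewrite -e1; ring.
set z := (_ - _) in e; have kj : k = 2 * (- k' - 3 * k) by lia.
set j := (_ - _) in kj; have /Z.mul_eq_1 k_z : z * j = 1 by rewrite kj in e; lia.
by lia.
Qed.

End Halves.

(* [phi] of an explicit pair against an explicit expression in s. *)
Ltac coef two_neq0 :=
  rewrite /= /phi /omega /eps6 /eps7 /eps21 /eps33 /eps77 /=;
  rewrite ?zr_pos ?zr_neg ?zr0 ?mul0r ?addr0 ?oppr0 /=;
  repeat match goal with |- context [Pos.to_nat ?p] =>
    let m := eval vm_compute in (Pos.to_nat p) in change (Pos.to_nat p) with m end;
  by [|ring|field; exact: two_neq0].

Ltac coefs two_neq0 := apply: phi_form_eq; coef two_neq0.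

Theorem theorem7p6 (D : nat) (F : fieldExtType rat) (s : F)
    (V : vectType F) (Q : V -> F) (L : V -> Prop)
    (D_gt1 : (1 < D)%N) (D_sqf : squarefree D)
    (D_n235 : D \notin [:: 2; 3; 5]%N)
    (F_eq : is_quadratic_field D s)
    (L_lat : quadratic_lattice 3 Q L)
    (L_pos : totally_positive_definite Q L)
    (L_univ : universal Q L) :
  D \in [:: 6; 7; 10; 13; 17; 21; 33; 41; 65; 77]%N
  /\ (D = 6%N ->
        corresponds Q L (phi6_1 s)
        \/ corresponds Q L (scale_form (eps6 s) (phi6_1 s))
        \/ corresponds Q L (phi6_2 s)
        \/ corresponds Q L (scale_form (eps6 s) (phi6_2 s)))
  /\ (D = 7%N ->
        corresponds Q L (phi7 s)
        \/ corresponds Q L (scale_form (eps7 s) (phi7 s)))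
  /\ (D = 10%N ->
        ~ free_lattice L
        /\ corresponds_with (p2inv10 s) Q L (phi10 s))
  /\ (D = 13%N ->
        corresponds Q L (phi13_24 s)
        \/ corresponds Q L (phi13_12 s)
        \/ corresponds Q L (conj_form s (phi13_12 s))
        \/ corresponds Q L (phi13_h2 s)
        \/ corresponds Q L (conj_form s (phi13_h2 s))
        \/ corresponds Q L (phi13_h3 s)
        \/ corresponds Q L (phi13_nm s)
        \/ corresponds Q L (conj_form s (phi13_nm s)))
  /\ (D = 17%N ->
        corresponds Q L (phi17_1 s)
        \/ corresponds Q L (conj_form s (phi17_1 s))
        \/ corresponds Q L (phi17_2 s)
        \/ corresponds Q L (phi17_3 s)
        \/ corresponds Q L (conj_form s (phi17_3 s))
        \/ corresponds Q L (phi17_nm1 s)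
        \/ corresponds Q L (conj_form s (phi17_nm1 s))
        \/ corresponds Q L (phi17_nm2 s)
        \/ corresponds Q L (conj_form s (phi17_nm2 s))
        \/ corresponds Q L (phi17_nm3 s)
        \/ corresponds Q L (conj_form s (phi17_nm3 s)))
  /\ (D = 21%N ->
        corresponds Q L (phi21 s)
        \/ corresponds Q L (scale_form (eps21 s) (phi21 s)))
  /\ (D = 33%N ->
        corresponds Q L (phi33 s)
        \/ corresponds Q L (scale_form (eps33 s) (phi33 s)))
  /\ (D = 41%N -> corresponds Q L (phi41 s))
  /\ (D = 65%N ->
        ~ free_lattice L
        /\ corresponds_with (p2inv65 s) Q L (phi65 s))
  /\ (D = 77%N ->
        corresponds Q L (phi77 s)
        \/ corresponds Q L (scale_form (eps77 s) (phi77 s))).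
Proof.
have two_neq0 : 2 != 0 :> F by rewrite F_char0.
split; first exact: (universal_listed D_gt1 D_sqf F_eq L_lat L_univ D_n235).
split.
- move=> D_eq; subst D.
  have [f f_in hf] := universal_classification D_gt1 D_sqf F_eq L_lat L_univ check6.
  case: f_in hf => [<-|[<-|[<-|[<-|[]]]]] hf.
  + left; apply: (corresponds_eq _ hf); coefs two_neq0.
  + right; left; apply: (corresponds_scale F_eq _ _ hf); [coef two_neq0|coefs two_neq0].
  + do 2 right; left; apply: (corresponds_eq _ hf); coefs two_neq0.
  + do 3 right; apply: (corresponds_scale F_eq _ _ hf); [coef two_neq0|coefs two_neq0].
split.
- move=> D_eq; subst D.
  have [f f_in hf] := universal_classification D_gt1 D_sqf F_eq L_lat L_univ check7.
  case: f_in hf => [<-|[<-|[]]] hf.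
  + left; apply: (corresponds_eq _ hf); coefs two_neq0.
  + right; apply: (corresponds_scale F_eq _ _ hf); [coef two_neq0|coefs two_neq0].
split.
- move=> D_eq; subst D.
  have eta_def : 2 * (s / 2) = phi 10 s (0, 1)%BZ.
    by coef two_neq0.
  have [ok /andP [dvd res]] := andP check10.
  have [T [<-|[]] hT] := universal_run D_gt1 D_sqf F_eq L_lat L_univ ok.
  have x1 : phi 10 s extra10.1.1 = (s / 2) * phi 10 s (kxz form10).
    by apply: (mulfI two_neq0); rewrite mulrA eta_def -(phi_mul F_eq) -phi_dbl.
  have x2 : phi 10 s extra10.1.2 = (s / 2) * phi 10 s (kyz form10).
    by apply: (mulfI two_neq0); rewrite mulrA eta_def -(phi_mul F_eq) -phi_dbl.
  have x3 : phi 10 s extra10.2 = (s / 2) * phi 10 s (kdbl (kzz form10)).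
    by apply: (mulfI two_neq0); rewrite mulrA eta_def -(phi_mul F_eq) -phi_dbl.
  have [u1 [u2 [u3 [fr bL Qb]]]] := corresponds_half D_gt1 D_sqf F_eq L_lat eta_def hT
    x1 x2 x3 (erefl : (0 < 4)%BZ) dvd res.
  have omega_eta : half_ideal (s / 2) (omega 10 s * (s / 2)).
    exists 5, 0; have s2 : s ^+ 2 = 10 := proj1 F_eq.
    by rewrite /omega /= mulrA -expr2 s2; field; exact: two_neq0.
  split; first exact: (half_not_free D_gt1 D_sqf F_eq eta_def omega_eta fr bL no_norm10).
  clear ok dvd res hT; exists u1, u2, u3; split; [exact: fr | exact: bL |].
  by move=> x y z _ _ _; rewrite Qb; congr eval_form; coefs two_neq0.
split.
- move=> D_eq; subst D.
  have [f f_in hf] := universal_classification D_gt1 D_sqf F_eq L_lat L_univ check13.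
  case: f_in hf => [<-|[<-|[<-|[<-|[<-|[<-|[<-|[<-|[]]]]]]]]] hf.
  + left; apply: (corresponds_eq _ hf);
    rewrite /phi13_24 (gconj_omega D_gt1 D_sqf F_eq); coefs two_neq0.
  + right; left; apply: (corresponds_eq _ hf); coefs two_neq0.
  + do 2 right; left; apply: (corresponds_conj D_gt1 D_sqf F_eq _ hf); coefs two_neq0.
  + do 3 right; left; apply: (corresponds_eq _ hf); coefs two_neq0.
  + do 4 right; left; apply: (corresponds_conj D_gt1 D_sqf F_eq _ hf); coefs two_neq0.
  + do 5 right; left; apply: (corresponds_eq _ hf); coefs two_neq0.
  + do 6 right; left; apply: (corresponds_eq _ hf); coefs two_neq0.
  + do 7 right; apply: (corresponds_conj D_gt1 D_sqf F_eq _ hf); coefs two_neq0.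
split.
- move=> D_eq; subst D.
  have [f f_in hf] := universal_classification D_gt1 D_sqf F_eq L_lat L_univ check17.
  case: f_in hf => [<-|[<-|[<-|[<-|[<-|[<-|[<-|[<-|[<-|[<-|[<-|[]]]]]]]]]]]] hf.
  + left; apply: (corresponds_eq _ hf); coefs two_neq0.
  + right; left; apply: (corresponds_conj D_gt1 D_sqf F_eq _ hf); coefs two_neq0.
  + do 2 right; left; apply: (corresponds_eq _ hf);
    rewrite /phi17_2 (gconj_omega D_gt1 D_sqf F_eq); coefs two_neq0.
  + do 3 right; left; apply: (corresponds_eq _ hf); coefs two_neq0.
  + do 4 right; left; apply: (corresponds_conj D_gt1 D_sqf F_eq _ hf); coefs two_neq0.
  + do 5 right; left; apply: (corresponds_eq _ hf); coefs two_neq0.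
  + do 6 right; left; apply: (corresponds_conj D_gt1 D_sqf F_eq _ hf); coefs two_neq0.
  + do 7 right; left; apply: (corresponds_eq _ hf); coefs two_neq0.
  + do 8 right; left; apply: (corresponds_conj D_gt1 D_sqf F_eq _ hf); coefs two_neq0.
  + do 9 right; left; apply: (corresponds_eq _ hf); coefs two_neq0.
  + do 10 right; apply: (corresponds_conj D_gt1 D_sqf F_eq _ hf); coefs two_neq0.
split.
- move=> D_eq; subst D.
  have [f f_in hf] := universal_classification D_gt1 D_sqf F_eq L_lat L_univ check21.
  case: f_in hf => [<-|[<-|[]]] hf.
  + left; apply: (corresponds_eq _ hf); coefs two_neq0.
  + right; apply: (corresponds_scale F_eq _ _ hf); [coef two_neq0|coefs two_neq0].
split.
- move=> D_eq; subst D.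
  have [f f_in hf] := universal_classification D_gt1 D_sqf F_eq L_lat L_univ check33.
  case: f_in hf => [<-|[<-|[]]] hf.
  + left; apply: (corresponds_eq _ hf); coefs two_neq0.
  + right; apply: (corresponds_scale F_eq _ _ hf); [coef two_neq0|coefs two_neq0].
split.
- move=> D_eq; subst D.
  have [f f_in hf] := universal_classification D_gt1 D_sqf F_eq L_lat L_univ check41.
  case: f_in hf => [<-|[]] hf.
  apply: (corresponds_eq _ hf); coefs two_neq0.
split.
- move=> D_eq; subst D.
  have eta_def : 2 * ((1 + omega 65 s) / 2) = phi 65 s (1, 1)%BZ.
    by coef two_neq0.
  have [ok /andP [dvd res]] := andP check65.
  have [T [<-|[]] hT] := universal_run D_gt1 D_sqf F_eq L_lat L_univ ok.
  have x1 : phi 65 s extra65.1.1 = ((1 + omega 65 s) / 2) * phi 65 s (kxz form65).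
    by apply: (mulfI two_neq0); rewrite mulrA eta_def -(phi_mul F_eq) -phi_dbl.
  have x2 : phi 65 s extra65.1.2 = ((1 + omega 65 s) / 2) * phi 65 s (kyz form65).
    by apply: (mulfI two_neq0); rewrite mulrA eta_def -(phi_mul F_eq) -phi_dbl.
  have x3 : phi 65 s extra65.2 = ((1 + omega 65 s) / 2) * phi 65 s (kdbl (kzz form65)).
    by apply: (mulfI two_neq0); rewrite mulrA eta_def -(phi_mul F_eq) -phi_dbl.
  have [u1 [u2 [u3 [fr bL Qb]]]] := corresponds_half D_gt1 D_sqf F_eq L_lat eta_def hT
    x1 x2 x3 (erefl : (0 < 8)%BZ) dvd res.
  have omega_eta : half_ideal ((1 + omega 65 s) / 2) (omega 65 s * ((1 + omega 65 s) / 2)).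
    (* From $\omega^2=\omega+16$: $\omega(1+\omega)/2=8+\omega=7+2\eta$. *)
    exists 7, 2; have s2 : s ^+ 2 = 65 := proj1 F_eq.
    apply: (mulfI two_neq0); apply: (mulfI two_neq0); rewrite /omega /=.
    have -> : 2 * (2 * ((1 + s) / 2 * ((1 + (1 + s) / 2) / 2))) = (3 + 4 * s + s ^+ 2) / 2.
      by field; exact: two_neq0.
    by rewrite s2; field; exact: two_neq0.
  split; first exact: (half_not_free D_gt1 D_sqf F_eq eta_def omega_eta fr bL no_norm65).
  clear ok dvd res hT; exists u1, u2, u3; split; [exact: fr | exact: bL |].
  by move=> x y z _ _ _; rewrite Qb; congr eval_form; coefs two_neq0.
move=> D_eq; subst D.
have [f f_in hf] := universal_classification D_gt1 D_sqf F_eq L_lat L_univ check77.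
case: f_in hf => [<-|[<-|[]]] hf.
+ left; apply: (corresponds_eq _ hf); coefs two_neq0.
+ right; apply: (corresponds_scale F_eq _ _ hf); [coef two_neq0|coefs two_neq0].
Qed.
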